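(* Let $\mathcal C$ be either (1) the class of oligomorphic closed subgroups of $\mathrm{Sym}(\omega)$ with no algebraicity, or (2) the class of oligomorphic closed subgroups of $\mathrm{Sym}(\omega)$ with finitely many essential subgroups up to conjugacy. Then: (a) The topological isomorphism relation on $\mathcal C$ is smooth. (b) If $G\in\mathcal C$, then $\mathrm{Out}(G)$ is profinite, and $\mathrm{Aut}(G)$ is topologically isomorphic to an oligomorphic closed subgroup of $\mathrm{Sym}(\omega)$.
   Context: $\mathrm{Sym}(\omega)$ is the Polish group of permutations of $\omega$; a neighbourhood basis of $1$ is given by the pointwise stabilisers of finite sets. A subgroup $G\leq\mathrm{Sym}(\omega)$ is oligomorphic if for each $n$ the canonical action of $G$ on $\omega^n$ has only finitely many orbits. No algebraicity: an oligomorphic $G$ has no algebraicity if for each finite set $S\subseteq\omega$, the pointwise stabiliser $G_{(S)}$ has no finite orbits on $\omega\setminus S$. Essential subgroups. Let $G$ be oligomorphic and closed. Above any open subgroup $U$ of $G$ there are only finitely many subgroups of $G$. The depth of an open subgroup $U$ is the minimum of the lengths of maximal chains of subgroups leading from $U$ to $G$ (so $G$ has depth $0$). An open subgroup of $G$ is irreducible if it has no proper open subgroup of finite index. An irreducible open subgroup $H$ is almost essential if every open subgroup of $G$ contains a finite intersection of conjugates of $H$. It is essential if it is almost essential and its depth is minimal among the almost essential subgroups of $G$. Smoothness. The closed subgroups of $\mathrm{Sym}(\omega)$ form a standard Borel space, as a Borel subspace of the Effros space of closed subsets of $\mathrm{Sym}(\omega)$ (whose $\sigma$-algebra is generated by the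 sets $\{F: F\cap W\neq\emptyset\}$, $W$ open); the oligomorphic ones form a Borel subset. An equivalence relation on a Borel class is smooth if it is Borel reducible to the identity relation on $\mathbb R$, i.e. there is a Borel map $f$ from the class to $\mathbb R$ (equivalently, to some standard Borel space) such that two elements are equivalent iff they have the same image under $f$. $\mathrm{Aut}(G)$ denotes the group of continuous automorphisms of $G$, with the (Polish) group topology for which a neighbourhood basis of the identity consists of the subgroups $\{\Phi: \Phi(A_i)=A_i \text{ for } i=1,\dots,n\}$, where $A_1,\dots,A_n$ are cosets of open subgroups of $G$. $\mathrm{Out}(G)=\mathrm{Aut}(G)/\mathrm{Inn}(G)$ has the quotient topology ($\mathrm{Inn}(G)$ is closed in $\mathrm{Aut}(G)$).
   Formalization: In class (2), ''finitely many essential subgroups up to conjugacy'' is taken to mean at least one and finitely many; with none allowed, Out(G) need not be profinite (e.g. G × Z/2 for an oligomorphic G with infinitely many open subgroups of index 2). *)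

(* Defs.v *)
From HB Require Import structures.
From mathcomp Require Import all_boot all_order all_algebra.
From mathcomp Require Import all_classical all_reals all_analysis.

Set Implicit Arguments.
Unset Strict Implicit.
Unset Printing Implicit Defensive.

Local Open Scope classical_set_scope.
Local Open Scope card_scope.
Local Open Scope group_scope.
Local Open Scope quotient_scope.

HB.mixin Record isTopologicalGroup T of Group T & Topological T := {
  mulg_continuous : continuous (fun x : T * T => x.1 * x.2);
  invg_continuous : continuous (fun x : T => x^-1) }.

#[short(type="topGroupType")]
HB.structure Definition TopologicalGroup :=
  {T of isTopologicalGroup T & Group T & Topological T}.

Section subgroups.
Context {T : groupType}.
Implicit Types (H K U : set T) (N : set (set T)).

Definition is_subgroup H :=
  [/\ H 1, (forall x y, H x -> H y -> H (x * y)) & forall x, H x -> H x^-1].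

Record subgroup := Subgroup {
  subgroup_set :> set T;
  subgroupP : is_subgroup subgroup_set }.

Definition lcoset_set (x : T) H : set T := [set x * h | h in H].

Definition conj_set H (g : T) : set T := [set h ^ g | h in H].

Definition finite_index K H := finite_set [set lcoset_set h K | h in H].

(* Bases at 1, consisting of subgroups, of a group topology. *)
Definition subgroup_basis N :=
  [/\ N !=set0, (forall H, N H -> is_subgroup H),
    (forall H K, N H -> N K -> exists2 L, N L & L `<=` H `&` K) &
    (forall H x, N H -> exists2 K, N K & forall k, K k -> H (k ^ x))].

Definition basis_open N : set (set T) :=
  [set V | forall x, V x -> exists2 H, N H & lcoset_set x H `<=` V].

Section basis_open.
Variables (N : set (set T)) (NP : subgroup_basis N).

Lemma basis_openT : basis_open N setT.
Proof. by case: NP => -[H NH] _ _ _ x _; exists H. Qed.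

Lemma basis_openI : setI_closed (basis_open N).
Proof.
move=> A B oA oB x [/oA[H NH HA] /oB[K NK KB]].
have [_ _ /(_ _ _ NH NK)[L NL LHK] _] := NP.
exists L => // _ [y Ly <-]; have [Hy Ky] := LHK _ Ly.
by split; [apply: HA; exists y | apply: KB; exists y].
Qed.

Lemma basis_open_bigU (I : Type) (f : I -> set T) :
  (forall i, basis_open N (f i)) -> basis_open N (\bigcup_i f i).
Proof.
move=> fo x [i _ fix_]; have [H NH Hf] := fo i x fix_.
by exists H => // y /Hf fy; exists i.
Qed.

Lemma basis_open_lcoset x H : N H -> basis_open N (lcoset_set x H).
Proof.
move=> NH _ [h Hh <-]; exists H => // _ [k Hk <-].
have [_ /(_ _ NH)[_ HM _] _ _] := NP.
by exists (h * k); [exact: HM | rewrite mulgA].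
Qed.

End basis_open.
End subgroups.
Arguments subgroup : clear implicits.

HB.factory Record isSubgroupBasis T of Group T := {
  nbhs1_basis : set (set T);
  nbhs1_basisP : subgroup_basis nbhs1_basis }.

HB.builders Context T of isSubgroupBasis T.

Let N : set (set T) := nbhs1_basis.
Let NP : subgroup_basis N := nbhs1_basisP.

HB.instance Definition _ := isOpenTopological.Build T
  (basis_openT NP) (basis_openI NP) (@basis_open_bigU _ N).

Let nbhs_basisE (x : T) (V : set T) :
  nbhs x V <-> exists2 H, N H & lcoset_set x H `<=` V.
Proof.
rewrite nbhsE; split=> [[W [oW Wx] WV]|[H NH HV]].
  by have [H NH HW] := oW _ Wx; exists H => //; exact: subset_trans WV.
exists (lcoset_set x H) => //; split; first exact: (basis_open_lcoset NP).
by have [_ /(_ _ NH)[H1 _ _] _ _] := NP; exists 1; rewrite ?mulg1.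
Qed.

Let mul_continuous : continuous (fun x : T * T => x.1 * x.2).
Proof.
move=> [x y] V /= /nbhs_basisE[H NH HV].
have [_ /(_ _ NH)[_ HM _] _ /(_ _ y NH)[K NK KH]] := NP.
exists (lcoset_set x K, lcoset_set y H).
  by split; apply/nbhs_basisE; [exists K | exists H].
move=> [_ _] /= [[k Kk <-] [h Hh <-]]; apply: HV.
exists (k ^ y * h); first by apply: HM => //; exact: KH.
by rewrite conjgE !mulgA mulgK.
Qed.

Let inv_continuous : continuous (fun x : T => x^-1).
Proof.
move=> x V /= /nbhs_basisE[H NH HV].
have [_ /(_ _ NH)[_ _ HN] _ /(_ _ x^-1 NH)[K NK KH]] := NP.
apply/nbhs_basisE; exists K => // _ [k Kk <-]; apply: HV.
exists ((k ^ x^-1)^-1); first by apply: HN; exact: KH.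
by rewrite -conjVg conjgE invgK invgM !mulgA mulVg mul1g.
Qed.

HB.instance Definition _ :=
  isTopologicalGroup.Build T mul_continuous inv_continuous.

HB.end.

(* A subgroup H is itself a group, on the type set_type H; its topology is the
   subspace topology that the library puts on set_type. *)
Section subgroup_group.
Context {T : groupType} (H : subgroup T).
Implicit Types x y : set_type H.

Let one_subproof : 1 \in (H : set T).
Proof. by apply/mem_set; have [] := subgroupP H. Qed.

Let mul_subproof x y : val x * val y \in (H : set T).
Proof.
by apply/mem_set; have [_ + _] := subgroupP H; apply; exact/set_mem/valP.
Qed.

Let inv_subproof x : (val x)^-1 \in (H : set T).
Proof.
by apply/mem_set; have [_ _] := subgroupP H; apply; exact/set_mem/valP.
Qed.

Definition subgroup_one : set_type H := exist _ 1 one_subproof.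
Definition subgroup_mul x y : set_type H :=
  exist _ (val x * val y) (mul_subproof x y).
Definition subgroup_inv x : set_type H := exist _ (val x)^-1 (inv_subproof x).

Let mulA : associative subgroup_mul.
Proof. by move=> x y z; apply: val_inj; exact: mulgA. Qed.
Let mul1 : left_id subgroup_one subgroup_mul.
Proof. by move=> x; apply: val_inj; exact: mul1g. Qed.
Let mulr1 : right_id subgroup_one subgroup_mul.
Proof. by move=> x; apply: val_inj; exact: mulg1. Qed.
Let mulV : left_inverse subgroup_one subgroup_inv subgroup_mul.
Proof. by move=> x; apply: val_inj; exact: mulVg. Qed.
Let mulrV : right_inverse subgroup_one subgroup_inv subgroup_mul.
Proof. by move=> x; apply: val_inj; exact: mulgV. Qed.

HB.instance Definition _ :=
  isGroup.Build (set_type H) mulA mul1 mulr1 mulV mulrV.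

End subgroup_group.

Section subgroup_topology.
Context {T : topGroupType} (H : subgroup T).

Let val_continuous : continuous (val : set_type H -> T).
Proof. exact: (@initial_continuous (set_type H) T set_val). Qed.

Let mul_continuous : continuous (fun x : set_type H * set_type H => x.1 * x.2).
Proof.
apply: (@continuous_comp_initial (set_type H) _ T set_val) => x.
apply: (@continuous_comp _ _ _
    (fun x : set_type H * set_type H => (val x.1, val x.2))
    (fun x : T * T => x.1 * x.2)); last exact: mulg_continuous.
by apply: cvg_pair => /=; apply: continuous_comp;
  [exact: cvg_fst|exact: val_continuous|exact: cvg_snd|exact: val_continuous].
Qed.

Let inv_continuous : continuous (fun x : set_type H => x^-1).
Proof.
apply: (@continuous_comp_initial (set_type H) _ T set_val) => x.
apply: (@continuous_comp _ _ _ (val : set_type H -> T) (fun x : T => x^-1)).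
  exact: val_continuous.
exact: invg_continuous.
Qed.

HB.instance Definition _ :=
  isTopologicalGroup.Build (set_type H) mul_continuous inv_continuous.

End subgroup_topology.

(* The group of all bijections of X, with f * g = f \o g; no topology yet. *)
Definition bij_group (X : choiceType) : Type :=
  set_type [set f : X -> X | bijective f].

Section bij_group.
Context {X : choiceType}.

HB.instance Definition _ := Choice.on (bij_group X).

Definition bij_fun (f : bij_group X) : X -> X := val f.
Coercion bij_fun : bij_group >-> Funclass.
Implicit Types f g : bij_group X.

Lemma bij_ext f g : f =1 g -> f = g.
Proof. by move=> fg; apply: val_inj; exact/funext. Qed.

Lemma bij_funP f : bijective f. Proof. exact/set_mem/(valP f). Qed.

Definition mk_bij (f : X -> X) (fP : bijective f) : bij_group X :=
  exist _ f (mem_set fP).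

Let bij_inv_subproof f : {g : X -> X | cancel f g /\ cancel g f}.
Proof. by apply: cid; have [g fK gK] := bij_funP f; exists g. Qed.

Definition bij_inv_fun f : X -> X := sval (bij_inv_subproof f).

Lemma bij_invK f : cancel f (bij_inv_fun f).
Proof. by rewrite /bij_inv_fun; case: bij_inv_subproof => ? []. Qed.

Lemma bij_invKV f : cancel (bij_inv_fun f) f.
Proof. by rewrite /bij_inv_fun; case: bij_inv_subproof => ? []. Qed.

Definition bij_one : bij_group X := mk_bij (@inv_bij X id (fun=> erefl)).
Definition bij_mul f g : bij_group X :=
  mk_bij (bij_comp (bij_funP f) (bij_funP g)).
Definition bij_inv f : bij_group X :=
  mk_bij (Bijective (bij_invKV f) (bij_invK f)).

Let mulA : associative bij_mul. Proof. by move=> f g h; exact: bij_ext. Qed.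
Let mul1 : left_id bij_one bij_mul. Proof. by move=> f; exact: bij_ext. Qed.
Let mulr1 : right_id bij_one bij_mul. Proof. by move=> f; exact: bij_ext. Qed.
Let mulV : left_inverse bij_one bij_inv bij_mul.
Proof. by move=> f; apply: bij_ext; exact: bij_invK. Qed.
Let mulrV : right_inverse bij_one bij_inv bij_mul.
Proof. by move=> f; apply: bij_ext; exact: bij_invKV. Qed.

HB.instance Definition _ :=
  isGroup.Build (bij_group X) mulA mul1 mulr1 mulV mulrV.

Lemma bij_mulE f g x : bij_fun (f * g) x = f (g x). Proof. by []. Qed.
Lemma bij_1E x : bij_fun 1 x = x. Proof. by []. Qed.
Lemma bij_VK f : cancel f (bij_fun f^-1). Proof. exact: bij_invK. Qed.
Lemma bij_KV f : cancel (bij_fun f^-1) f. Proof. exact: bij_invKV. Qed.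

Definition pointwise_stab (S : set X) : set (bij_group X) :=
  [set g | forall a, S a -> g a = a].

Definition setwise_stab (C : set (set X)) : set (bij_group X) :=
  [set g | forall A, C A -> g @` A = A].

End bij_group.

Definition sym_omega : Type := bij_group nat.

HB.instance Definition _ := Group.on sym_omega.

Definition sym_basis : set (set sym_omega) :=
  [set pointwise_stab S | S in [set S : set nat | finite_set S]].

Lemma pointwise_stab_subgroup (S : set nat) :
  is_subgroup (pointwise_stab S : set sym_omega).
Proof.
split=> [//|f g fS gS a Sa|f fS a Sa]; first by rewrite bij_mulE gS ?fS.
by rewrite -[in LHS](fS a Sa) bij_VK.
Qed.

Lemma sym_basisP : subgroup_basis sym_basis.
Proof.
split=> [|_ [S _ <-]|_ _ [S fS <-] [S' fS' <-]|_ x [S fS <-]].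
- by exists (pointwise_stab set0), set0 => //=; exact: finite_set0.
- exact: pointwise_stab_subgroup.
- exists (pointwise_stab (S `|` S')).
    by exists (S `|` S') => //=; rewrite finite_setU.
  by move=> f fS2; split=> a Sa; apply: fS2; [left | right].
- exists (pointwise_stab (bij_fun x @` S)); first by exists (bij_fun x @` S) => //; exact: finite_image.
  by move=> k kS a Sa; rewrite conjgE !bij_mulE kS ?bij_VK//; exists a.
Qed.

HB.instance Definition _ := isSubgroupBasis.Build sym_omega sym_basisP.

Definition topological_isomorphism (T T' : topGroupType) (f : T -> T') :=
  [/\ {morph f : x y / x * y}, continuous f &
      exists g : T' -> T, [/\ cancel f g, cancel g f & continuous g]].

Definition topologically_isomorphic (T T' : topGroupType) :=
  exists f : T -> T', topological_isomorphism f.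

Section open_subgroups.
Context {T : topGroupType}.
Implicit Types (H K U : set T).

Definition open_subgroup U := open U /\ is_subgroup U.

(* A right coset U x is the left coset x (U ^ x), so that these are all the
   cosets of open subgroups. *)
Definition open_coset (A : set T) :=
  exists2 U, open_subgroup U & exists x, A = lcoset_set x U.

Definition subgroup_chain U (C : set (set T)) :=
  [/\ C U, C setT, (forall V, C V -> is_subgroup V /\ U `<=` V) &
      total_on C subset].

Definition maximal_subgroup_chain U (C : set (set T)) :=
  subgroup_chain U C /\
  forall C', subgroup_chain U C' -> C `<=` C' -> C' = C.

(* A chain of length d has d + 1 members. *)
Definition has_depth U (d : nat) :=
  (exists2 C, maximal_subgroup_chain U C & C #= `I_d.+1) /\
  forall C e, maximal_subgroup_chain U C -> C #= `I_e.+1 -> d <= e.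

Definition irreducible H :=
  open_subgroup H /\
  forall K, open_subgroup K -> K `<=` H -> finite_index K H -> K = H.

Definition almost_essential H :=
  irreducible H /\
  forall U, open_subgroup U ->
    exists2 F : set T, finite_set F & \bigcap_(g in F) conj_set H g `<=` U.

Definition essential H :=
  almost_essential H /\
  exists2 d, has_depth H d &
    forall K e, almost_essential K -> has_depth K e -> d <= e.

End open_subgroups.

(* "Finitely many" does not include "none" here. An oligomorphic group G with
   infinitely many open subgroups of index 2 has no irreducible open subgroup:
   such a subgroup would lie in all open subgroups of finite index. The same
   holds for G x Z/2, and Out (G x Z/2) is not compact because
   (g, z) |-> (g, z + phi g), for phi in Hom (G, Z/2), maps the open normal
   subgroup G x 1 to infinitely many different subgroups. *)
Definition finitely_many_essential (T : topGroupType) :=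
  (exists H : set T, essential H) /\
  exists2 F : set (set T), finite_set F &
    forall H, essential H -> exists2 K, F K & exists g, H = conj_set K g.

Section automorphisms.
Variable T : topGroupType.

Definition aut_set : set (bij_group T) := [set f | topological_isomorphism f].

Lemma aut_set_subgroup : is_subgroup aut_set.
Proof.
split.
- by split=> //; [move=> x; exact: cvg_id | exists id; split=> // x; exact: cvg_id].
- move=> f f' [fM fc [g [fK gK gc]]] [f'M f'c [g' [f'K g'K g'c]]]; split.
  + by move=> x y; rewrite !bij_mulE f'M fM.
  + by move=> x; apply: continuous_comp; [exact: f'c | exact: fc].
  + exists (g' \o g); split; [exact: can_comp | exact: can_comp |].
    by move=> x; apply: continuous_comp; [exact: gc | exact: g'c].
- move=> f [fM fc [g [fK gK gc]]].
  have gE : bij_fun f^-1 = g.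
    by apply/funext => x; apply: (can_inj fK); rewrite gK bij_KV.
  rewrite /aut_set /= gE; split=> //; last by exists (bij_fun f).
  by move=> x y; apply: (can_inj fK); rewrite fM !gK.
Qed.

(* For Polish T the continuity of the inverse is automatic. *)
Definition aut : Type := set_type (Subgroup aut_set_subgroup).

HB.instance Definition _ := Group.on aut.

Lemma aut_isoP (f : aut) : topological_isomorphism (bij_fun (val f)).
Proof. exact: (set_mem (valP f)). Qed.

Definition aut_basis : set (set aut) :=
  [set val @^-1` setwise_stab C | C in
     [set C : set (set T) | finite_set C /\ C `<=` open_coset]].

Lemma aut_open_coset (f : aut) (A : set T) :
  open_coset A -> open_coset (bij_fun (val f) @` A).
Proof.
case=> U [oU [U1 UM UV]] [x ->].
have [fM fc [g [fK gK gc]]] := aut_isoP f.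
exists (bij_fun (val f) @` U); [split|exists (bij_fun (val f) x)].
- rewrite (_ : _ @` U = g @^-1` U); first exact: open_comp.
  apply/seteqP; split=> [_ [y Uy <-] /=|y /= Uy]; first by rewrite fK.
  by exists (g y).
- have f1 : bij_fun (val f) 1 = 1.
    by apply: (mulgI (bij_fun (val f) 1)); rewrite -fM !mulg1.
  split; first by exists 1.
    by move=> _ _ [a Ua <-] [b Ub <-]; exists (a * b); [exact: UM | rewrite fM].
  move=> _ [a Ua <-]; exists a^-1; first exact: UV.
  by apply: (mulgI (bij_fun (val f) a)); rewrite -fM !mulgV.
- apply/seteqP; split=> [_ [_ [u Uu <-] <-]|_ [_ [u Uu <-] <-]].
    by exists (bij_fun (val f) u); [exists u | rewrite fM].
  by exists (x * u); [exists u | rewrite fM].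
Qed.

Lemma aut_basisP : subgroup_basis aut_basis.
Proof.
split.
- by exists (val @^-1` setwise_stab set0), set0 => //=; split.
- move=> _ [C [_ _] <-]; split=> [A CA|f g fC gC A CA|f fC A CA] /=.
  + by rewrite -[RHS]image_id; apply: eq_imagel.
  + rewrite -[RHS](fC A CA) -[in RHS](gC A CA) image_comp.
    exact: eq_imagel.
  + rewrite -[in LHS](fC A CA) image_comp -[RHS]image_id.
    by apply: eq_imagel => x _ /=; rewrite bij_VK.
- move=> _ _ [C [fC oC] <-] [C' [fC' oC'] <-].
  exists (val @^-1` setwise_stab (C `|` C')).
    exists (C `|` C') => //=; split; first by rewrite finite_setU.
    by move=> A [/oC|/oC'].
  by move=> f fCC'; split=> A CA; apply: fCC'; [left | right].
- move=> _ x [C [fC oC] <-].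
  exists (val @^-1` setwise_stab [set bij_fun (val x) @` A | A in C]).
    exists [set bij_fun (val x) @` A | A in C] => //=; split.
      exact: finite_image.
    by move=> _ [A CA <-]; apply: aut_open_coset; exact: oC.
  move=> k kC A CA /=; have {}kC := kC _ (imageP _ CA).
  transitivity (bij_fun (val x)^-1 @` (bij_fun (val k) @`
      (bij_fun (val x) @` A))); first by rewrite !image_comp.
  rewrite kC image_comp -[RHS]image_id.
  by apply: eq_imagel => a _ /=; rewrite bij_VK.
Qed.

HB.instance Definition _ := isSubgroupBasis.Build aut aut_basisP.

(* With x ^ g = g^-1 * x * g. *)
Definition inn : set aut :=
  [set f | exists g : T, forall x, bij_fun (val f) x = x ^ g].

Lemma inn_subgroup : is_subgroup inn.
Proof.
split=> [|f f' [g fE] [g' f'E]|f [g fE]].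
- by exists 1 => x; rewrite conjg1.
- by exists (g' * g) => x; rewrite conjgM -f'E -fE.
- exists g^-1 => x; apply: (can_inj (bij_VK (val f))).
  by rewrite bij_KV fE conjgKV.
Qed.

Lemma inn_normal (f g : aut) : inn f -> inn (f ^ g).
Proof.
case=> a fE; exists (bij_fun (val g)^-1 a) => x.
have [gM _ _] := aut_isoP g^-1.
have gV y : bij_fun (val g)^-1 y^-1 = (bij_fun (val g)^-1 y)^-1.
  have g1 : bij_fun (val g)^-1 1 = 1.
    by apply: (mulgI (bij_fun (val g)^-1 1)); rewrite -gM !mulg1.
  by apply: (mulgI (bij_fun (val g)^-1 y)); rewrite -gM !mulgV.
rewrite -[x in RHS](bij_VK (val g)) [RHS]conjgE -gV -!gM -[_^-1 * _]conjgE -fE.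
by rewrite conjgE.
Qed.

Definition outer_eq (f g : aut) : bool := `[< inn (f^-1 * g) >].

Lemma outer_eq_refl : reflexive outer_eq.
Proof. by move=> f; apply/asboolP; rewrite mulVg; have [] := inn_subgroup. Qed.

Lemma outer_eq_sym : symmetric outer_eq.
Proof.
move=> f g; have [_ _ innV] := inn_subgroup.
by apply/asboolP/asboolP => /innV; rewrite invgM invgK.
Qed.

Lemma outer_eq_trans : transitive outer_eq.
Proof.
move=> g f h /asboolP fg /asboolP gh; apply/asboolP.
have [_ innM _] := inn_subgroup.
by have := innM _ _ fg gh; rewrite mulgA mulgK.
Qed.

Canonical outer_equiv :=
  EquivRel outer_eq outer_eq_refl outer_eq_sym outer_eq_trans.

Definition out : Type := quotient_topology {eq_quot outer_equiv}.

HB.instance Definition _ := Topological.on out.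
HB.instance Definition _ := Quotient.on out.

Definition out_pi : aut -> out := \pi_out.

Lemma out_piP (f g : aut) : out_pi f = out_pi g <-> inn (f^-1 * g).
Proof.
split=> [fg|fg]; last exact/eqmodP/asboolP.
by apply/asboolP; exact/(@eqmodP _ outer_equiv).
Qed.

Lemma out_reprK : cancel repr out_pi. Proof. exact: reprK. Qed.

Definition out_one : out := out_pi 1.
Definition out_mul (a b : out) : out := out_pi (repr a * repr b).
Definition out_inv (a : out) : out := out_pi (repr a)^-1.

Lemma out_piM (f g : aut) : out_mul (out_pi f) (out_pi g) = out_pi (f * g).
Proof.
have /out_piP fi := out_reprK (out_pi f).
have /out_piP gi := out_reprK (out_pi g).
have [_ innM _] := inn_subgroup; apply/out_piP.
have := innM _ _ gi (inn_normal g fi).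
by rewrite conjgE invgM !mulgA mulgK.
Qed.

Lemma out_piV (f : aut) : out_inv (out_pi f) = out_pi f^-1.
Proof.
have /out_piP fi := out_reprK (out_pi f).
have [_ _ innV] := inn_subgroup; apply/out_piP.
have := inn_normal (repr (out_pi f))^-1 (innV _ fi).
by rewrite conjgE !invgK invgM invgK !mulgA mulgK.
Qed.

Let mulA : associative out_mul.
Proof.
move=> a b c; rewrite -[a]out_reprK -[b]out_reprK -[c]out_reprK.
by rewrite !out_piM mulgA.
Qed.
Let mul1 : left_id out_one out_mul.
Proof. by move=> a; rewrite -[a]out_reprK out_piM mul1g. Qed.
Let mulr1 : right_id out_one out_mul.
Proof. by move=> a; rewrite -[a]out_reprK out_piM mulg1. Qed.
Let mulV : left_inverse out_one out_inv out_mul.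
Proof. by move=> a; rewrite -[a]out_reprK out_piV out_piM mulVg. Qed.
Let mulrV : right_inverse out_one out_inv out_mul.
Proof. by move=> a; rewrite -[a]out_reprK out_piV out_piM mulgV. Qed.

HB.instance Definition _ := isGroup.Build out mulA mul1 mulr1 mulV mulrV.

Let out_pi_continuous : continuous out_pi. Proof. exact: pi_continuous. Qed.

Let mulr_continuous (g : aut) : continuous (fun f : aut => f * g).
Proof.
move=> f; apply: (@continuous_comp _ _ _ (fun f : aut => (f, g))
  (fun x : aut * aut => x.1 * x.2)); last exact: mulg_continuous.
have := @cvg_pair _ _ _ (nbhs f) (nbhs f) (nbhs g) _ _ _ id (fun=> g).
by apply; [exact: cvg_id | exact: cvg_cst].
Qed.

Let out_pi_nbhs (f : aut) (U : set aut) :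
  nbhs f U -> nbhs (out_pi f) (out_pi @` U).
Proof.
rewrite !nbhsE => -[V [oV Vf] VU]; exists (out_pi @` V); last exact: image_subset.
split; last by exists f.
have -> : open (out_pi @` V) = open (out_pi @^-1` (out_pi @` V)) by [].
rewrite (_ : _ @^-1` _ = \bigcup_(i in inn) ((fun f => f * i) @^-1` V)).
  apply: bigcup_open => i _; have /continuousP := @mulr_continuous i.
  exact.
apply/seteqP; split=> [x [y Vy /esym/out_piP xy]|x [i ii /= Vxi]].
  by exists (x^-1 * y) => //=; rewrite mulgA mulgV mul1g.
by exists (x * i) => //; apply/esym/out_piP; rewrite mulgA mulVg mul1g.
Qed.

Let mul_continuous : continuous (fun x : out * out => x.1 * x.2).
Proof.
move=> [a b] V /=; rewrite -[a]out_reprK -[b]out_reprK => abV.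
have : nbhs (repr a * repr b) (out_pi @^-1` V).
  by apply: out_pi_continuous; rewrite -out_piM.
move=> /(@mulg_continuous aut (repr a, repr b))[[A B] /= [nA nB] AB].
exists (out_pi @` A, out_pi @` B) => /=; first by split; exact: out_pi_nbhs.
move=> [_ _] [/= [f Af <-] [g Bg <-]] /=.
by have := AB (f, g) (conj Af Bg); rewrite /= -out_piM.
Qed.

Let inv_continuous : continuous (fun x : out => x^-1).
Proof.
move=> a V /=; rewrite -[a]out_reprK => aV.
have : nbhs (repr a)^-1 (out_pi @^-1` V).
  by apply: out_pi_continuous; rewrite -out_piV.
move=> /(@invg_continuous aut (repr a))/out_pi_nbhs; apply: filterS.
by move=> _ [f /= fV <-]; rewrite [_^-1]out_piV.
Qed.

HB.instance Definition _ :=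
  isTopologicalGroup.Build out mul_continuous inv_continuous.

End automorphisms.

Definition profinite (T : topGroupType) :=
  [/\ compact [set: T], hausdorff_space T & totally_disconnected [set: T]].

Record closed_subgroup := ClosedSubgroup {
  closed_subgroup_sub :> subgroup sym_omega;
  closed_subgroupP : closed (closed_subgroup_sub : set sym_omega) }.

HB.instance Definition _ := gen_eqMixin closed_subgroup.
HB.instance Definition _ := gen_choiceMixin closed_subgroup.

Lemma sym_omega_subgroup : is_subgroup [set: sym_omega].
Proof. by []. Qed.

HB.instance Definition _ := isPointed.Build closed_subgroup
  (@ClosedSubgroup (Subgroup sym_omega_subgroup) closedT).

(* The trace of the Effros sigma-algebra on the closed subgroups. *)
Definition effros : set (set closed_subgroup) :=
  [set [set G : closed_subgroup | G `&` W !=set0] |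
     W in [set W : set sym_omega | open W]].

HB.instance Definition _ :=
  Measurable.copy closed_subgroup (g_sigma_algebraType effros).

(* That C is Borel is part of smoothness; measurable_fun C f is vacuous otherwise. *)
Definition smooth_on (R : realType) (C : set closed_subgroup)
    (E : closed_subgroup -> closed_subgroup -> Prop) :=
  measurable C /\
  exists2 f : closed_subgroup -> R, measurable_fun C f &
    forall G H, C G -> C H -> E G H <-> f G = f H.

Definition tuple_orbit (G : set sym_omega) n (t : n.-tuple nat) : set (n.-tuple nat) :=
  [set map_tuple (bij_fun g) t | g in G].

Definition oligomorphic (G : set sym_omega) :=
  forall n, finite_set [set tuple_orbit G t | t in [set: n.-tuple nat]].

Definition no_algebraicity (G : set sym_omega) :=
  forall S : set nat, finite_set S -> forall a, ~ S a ->
    ~ finite_set [set bij_fun g a | g in G `&` pointwise_stab S].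

Definition no_algebraicity_class : set closed_subgroup :=
  [set G : closed_subgroup | oligomorphic G /\ no_algebraicity G].

Definition finitely_many_essential_class : set closed_subgroup :=
  [set G : closed_subgroup |
    oligomorphic G /\ finitely_many_essential (set_type G)].

Definition closed_subgroup_iso (G H : closed_subgroup) :=
  topologically_isomorphic (set_type G) (set_type H).

(* Main.v *)
(* To a suitable family D of open subgroups of G one attaches the structure of
   all left cosets of members of D, with the relations "A1, ..., An have a common
   point" and "A B is contained in C". If D is closed under conjugation, consists
   of finitely many conjugacy classes, and its finite intersections form a basis
   at 1, then conjugation by G has finitely many orbits on n-tuples of cosets, so
   that this structure is omega-categorical, and by completeness of G every
   isomorphism of such structures comes from a topological isomorphism of groups.
   Hence the first-order theory of the structure, which is a Borel function of G
   because open cosets are coded by finite sets of tuples up to orbits, is a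
   complete invariant; Aut(G) is the automorphism group of the structure; and a
   back-and-forth argument along an ultrafilter makes Out(G) compact.
   For the essential subgroups D is invariant under isomorphism by definition. In
   the absence of algebraicity D is the family of point stabilizers; it is
   invariant because, given an isomorphism from G to H, every point for G is
   interalgebraic with exactly one point for H. *)
Require Import Defs.
From HB Require Import structures.
From mathcomp Require Import all_boot all_order all_algebra.
From mathcomp Require Import all_classical all_reals all_analysis.

Set Implicit Arguments.
Unset Strict Implicit.
Unset Printing Implicit Defensive.

Local Open Scope classical_set_scope.
Local Open Scope group_scope.
Local Open Scope card_scope.

(** * Closed permutation groups *)

(** The elements of the coset structure are sets that vary with [G], so its theory can depend on [G]
    in a Borel way only if they are named uniformly. Codes are finite objects independent of [G],
    and the quantifiers of formulas run over the countable type of codes. Quantifiers over the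
    uncountable group itself disappear because each condition met here depends on [g] and its
    inverse only through finitely many values; what remains are statements [orb G s t], which define
    generators of the Effros sigma-algebra. Inverses need separate care: coherent left cosets of
    point stabilisers pin down only an injection of omega, which may fail to be onto. Right cosets
    control preimages, and closure of the family under conjugation makes them available as left
    cosets of other members. That Out(G) is Hausdorff rests on Inn(G) being closed in Aut(G), which
    in turn comes from each point stabiliser having only finitely many fixed points. *)

Notation gt G := (set_type (subgroup_set (closed_subgroup_sub G))).

Section action.
Context {G : closed_subgroup}.
Implicit Types (g h : gt G) (s t : seq nat).

Definition act g (n : nat) : nat := bij_fun (val g) n.

Lemma actM g h n : act (g * h) n = act g (act h n). Proof. by []. Qed.

Lemma actK g : cancel (act g) (act g^-1).
Proof. by move=> n; rewrite /act [val g^-1]/(val g)^-1; exact: bij_VK. Qed.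

Lemma actKV g : cancel (act g^-1) (act g).
Proof. by move=> n; rewrite /act [val g^-1]/(val g)^-1; exact: bij_KV. Qed.

Lemma act_inj g : injective (act g).
Proof. exact: can_inj (actK g). Qed.

Lemma act_faithful g h : act g =1 act h -> g = h.
Proof. by move=> gh; apply/val_inj/bij_ext. Qed.

Definition acts g s := map (act g) s.

Lemma acts1 s : acts 1 s = s. Proof. exact: map_id. Qed.

Lemma actsM g h s : acts (g * h) s = acts g (acts h s).
Proof. by rewrite /acts -map_comp. Qed.

Lemma actsK g : cancel (acts g) (acts g^-1).
Proof. by move=> s; rewrite -actsM mulVg acts1. Qed.

Lemma actsKV g : cancel (acts g^-1) (acts g).
Proof. by move=> s; rewrite -actsM mulgV acts1. Qed.

Lemma acts_inj g : injective (acts g).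
Proof. exact: can_inj (actsK g). Qed.

Lemma acts_cat g s t : acts g (s ++ t) = acts g s ++ acts g t.
Proof. exact: map_cat. Qed.

Lemma size_acts g s : size (acts g s) = size s. Proof. exact: size_map. Qed.

Lemma acts_eqP g h s : acts g s = acts h s <-> {in s, act g =1 act h}.
Proof. by split=> [/eq_in_map|/eq_in_map]. Qed.

Lemma nbhs_act g (A : set (gt G)) :
  nbhs g A <-> exists s, forall h, acts h s = acts g s -> A h.
Proof.
split.
- case=> B [[W oW <-] Wg WA].
  have [_ [S /finite_seqP[s ->] <-] SW] := oW _ Wg.
  exists s => h /acts_eqP hg; apply: WA; apply: SW.
  exists ((val g)^-1 * val h); last by rewrite mulgA mulgV mul1g.
  by move=> a sa; rewrite bij_mulE; have := hg a sa; rewrite /act => ->; exact: bij_VK.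
- move=> [s sA]; exists (val @^-1` lcoset_set (val g) (pointwise_stab [set` s])).
  split=> [||h [k ks /= kE]].
  + exists (lcoset_set (val g) (pointwise_stab [set` s])) => //.
    apply: (basis_open_lcoset sym_basisP).
    by exists [set` s] => //=; exact: finite_seq.
  + exists 1; last by rewrite mulg1.
    by have [] := pointwise_stab_subgroup [set` s].
  + apply: sA; apply/acts_eqP => a sa.
    by have := congr1 (fun x : sym_omega => bij_fun x a) kE; rewrite /act bij_mulE ks// => <-.
Qed.

End action.

(** A pointwise limit of permutations is injective but may miss points; eventual constancy of
    preimages supplies the inverse. The limit lies in [G] because [G] is closed. *)
Lemma closed_subgroup_limit (G : closed_subgroup) (F : set (set (gt G))) :
    ProperFilter F ->
    (forall b, exists c, F [set g | act g b = c]) ->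
    (forall b, exists c, F [set g | act g c = b]) ->
  exists g : gt G, forall s, F [set h | acts h s = acts g s].
Proof.
move=> PF /choice[f Ff] /choice[f' Ff'].
have f'K : cancel f' f.
  move=> b; have [g [<- gb]] := filter_ex (filterI (Ff (f' b)) (Ff' b)).
  exact: gb.
have fK : cancel f f'.
  move=> b; have [g [gb gb']] := filter_ex (filterI (Ff b) (Ff' (f b))).
  by apply: (@act_inj _ g); rewrite gb gb'.
pose x : sym_omega := mk_bij (Bijective fK f'K).
have Fx s : F [set h : gt G | map (bij_fun (val h)) s = map (bij_fun x) s].
  elim: s => [|b s IHs]; first by apply: filterS filterT.
  by apply: filterS (filterI (Ff b) IHs) => h [hb hs]; exact: congr2 hb hs.
suff Gx : (G : set sym_omega) x.
  by exists (exist _ x (mem_set Gx)) => s; exact: Fx.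
apply: closed_subgroupP => B; rewrite nbhsE => -[W [oW Wx] WB].
have [_ [S /finite_seqP[s ->] <-] SW] := oW _ Wx.
have [g /= gs] := filter_ex (Fx s); exists (val g); split.
  exact/set_mem/(valP g).
apply: WB; apply: SW; exists (x^-1 * val g); last by rewrite mulgA mulgV mul1g.
by move/eq_in_map: gs => gs a sa; rewrite bij_mulE gs//; exact: bij_VK.
Qed.

Section group_sets.
Context {T : groupType}.
Implicit Types (x y g : T) (H K U : set T).

Lemma lcosetE x H : lcoset_set x H = [set y | H (x^-1 * y)].
Proof.
apply/seteqP; split=> [_ [h Hh <-] /=|y /= Hy]; first by rewrite mulKg.
by exists (x^-1 * y) => //; rewrite mulVKg.
Qed.

Lemma conj_setE H g : conj_set H g = [set y | H (y ^ g^-1)].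
Proof.
apply/seteqP; split=> [_ [h Hh <-] /=|y /= Hy]; first by rewrite conjgK.
by exists (y ^ g^-1) => //; rewrite conjgKV.
Qed.

Lemma conj_set1 H : conj_set H 1 = H.
Proof. by rewrite conj_setE invg1; apply/seteqP; split=> y /=; rewrite conjg1. Qed.

Lemma conj_setM H x y : conj_set H (x * y) = conj_set (conj_set H x) y.
Proof.
rewrite !conj_setE; apply/seteqP.
by split=> z /=; rewrite invgM conjgM.
Qed.

Lemma conj_setK g : cancel (@conj_set T ^~ g) (@conj_set T ^~ g^-1).
Proof. by move=> H; rewrite -conj_setM mulgV conj_set1. Qed.

Lemma conj_setKV g : cancel (@conj_set T ^~ g^-1) (@conj_set T ^~ g).
Proof. by move=> H; rewrite -conj_setM mulVg conj_set1. Qed.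

Lemma lcoset_set_eq x y U : is_subgroup U -> lcoset_set x U y ->
  lcoset_set x U = lcoset_set y U.
Proof.
move=> [U1 UM UV]; rewrite !lcosetE /= => Uxy; apply/seteqP; split=> z /= Uz.
  have := UM _ _ (UV _ Uxy) Uz.
  by rewrite invgM invgK mulgA -(mulgA _ x) mulgV mulg1.
have := UM _ _ Uxy Uz; by rewrite mulgA -(mulgA _ y) mulgV mulg1.
Qed.

Lemma lcoset_set_refl x U : is_subgroup U -> lcoset_set x U x.
Proof. by case=> U1 _ _; exists 1 => //; rewrite mulg1. Qed.

Lemma conj_set_subgroup U g : is_subgroup U -> is_subgroup (conj_set U g).
Proof.
move=> [U1 UM UV]; rewrite conj_setE; split=> /=; first by rewrite conj1g.
  by move=> x y Ux Uy; rewrite conjMg; exact: UM.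
by move=> x Ux; rewrite conjVg; exact: UV.
Qed.

Lemma conj_lcoset x U g :
  conj_set (lcoset_set x U) g = lcoset_set (x ^ g) (conj_set U g).
Proof.
rewrite !lcosetE !conj_setE; apply/seteqP.
by split=> y /=; rewrite conjMg conjVg conjgK.
Qed.

Lemma conj_set_id U g : is_subgroup U -> U g -> conj_set U g = U.
Proof.
move=> [U1 UM UV] Ug; apply/seteqP; split=> [_ [h Uh <-]|h Uh].
  rewrite conjgE; by apply: (UM); [exact: UV|exact: UM].
exists (h ^ g^-1); last exact: conjgKV.
by rewrite conjgE invgK; apply: (UM) => //; apply: UM => //; exact: UV.
Qed.

Lemma lcoset_setM x y U : is_subgroup U -> U y ->
  lcoset_set (x * y) U = lcoset_set x U.
Proof.
by move=> sU Uy; apply/esym/lcoset_set_eq => //; rewrite lcosetE /= mulKg.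
Qed.

End group_sets.

Section orbits.
Variable G : closed_subgroup.
Implicit Types (g h : gt G) (s t : seq nat) (A U V W : set (gt G)).

Definition orb s t := exists g : gt G, acts g s = t.

Lemma orb_refl s : orb s s. Proof. by exists 1; rewrite acts1. Qed.

Lemma orb_sym s t : orb s t -> orb t s.
Proof. by case=> g <-; exists g^-1; rewrite actsK. Qed.

Lemma orb_trans t s r : orb s t -> orb t r -> orb s r.
Proof. by case=> g <- [h <-]; exists (h * g); rewrite actsM. Qed.

(** Sequences replace tuples so that orbit representatives of all lengths lie in one countable type
    and the condition has only countable quantifiers over the data. *)
Lemma oligomorphicP : oligomorphic G <->
  forall n, exists ts : seq (seq nat),
    forall s, size s = n -> exists2 t, t \in ts & orb t s.
Proof.
split=> olG n.
  have /finite_seqP[os osE] := olG n.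
  have /choice[f fE] (o : set (n.-tuple nat)) : exists t : seq nat,
      o \in os -> exists2 u : n.-tuple nat, tval u = t & o = tuple_orbit G u.
    case: (boolP (o \in os)) => [oos|_]; last by exists [::].
    have : [set` os] o by [].
    by rewrite -osE => -[t _ <-]; exists t => _; exists t.
  exists (map f os) => s sn.
  pose u : n.-tuple nat := tcast sn (in_tuple s).
  have us : tval u = s by rewrite val_tcast.
  have uos : tuple_orbit G u \in os.
    by have : [set tuple_orbit G t | t in setT] (tuple_orbit G u); [exists u | rewrite osE].
  exists (f (tuple_orbit G u)); first exact: map_f.
  have [v vE uE] := fE _ uos.
  have : tuple_orbit G u u.
    exists 1; first by have [] := subgroupP G.
    by apply: val_inj; exact: map_id.
  rewrite {1}uE => -[g Gg gv].
  exists (exist _ g (mem_set Gg)); rewrite -vE -us -gv; exact: erefl.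
have [ts tsP] := olG n.
apply: (@sub_finite_set _ _ (@tuple_orbit G n @` (@tval n nat @^-1` [set` ts]))).
  move=> _ [t _ <-]; have [u uts [g gu]] := tsP t (size_tuple t).
  have un : size u = n by rewrite -(size_acts g) gu size_tuple.
  exists (tcast un (in_tuple u)); first by rewrite /= val_tcast.
  have GP := subgroupP G.
  have tE : t = map_tuple (bij_fun (val g)) (tcast un (in_tuple u)).
    by apply: val_inj; rewrite /= val_tcast -gu.
  have Gg : (G : set _) (val g) := set_mem (valP g).
  rewrite tE; apply/seteqP; split=> _ [h Gh <-].
    exists (h * (val g)^-1).
      by have [_ + GV] := GP; apply => //; exact: GV.
    apply: val_inj; rewrite /= -map_comp; apply: eq_map => a /=.
    by rewrite bij_mulE bij_VK.
  exists (h * val g); first by have [_ + _] := GP; apply.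
  by apply: val_inj; rewrite /= -map_comp.
apply/finite_image/finite_preimage; last exact: finite_seq.
by move=> ? ? _ _; exact: val_inj.
Qed.

Lemma open_acts A : open A <->
  forall g, A g -> exists s, forall h, acts h s = acts g s -> A h.
Proof.
rewrite openE; split=> oA g Ag; first by have /nbhs_act := oA g Ag.
by apply/nbhs_act; exact: oA.
Qed.

Definition stab s : set (gt G) := [set g | acts g s = s].

Lemma stab_subgroup s : is_subgroup (stab s).
Proof.
split; rewrite /stab /=; first exact: acts1.
  by move=> g h gs hs; rewrite actsM hs.
by move=> g gs; rewrite -[in LHS]gs actsK.
Qed.

Lemma stabP s g : stab s g <-> forall a, a \in s -> act g a = a.
Proof. by have := acts_eqP g 1 s; rewrite acts1. Qed.

Lemma stab_cat s t : stab (s ++ t) = stab s `&` stab t.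
Proof.
apply/seteqP; split=> g; rewrite /stab /= acts_cat.
  by move/eqP; rewrite eqseq_cat ?size_acts// => /andP[/eqP-> /eqP->].
by move=> [-> ->].
Qed.

Lemma acts_stab g h s : acts h s = acts g s <-> stab s (g^-1 * h).
Proof.
rewrite /stab /= actsM; split=> [->|hs]; first by rewrite actsK.
by apply: (@acts_inj _ g^-1); rewrite hs actsK.
Qed.

Lemma open_stab s : open (stab s).
Proof.
apply/open_acts => g gs; exists s => h; rewrite /stab /= => ->; exact: gs.
Qed.

Lemma open_subgroup_stab U :
  open_subgroup U <-> is_subgroup U /\ exists s, stab s `<=` U.
Proof.
split=> [[oU sU]|[sU [s sUs]]].
  split=> //; have [U1 _ _] := sU.
  have [s sP] := (open_acts U).1 oU _ U1.
  by exists s => g gs; apply: sP; rewrite acts1; exact: gs.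
split=> //; apply/open_acts => g Ug; exists s => h /acts_stab /sUs Ugh.
by have [_ UM _] := sU; rewrite -(mulVKg g h); exact: UM.
Qed.

Lemma stab_open_subgroup s : open_subgroup (stab s).
Proof. by split; [exact: open_stab | exact: stab_subgroup]. Qed.

Lemma open_subgroupI U V :
  open_subgroup U -> open_subgroup V -> open_subgroup (U `&` V).
Proof.
move=> [oU [U1 UM UV]] [oV [V1 VM VV]]; split; first exact: openI.
by split=> // [x y [] ? ? [] ? ?|x [] ? ?]; split; auto.
Qed.

Lemma open_lcoset x U : open_subgroup U -> open (lcoset_set x U).
Proof.
move=> oU; have /open_subgroup_stab[[_ UM _] [s sU]] := oU.
rewrite lcosetE; apply/open_acts => g /= Ug; exists s => h /acts_stab /sU Ugh.
by rewrite -(mulVKg g h) mulgA; exact: UM.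
Qed.

Lemma act_conj g x y s : acts (x ^ g) s = acts (y ^ g) s <->
  acts x (acts g s) = acts y (acts g s).
Proof.
rewrite !conjgE !actsM; split=> [/(@acts_inj _ _)//|->//].
Qed.

Lemma conj_set_open_subgroup U g :
  open_subgroup U -> open_subgroup (conj_set U g).
Proof.
move=> /open_subgroup_stab[sU [s sUs]]; apply/open_subgroup_stab.
split; first exact: conj_set_subgroup.
exists (acts g^-1 s) => h hs; rewrite conj_setE /=; apply: sUs.
rewrite /stab /= conjgE invgK !actsM.
by apply: (@acts_inj _ g^-1); rewrite actsK; exact: hs.
Qed.

Hypothesis olG : oligomorphic G.

(** If [V] contains [stab s] and [W] contains [stab r], the orbit of [s ++ acts g r] determines the
    double coset [V g W]: an [h] carrying [s ++ acts x r] to [s ++ acts g r] lies in [V], and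
    [(h x)^-1 g] fixes [r]. *)
Lemma double_cosets_finite V W : open_subgroup V -> open_subgroup W ->
  exists xs : seq (gt G), forall g,
    exists v x w, [/\ V v, x \in xs, W w & g = v * x * w].
Proof.
move=> oV oW.
have /open_subgroup_stab[[_ VM VV] [s sV]] := oV.
have /open_subgroup_stab[[_ WM WV] [r rW]] := oW.
have [ts tsP] := oligomorphicP.1 olG (size s + size r).
have /choice[f fP] (t : seq nat) : exists x : gt G,
    (exists g, orb t (s ++ acts g r)) -> orb t (s ++ acts x r).
  by have [[g gP]|tP] := pselect (exists g, orb t (s ++ acts g r));
    [exists g | exists 1 => /tP].
exists (map f ts) => g.
have [|t tts tP] := tsP (s ++ acts g r); first by rewrite size_cat size_acts.
have fr := fP t (ex_intro _ g tP).
have [h] := orb_trans (orb_sym fr) tP.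
rewrite acts_cat => /eqP; rewrite eqseq_cat ?size_acts// => /andP[/eqP hs /eqP hr].
exists h, (f t), ((f t)^-1 * h^-1 * g); split.
- exact: sV.
- exact: map_f.
- by apply: rW; rewrite /stab /= !actsM -hr !actsK.
- by rewrite -!mulgA mulVKg mulVKg.
Qed.

End orbits.

(** * The coset structure *)

Section coset_structure.
Variable G : closed_subgroup.
Implicit Types (g h x y : gt G) (A B C U V W : set (gt G)) (D : set (set (gt G))).

Definition admissible D :=
  [/\ forall U, D U -> open_subgroup U,
      forall U g, D U -> D (conj_set U g),
      forall V, open_subgroup V -> exists2 Us : seq (set (gt G)),
        forall U, U \in Us -> D U &
        forall g, (forall U, U \in Us -> U g) -> V g &
      exists2 Ks : seq (set (gt G)), forall K, K \in Ks -> D K &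
        forall U, D U -> exists2 K, K \in Ks & exists g, U = conj_set K g].

Definition Dcoset D : set (set (gt G)) :=
  [set A | exists2 U, D U & exists x, A = lcoset_set x U].

Definition meet (As : seq (set (gt G))) := exists x, forall A, A \in As -> A x.

Definition prodsub A B C := forall x y, A x -> B y -> C (x * y).

Variable D : set (set (gt G)).
Hypothesis admD : admissible D.

Let Dsub U : D U -> is_subgroup U.
Proof. by have [DO _ _ _] := admD; move/DO => -[]. Qed.

Lemma Dcoset_sub U : D U -> Dcoset D U.
Proof.
move=> DU; exists U => //; exists 1; rewrite lcosetE.
by apply/seteqP; split=> y /=; rewrite invg1 mul1g.
Qed.

Lemma Dcoset_lcoset U x : D U -> Dcoset D (lcoset_set x U).
Proof. by move=> DU; exists U => //; exists x. Qed.

Lemma Dcoset_conj A g : Dcoset D A -> Dcoset D (conj_set A g).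
Proof.
have [_ DJ _ _] := admD.
move=> [U DU [x ->]]; rewrite conj_lcoset; exact/Dcoset_lcoset/DJ.
Qed.

(** The right coset [U x] is a left coset of the conjugate [U ^ x], hence belongs to the
    structure. *)
Lemma Dcoset_rcoset U x : D U ->
  exists2 A, Dcoset D A & [/\ A x, prodsub U A A &
    forall y, A y -> U (y * x^-1)].
Proof.
move=> DU; have [_ DJ _ _] := admD; have sU := Dsub DU.
have [U1 UM UV] := sU.
exists (lcoset_set x (conj_set U x)); first exact/Dcoset_lcoset/DJ.
rewrite lcosetE conj_setE; split=> /=.
- by rewrite mulVg conj1g.
- move=> u y /= Uu; rewrite !conjgE invgK !mulgA !mulgV !mul1g -!mulgA => Uy.
  exact: UM.
- by move=> y /=; rewrite conjgE invgK !mulgA mulgV mul1g.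
Qed.

Lemma Dcoset_open A : Dcoset D A -> open A.
Proof.
have [DO _ _ _] := admD.
by move=> [U /DO oU [x ->]]; exact: open_lcoset.
Qed.

Lemma Dcoset_lcosetE A x : Dcoset D A -> A x -> exists2 U, D U & A = lcoset_set x U.
Proof.
move=> [U DU [y ->]] yUx; exists U => //; exact: lcoset_set_eq (Dsub DU) yUx.
Qed.

Lemma Dcoset_ex A : Dcoset D A -> exists x, A x.
Proof. by move=> [U DU [y ->]]; exists y; exact/lcoset_set_refl/Dsub. Qed.

(* For a coset [A = x U], [x * x] lies in [A] only if [x] lies in [U]. *)
Lemma Dcoset_subgroup A : Dcoset D A -> prodsub A A A -> D A.
Proof.
move=> [U DU [x AE]] AAA; have sU := Dsub DU; have [_ UM UV] := sU.
have Ax : A x by rewrite AE; exact: lcoset_set_refl.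
have := AAA _ _ Ax Ax; rewrite {1}AE lcosetE /= mulKg => Ux.
suff -> : A = U by [].
rewrite AE (@lcoset_set_eq _ x 1) //; last by rewrite lcosetE /= mulg1; exact: UV.
by rewrite lcosetE; apply/seteqP; split=> y /=; rewrite invg1 mul1g.
Qed.

Hypothesis olG : oligomorphic G.

(** Conjugation by [V] normalises a coset [a U] in two moves. The double cosets of [V] and the
    representatives [K] bring [U] to one of finitely many subgroups [U']. Then the intersection of
    [V] and [U'], whose elements fix [U'] under conjugation, brings the coset to a finite list
    through its double cosets with [U']. *)
Lemma Dcoset_conj_finite V : open_subgroup V ->
  exists2 As : seq (set (gt G)), forall A, A \in As -> Dcoset D A &
    forall A, Dcoset D A -> exists2 B, B \in As & exists2 v, V v & A = conj_set B v.
Proof.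
move=> oV; have [DO DJ _ [Ks KsD KsP]] := admD.
have [_ [V1 VM VV]] := oV.
have H1 K : exists xs : seq (gt G), K \in Ks -> forall g, exists v x k,
    [/\ V v, x \in xs, K k & g = v * x * k].
  have [KKs|KKs] := boolP (K \in Ks); last by exists [::].
  have [xs xsP] := double_cosets_finite olG oV (DO _ (KsD _ KKs)).
  by exists xs.
have [xs xsP] := choice H1.
have H2 U : exists ys : seq (gt G), D U -> forall g, exists v y u,
    [/\ (V `&` U) v, y \in ys, U u & g = v * y * u].
  have [DU|DU] := pselect (D U); last by exists [::].
  have [ys ysP] := double_cosets_finite olG (open_subgroupI oV (DO _ DU)) (DO _ DU).
  by exists ys.
have [ys ysP] := choice H2.
pose L := flatten [seq flatten [seq [seq lcoset_set y (conj_set K x^-1) |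
   y <- ys (conj_set K x^-1)] | x <- xs K] | K <- Ks].
exists L.
  move=> A /flattenP[_ /mapP[K KKs ->] /flattenP[_ /mapP[x _ ->] /mapP[y _ ->]]].
  exact/Dcoset_lcoset/DJ/KsD.
move=> A [U DU [a AE]].
have [K KKs [g UE]] := KsP _ DU.
have [v [x [k [Vv xx Kk gE]]]] := xsP _ KKs g^-1.
have DK := KsD _ KKs.
pose U' := conj_set K x^-1.
have DU' : D U' by exact: DJ.
have KJ : conj_set K k^-1 = K.
  by apply: conj_set_id; [exact: Dsub|have [_ _ KV] := Dsub DK; exact: KV].
have UE' : U = conj_set U' v^-1.
  by rewrite UE /U' -[g]invgK gE !invgM conj_setM KJ conj_setM.
have [w [y [u [[Vw Uw] yy Uu aE]]]] := ysP _ DU' (a ^ v).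
exists (lcoset_set y U').
  apply/flattenP; exists (flatten [seq [seq lcoset_set y (conj_set K x^-1) |
   y <- ys (conj_set K x^-1)] | x <- xs K]); first exact: map_f.
  apply/flattenP; exists [seq lcoset_set y (conj_set K x^-1) |
   y <- ys (conj_set K x^-1)]; first exact: (map_f (fun x => [seq lcoset_set y (conj_set K x^-1) |
   y <- ys (conj_set K x^-1)])).
  exact: map_f.
exists (w^-1 * v^-1); first by apply: VM; exact: VV.
rewrite conj_setM AE UE' -[a](conjgK v) -conj_lcoset; congr conj_set.
have sU' := Dsub DU'.
have [_ UM UV] := sU'.
rewrite conj_lcoset conj_set_id//; last exact: UV.
rewrite aE lcoset_setM// conjgE invgK mulgA (lcoset_setM (w * y))//; exact: UV.
Qed.

Lemma Dcoset_singleton x y :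
  (forall U, D U -> exists z, lcoset_set z U x /\ lcoset_set z U y) -> x = y.
Proof.
move=> xy; apply: act_faithful => b; have [_ _ Dsm _] := admD.
have [Us UsD UsP] := Dsm _ (@stab_open_subgroup G [:: b]).
suff : stab [:: b] (x^-1 * y).
  by rewrite /stab /= => -[xyb]; rewrite -[in LHS]xyb actM actKV.
apply: UsP => U UUs; have [z] := xy _ (UsD _ UUs).
have [_ UM UV] := Dsub (UsD _ UUs).
rewrite lcosetE /= => -[Ux Uy].
have := UM _ _ (UV _ Ux) Uy.
by rewrite invgM invgK mulgA -(mulgA _ z) mulgV mulg1.
Qed.

End coset_structure.

Lemma filter_seq (T : Type) (I : eqType) (F : set (set T)) (s : seq I)
    (f : I -> set T) : Filter F -> (forall i, i \in s -> F (f i)) ->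
  F [set x | forall i, i \in s -> f i x].
Proof.
move=> FF; elim: s => [|i s IHs] sF; first by apply: filterS filterT.
have Fi : F (f i) by apply: sF; rewrite mem_head.
have Fs : F [set x | forall i, i \in s -> f i x].
  by apply: IHs => j js; apply: sF; rewrite inE js orbT.
apply: filterS (filterI Fi Fs) => x [fi fs] j.
by rewrite inE => /predU1P[->|/fs].
Qed.

(** * Isomorphisms of coset structures come from topological isomorphisms *)

Section reconstruction.
Variables (G H : closed_subgroup) (D : set (set (gt G))) (E : set (set (gt H))).
Hypotheses (admD : admissible D) (admE : admissible E).
Variables (p : set (gt G) -> set (gt H)) (q : set (gt H) -> set (gt G)).
Hypotheses (pX : forall A, Dcoset D A -> Dcoset E (p A))
  (qX : forall B, Dcoset E B -> Dcoset D (q B))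
  (pK : forall A, Dcoset D A -> q (p A) = A)
  (qK : forall B, Dcoset E B -> p (q B) = B).
Hypothesis p_meet : forall As, (forall A, A \in As -> Dcoset D A) ->
  meet As -> meet (map p As).
Hypothesis p_prod : forall A B C, Dcoset D A -> Dcoset D B -> Dcoset D C ->
  prodsub A B C <-> prodsub (p A) (p B) (p C).

Let Dsub U : D U -> is_subgroup U.
Proof. by have [DO _ _ _] := admD; move/DO => -[]. Qed.

Let Esub U : E U -> is_subgroup U.
Proof. by have [DO _ _ _] := admE; move/DO => -[]. Qed.

Lemma prodsub_sub T (U : set (gt T)) : is_subgroup U -> prodsub U U U.
Proof. by case. Qed.

(** Among cosets, the subgroups are those closed under products, a condition that [p] reflects. *)
Lemma reconstruct_q V : E V -> D (q V).
Proof.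
move=> EV; have XV := Dcoset_sub EV; have XqV := qX XV.
apply: (Dcoset_subgroup admD) => //; apply/p_prod => //.
by rewrite qK//; exact: prodsub_sub (Esub EV).
Qed.

(** With [U = q V], take [A = g U] and write [p A = y0 W]. Then [A (q W)] is contained in [A], and
    cancelling [g] on the left gives that [U (q W)] is contained in [U]. Applying [p], [V W] is
    contained in [V], so [W] is contained in [V]. *)
Lemma reconstruct_left g V : E V -> exists2 A, Dcoset D A & A g /\
  forall y z, p A y -> p A z -> V (y^-1 * z).
Proof.
move=> EV; have DU := reconstruct_q EV; set U := q V in DU.
have XV := Dcoset_sub EV; have [V1 VM VV] := Esub EV.
exists (lcoset_set g U); first exact: Dcoset_lcoset.
split; first exact/lcoset_set_refl/Dsub.
set A := lcoset_set g U; have XA : Dcoset D A by exact: Dcoset_lcoset.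
have [W EW [y0 AE]] := pX XA.
have [W1 WM WV] := Esub EW.
have XW := Dcoset_sub EW; have XqW := qX XW.
have XU := Dcoset_sub DU.
have UWU : prodsub U (q W) U.
  have AWA : prodsub A (q W) A.
    apply/p_prod => //; rewrite qK// AE lcosetE => x y /= Wx Wy.
    by rewrite mulgA; exact: WM.
  have [U1 UM UV] := Dsub DU.
  move=> u w Uu qWw; apply: UM => //.
  have Ag : A g by exact/lcoset_set_refl/Dsub.
  by have := AWA _ _ Ag qWw; rewrite /A lcosetE /= mulKg.
have WV' w : W w -> V w.
  move=> Ww; have := (p_prod XU XqW XU).1 UWU; rewrite !qK// => /(_ 1 w V1 Ww).
  by rewrite mul1g.
move=> y z; rewrite AE lcosetE /= => Wy Wz; apply: WV'.
have := WM _ _ (WV _ Wy) Wz.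
by rewrite invgM invgK mulgA -(mulgA _ y0) mulgV mulg1.
Qed.

(** The mirror image, with the right coset [A = U g]: now [p A] is rewritten as a right coset
    [W' y0], and [W' V] being contained in [V] forces [W'] into [V]. *)
Lemma reconstruct_right g V : E V -> exists2 A, Dcoset D A & A g /\
  forall y z, p A y -> p A z -> V (z * y^-1).
Proof.
move=> EV; have DU := reconstruct_q EV; set U := q V in DU.
have XV := Dcoset_sub EV; have [V1 VM VV] := Esub EV.
have [A XA [Ag _ AU]] := Dcoset_rcoset admD g DU.
exists A => //; split=> // y z Ay Az.
have [W EW] := pX XA; have [W1 WM WV] := Esub EW.
move=> [y0 AE].
have [y1 pAy1] := Dcoset_ex admE (pX XA).
pose W' := conj_set W y0^-1.
have EW' : E W' by have [_ EJ _ _] := admE; exact: EJ.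
have AW' x : p A x -> W' (x * y0^-1).
  rewrite AE lcosetE /W' conj_setE /= invgK conjgE.
  by rewrite mulgVK.
have XW' := Dcoset_sub EW'; have XqW' := qX XW'; have XU := Dcoset_sub DU.
have [W'1 W'M W'V] := Esub EW'.
have WAA : prodsub (q W') A A.
  apply/p_prod => //; rewrite qK// => w x W'w Ax.
  have := W'M _ _ W'w (AW' _ Ax).
  rewrite AE lcosetE /W' conj_setE /= invgK conjgE.
  by rewrite -mulgA -mulgA !mulVg mulg1 mulgA.
have WUU : prodsub (q W') U U.
  have [U1 UM UV] := Dsub DU.
  move=> w u Ww Uu; apply: UM => //.
  by have := AU _ (WAA _ _ Ww Ag); rewrite mulgK.
have WV' w : W' w -> V w.
  move=> Ww; have := (p_prod XqW' XU XU).1 WUU; rewrite !qK// => /(_ w 1 Ww V1).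
  by rewrite mulg1.
apply: WV'; have := W'M _ _ (AW' _ Az) (W'V _ (AW' _ Ay)).
by rewrite invgM invgK -mulgA mulKg.
Qed.

(* [h] is the limit of the filter generated by the [p A] with [g] in [A]. Left
   and right cosets are both needed to converge to a permutation. *)
Lemma reconstruct_ex g : exists h : gt H, forall A, Dcoset D A -> A g -> p A h.
Proof.
have [_ _ Esm _] := admE.
pose I : set (seq (set (gt G))) := [set As | forall A, A \in As -> Dcoset D A /\ A g].
pose B (As : seq (set (gt G))) : set (gt H) := [set y | forall A, A \in As -> p A y].
have PF : ProperFilter (filter_from I B).
  apply: filter_from_proper.
    apply: filter_from_filter; first by exists [::].
    move=> As As' IAs IAs'; exists (As ++ As').
      by move=> A; rewrite mem_cat => /orP[/IAs|/IAs'].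
    by move=> y By; split=> A AAs; apply: By; rewrite mem_cat AAs ?orbT.
  move=> As IAs; have mAs : meet As by exists g => A /IAs[].
  have [|h hP] := p_meet _ mAs; first by move=> A /IAs[].
  by exists h => A AAs; exact: hP (map_f p AAs).
have Fsmall (V : set (gt H)) (R : gt H -> gt H -> gt H) : open_subgroup V ->
    (forall U, E U -> exists2 A, Dcoset D A & A g /\
      forall y z, p A y -> p A z -> U (R y z)) ->
    exists2 As, I As & forall y z, B As y -> B As z -> V (R y z).
  move=> /Esm[Us UsE UsV] AP.
  have /choice[f fP] U : exists A, E U -> [/\ Dcoset D A, A g &
      forall y z, p A y -> p A z -> U (R y z)].
    have [/AP[A XA [Ag AU]]|EU] := pselect (E U); first by exists A.
    by exists set0 => /EU.
  exists (map f Us); first by move=> _ /mapP[U /UsE /fP[? ? ?] ->].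
  move=> y z By Bz; apply: UsV => U UUs; have [_ _] := fP _ (UsE _ UUs).
  by apply; [apply: By|apply: Bz]; exact: map_f.
have [b|b|h hP] := @closed_subgroup_limit H _ PF.
- have [As IAs AsP] := Fsmall _ (fun y z => y^-1 * z) (@stab_open_subgroup H [:: b])
    (reconstruct_left g).
  have : filter_from I B (B As) by exists As.
  move=> /filter_ex[y By]; exists (act y b).
  exists As => // z Bz; have [] := AsP _ _ By Bz.
  by rewrite /stab /= actM => bE; rewrite -[in RHS]bE actKV.
- have [As IAs AsP] := Fsmall _ (fun y z => z * y^-1) (@stab_open_subgroup H [:: b])
    (reconstruct_right g).
  have : filter_from I B (B As) by exists As.
  move=> /filter_ex[y By]; exists (act y^-1 b).
  by exists As => // z Bz; have [] := AsP _ _ By Bz.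
exists h => A XA Ag; have [U EU [x AE]] := pX XA.
have [s sU] : exists s, stab s `<=` U.
  have [EO _ _ _] := admE; by have /open_subgroup_stab[] := EO _ EU.
have FA : filter_from I B (p A).
  exists [:: A]; first by move=> A0 /=; rewrite inE => /eqP->.
  by move=> y; apply; rewrite inE.
have [y [yA /esym/acts_stab/sU yh]] := filter_ex (filterI FA (hP s)).
have [_ UM _] := Esub EU.
move: yA; rewrite AE lcosetE /= => /UM /(_ yh).
by rewrite mulgA mulgK.
Qed.

Lemma reconstruct_uniq g h h' : (forall A, Dcoset D A -> A g -> p A h) ->
  (forall A, Dcoset D A -> A g -> p A h') -> h = h'.
Proof.
move=> hP h'P; apply: (Dcoset_singleton admE) => U EU.
have [A XA [Ag AU]] := reconstruct_left g EU.
exists h; rewrite !lcosetE /=.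
by split; apply: AU; [exact: hP|exact: hP|exact: hP|exact: h'P].
Qed.

Lemma reconstruct_half : exists f : gt G -> gt H,
  [/\ {morph f : x y / x * y}, continuous f,
    forall g A, Dcoset D A -> A g -> p A (f g) &
    forall g h, (forall A, Dcoset D A -> A g -> p A h) -> h = f g].
Proof.
have [f fP] := choice reconstruct_ex; exists f; split=> //; last first.
- by move=> g h hP; exact: reconstruct_uniq hP (fP g).
- move=> g W /nbhs_act[s sW]; have [_ _ Esm _] := admE.
  have [Us UsE UsV] := Esm _ (@stab_open_subgroup H s).
  have /choice[F FP] U : exists A, E U -> [/\ Dcoset D A, A g &
      forall y z, p A y -> p A z -> U (y^-1 * z)].
    have [/(reconstruct_left g)[A XA [Ag AU]]|EU] := pselect (E U); first by exists A.
    by exists set0 => /EU.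
  have : nbhs g [set x | forall U, U \in Us -> F U x].
    apply: filter_seq => U /UsE /FP[XA Ag _]; apply: open_nbhs_nbhs.
    by split => //; exact: Dcoset_open admD _ XA.
  apply: filterS => x Fx; apply: sW; apply/acts_stab/UsV => U UUs.
  by have [XA Ag] := FP _ (UsE _ UUs); apply; apply: fP => //; exact: Fx.
- move=> g h; symmetry; apply: reconstruct_uniq (fP (g * h)) => C XC Cgh.
  have [U DU CE] := Dcoset_lcosetE admD XC Cgh.
  have XB := Dcoset_lcoset h DU.
  (* The coset [C = g h U] is the product of [A = g (h U h^-1)] and [B = h U], so products of points
     of [p A] and [p B] lie in [p C]. *)
  have DU' : D (conj_set U h^-1) by have [_ DJ _ _] := admD; exact: DJ.
  have XA := Dcoset_lcoset g DU'.
  have := (p_prod XA XB XC).1; apply; last 2 first.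
  + exact/fP/lcoset_set_refl/Dsub.
  + exact/fP/lcoset_set_refl/Dsub.
  rewrite CE !lcosetE conj_setE => x y /= Ux Uy; have [_ UM _] := Dsub DU.
  have := UM _ _ Ux Uy; rewrite invgK conjgE invgM !mulgA.
  by rewrite -(mulgA _ h) mulgV mulg1.
Qed.

End reconstruction.

Section reconstruction_iso.
Variables (G H : closed_subgroup) (D : set (set (gt G))) (E : set (set (gt H))).
Hypotheses (admD : admissible D) (admE : admissible E).
Variables (p : set (gt G) -> set (gt H)) (q : set (gt H) -> set (gt G)).
Hypotheses (pX : forall A, Dcoset D A -> Dcoset E (p A))
  (qX : forall B, Dcoset E B -> Dcoset D (q B))
  (pK : forall A, Dcoset D A -> q (p A) = A)
  (qK : forall B, Dcoset E B -> p (q B) = B).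
Hypothesis p_meet : forall As, (forall A, A \in As -> Dcoset D A) ->
  meet As <-> meet (map p As).
Hypothesis p_prod : forall A B C, Dcoset D A -> Dcoset D B -> Dcoset D C ->
  prodsub A B C <-> prodsub (p A) (p B) (p C).

(** The maps induced by [p] and by [q] are mutually inverse: their composite sends [g] into every
    coset [g U] with [U] in the family, and these cosets have only [g] in common. *)
Lemma reconstruct : exists2 f : gt G -> gt H, topological_isomorphism f &
  forall A, Dcoset D A -> p A = f @` A.
Proof.
have qm As : (forall A, A \in As -> Dcoset E A) -> meet As -> meet (map q As).
  move=> AsE mAs; apply/p_meet; first by move=> _ /mapP[B /AsE XB ->]; exact: qX.
  rewrite -map_comp; suff -> : map (p \o q) As = As by [].
  by rewrite -[RHS]map_id; apply/eq_in_map => B /AsE; exact: qK.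
have qp A B C : Dcoset E A -> Dcoset E B -> Dcoset E C ->
    prodsub A B C <-> prodsub (q A) (q B) (q C).
  by move=> XA XB XC; rewrite p_prod ?qK//; exact: qX.
have pm As : (forall A, A \in As -> Dcoset D A) -> meet As -> meet (map p As).
  by move=> /p_meet[].
have [f [fM fc fP fU]] := reconstruct_half admD admE pX qX qK pm p_prod.
have [h [hM hc hP hU]] := reconstruct_half admE admD qX pX pK qm qp.
have fK : cancel f h.
  move=> g; apply/esym/(Dcoset_singleton admD) => U DU.
  have sU : is_subgroup U by have [DO _ _ _] := admD; have [] := DO _ DU.
  have XgU := Dcoset_lcoset g DU; have gU := lcoset_set_refl g sU.
  by exists g; split=> //; rewrite -(pK XgU); apply: hP; [exact: pX|exact: fP].
have hK : cancel h f.
  move=> g; apply/esym/(Dcoset_singleton admE) => U EU.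
  have sU : is_subgroup U by have [EO _ _ _] := admE; have [] := EO _ EU.
  have XgU := Dcoset_lcoset g EU; have gU := lcoset_set_refl g sU.
  by exists g; split=> //; rewrite -(qK XgU); apply: fP; [exact: qX|exact: hP].
exists f; first by split=> //; exists h.
move=> A XA; apply/seteqP; split=> [y pAy|_ [x Ax <-]]; last exact: fP.
by exists (h y); rewrite ?hK//; rewrite -(pK XA); apply: hP => //; exact: pX.
Qed.

End reconstruction_iso.

(** * Back and forth *)

Lemma countable_enum (X : Type) : countable [set: X] ->
  exists e : nat -> option X, forall x, exists n, e n = Some x.
Proof.
move=> /countable_injP[f fI].
pose P n (o : option X) := forall x, f x = n -> o = Some x.
have /choice[e eP] n : exists o, P n o.
  have [[x fx]|nx] := pselect (exists x, f x = n).
    exists (Some x) => y fy; congr Some.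
    by apply: fI; rewrite ?in_setT ?fx.
  by exists None => x fx; case: nx; exists x.
by exists e => x; exists (f x); exact: eP.
Qed.

Section back_and_forth.
Variables (X Y : choiceType) (L : seq (X * Y) -> Prop).
Hypotheses (ctX : countable [set: X]) (ctY : countable [set: Y]) (L0 : L [::])
  (forth : forall l x, L l -> exists y, L ((x, y) :: l))
  (back : forall l y, L l -> exists x, L ((x, y) :: l))
  (L_inj : forall l x y x' y', L l -> (x, y) \in l -> (x', y') \in l ->
     x = x' <-> y = y').

(** The two extension properties are applied alternately along enumerations of [X] and [Y]; by
    [L_inj] the union of the increasing lists is the graph of a bijection. [L] is not assumed to
    pass to sublists, so a finite [s] is only covered by some larger [s'] satisfying it. *)
Lemma back_and_forth : exists (p : X -> Y) (q : Y -> X),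
  [/\ cancel p q, cancel q p &
    forall s : seq X, exists2 s' : seq X, {subset s <= s'} & L [seq (x, p x) | x <- s']].
Proof.
have [eX eXP] := countable_enum ctX; have [eY eYP] := countable_enum ctY.
have stepX (o : option X) l : L l -> exists l', [/\ L l', {subset l <= l'} &
    forall x, o = Some x -> exists y, (x, y) \in l'].
  case: o => [x|] Ll; last by exists l; split.
  have [y Ly] := forth x Ll; exists ((x, y) :: l); split=> //.
    by move=> z zl; rewrite inE zl orbT.
  by move=> _ [<-]; exists y; rewrite mem_head.
have stepY (o : option Y) l : L l -> exists l', [/\ L l', {subset l <= l'} &
    forall y, o = Some y -> exists x, (x, y) \in l'].
  case: o => [y|] Ll; last by exists l; split.
  have [x Lx] := back y Ll; exists ((x, y) :: l); split=> //.
    by move=> z zl; rewrite inE zl orbT.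
  by move=> _ [<-]; exists x; rewrite mem_head.
have step (nl : nat * seq (X * Y)) : exists l', L nl.2 -> [/\ L l', {subset nl.2 <= l'},
    forall x, eX nl.1 = Some x -> exists y, (x, y) \in l' &
    forall y, eY nl.1 = Some y -> exists x, (x, y) \in l'].
  case: nl => n l /=; have [Ll|] := pselect (L l); last by exists [::].
  have [l1 [L1 s1 x1]] := stepX (eX n) l Ll.
  have [l2 [L2 s2 y2]] := stepY (eY n) l1 L1.
  exists l2 => _; split=> // [z /s1/s2//|x /x1[y /s2 xy]]; by exists y.
have {}[next nextP] := choice step.
pose l := fix l n := if n is m.+1 then next (m, l m) else [::].
have Ll n : L (l n) by elim: n => // n IHn /=; have [] := nextP (n, l n) IHn.
have lS n : {subset l n <= l n.+1} by have [] := nextP (n, l n) (Ll n).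
have lmono m n : (m <= n)%N -> {subset l m <= l n}.
  move=> /subnK <-; elim: (n - m)%N => // k IHk z zl; exact/lS/IHk.
have /choice[p pP] x : exists y, exists n, (x, y) \in l n.
  have [n nx] := eXP x; have [_ _ /(_ x nx)[y xy] _] := nextP (n, l n) (Ll n).
  by exists y, n.+1.
have /choice[q qP] y : exists x, exists n, (x, y) \in l n.
  have [n ny] := eYP y; have [_ _ _ /(_ y ny)[x xy]] := nextP (n, l n) (Ll n).
  by exists x, n.+1.
have lE m n x y x' y' : (x, y) \in l m -> (x', y') \in l n -> x = x' <-> y = y'.
  move=> xy xy'; apply: (L_inj (Ll (maxn m n))).
    exact: lmono (leq_maxl m n) _ xy.
  exact: lmono (leq_maxr m n) _ xy'.
exists p, q; split.
- move=> x; have [m pm] := pP x; have [n qn] := qP (p x).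
  by apply/(lE _ _ _ _ _ _ qn pm).
- move=> y; have [m pm] := pP (q y); have [n qn] := qP y.
  by apply/(lE _ _ _ _ _ _ pm qn).
move=> s; have [n sn] : exists n, forall x, x \in s -> (x, p x) \in l n.
  elim: s => [|x s [n nP]]; first by exists 0.
  have [m pm] := pP x; exists (maxn m n) => y; rewrite inE => /predU1P[->|ys].
    exact: lmono (leq_maxl m n) _ pm.
  exact: lmono (leq_maxr m n) _ (nP _ ys).
exists (unzip1 (l n)); first by move=> x /sn xl; apply/mapP; exists (x, p x).
suff -> : [seq (x, p x) | x <- unzip1 (l n)] = l n by [].
rewrite -map_comp -[RHS]map_id; apply/eq_in_map => -[x y] xy /=; congr pair.
by have [m pm] := pP x; apply/(lE _ _ _ _ _ _ pm xy).
Qed.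

End back_and_forth.

(** * First-order formulas and structures with finitely many types *)

Inductive fo_form (A : Type) : Type :=
  Atom of A | Neg of fo_form A | And of fo_form A & fo_form A | Ex of fo_form A.

Section form_countable.
Variable A : countType.

Fixpoint form_code (f : fo_form A) : GenTree.tree A :=
  match f with
  | Atom a => GenTree.Leaf a
  | Neg f => GenTree.Node 0 [:: form_code f]
  | And f g => GenTree.Node 1 [:: form_code f; form_code g]
  | Ex f => GenTree.Node 2 [:: form_code f]
  end.

Lemma form_code_inj : injective form_code.
Proof.
elim=> [a|f IHf|f IHf g IHg|f IHf] [b|f'|f' g'|f'] //= [].
- by move=> ->.
- by move=> /IHf ->.
- by move=> /IHf -> /IHg ->.
- by move=> /IHf ->.
Qed.

Definition form_index (f : fo_form A) : nat := pickle (form_code f).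

Lemma form_index_inj : injective form_index.
Proof. exact: inj_comp (pcan_inj pickleK) form_code_inj. Qed.

End form_countable.

(** Variables are positions in the environment: [Ex] pushes its witness in front, and an atom is
    evaluated on the whole environment. *)
Fixpoint sat (A X : Type) (R : A -> seq X -> Prop) (f : fo_form A) (e : seq X) : Prop :=
  match f with
  | Atom a => R a e
  | Neg f => ~ sat R f e
  | And f g => sat R f e /\ sat R g e
  | Ex f => exists x, sat R f (x :: e)
  end.

Section elementary_equivalence.
Variables (A : Type) (eqa : nat -> nat -> A).

(** Only finitely many 1-types are realised over each finite tuple: the form of omega-categoricity
    that back and forth needs. *)
Definition finite_types (X : eqType) (R : A -> seq X -> Prop) :=
  forall e, exists xs : seq X, forall x, exists2 x', x' \in xs &
    forall f, sat R f (x :: e) <-> sat R f (x' :: e).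

Definition eq_atoms (X : Type) (R : A -> seq X -> Prop) :=
  forall i j e, R (eqa i j) e <-> onth e i = onth e j.

(* If [e'] has finitely many types, one formula separates them from any other. *)
Lemma realize_type (X : Type) (Y : eqType) (R : A -> seq X -> Prop)
    (S : A -> seq Y -> Prop) e e' x : finite_types S ->
  (forall f, sat R f e <-> sat S f e') ->
  exists y, forall f, sat R f (x :: e) <-> sat S f (y :: e').
Proof.
move=> /(_ e')[ys ysP] ee'; apply: contrapT => /forallNP noy.
have sep y : exists f, sat R f (x :: e) /\ ~ sat S f (y :: e').
  have /existsNP[f Hf] := noy y.
  have [Rf|Rf] := pselect (sat R f (x :: e)).
    by exists f; split=> // Sf; apply: Hf.
  by exists (Neg f); split=> //= Sf; apply: Hf; split=> // ?; case: Sf.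
have [f [Rf Sf]] : exists f, sat R f (x :: e) /\
    forall y, y \in ys -> ~ sat S f (y :: e').
  elim: {ysP} ys => [|y ys [f [Rf Sf]]].
    (* A tautology serves as the empty conjunction; [eqa 0 0] merely provides an atom to build it
       from. *)
    pose a := Atom (eqa 0 0); exists (Neg (And a (Neg a))).
    by split=> //= -[].
  have [g [Rg Sg]] := sep y; exists (And f g); split=> // z.
  by rewrite inE => /predU1P[-> []//|/Sf Sfz []].
have [y Sy] : sat S (Ex f) e' by apply/ee'; exists x.
by have [y' y's /(_ f)[/(_ Sy) + _]] := ysP y; exact: Sf.
Qed.

Lemma elementary_equivalence_iso (X Y : choiceType) (R : A -> seq X -> Prop)
    (S : A -> seq Y -> Prop) :
  countable [set: X] -> countable [set: Y] ->
  finite_types R -> finite_types S -> eq_atoms R -> eq_atoms S ->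
  (forall f, sat R f [::] <-> sat S f [::]) ->
  exists (p : X -> Y) (q : Y -> X), [/\ cancel p q, cancel q p &
    forall s : seq X, exists2 s' : seq X, {subset s <= s'} &
      forall a, R a s' <-> S a (map p s')].
Proof.
move=> ctX ctY ftR ftS eqR eqS RS.
pose L (l : seq (X * Y)) := forall f, sat R f (unzip1 l) <-> sat S f (unzip2 l).
have [|||p [q [pK qK pP]]] := @back_and_forth X Y L ctX ctY RS.
- by move=> l x Ll; have [y yP] := realize_type x ftS Ll; exists y.
- move=> l y Ll; have Ll' f : sat S f (unzip2 l) <-> sat R f (unzip1 l) by rewrite Ll.
  by have [x xP] := realize_type y ftR Ll'; exists x => f; rewrite xP.
- move=> l x y x' y' Ll /nthP => /(_ (x, y))[i il iE] /nthP => /(_ (x, y))[j jl jE].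
  have := Ll (Atom (eqa i j)); rewrite /= eqR eqS !onthE /unzip1 /unzip2 -!map_comp.
  rewrite !(nth_map (x, y)) // iE jE /= => xy.
  split=> [xx|yy]; first by have [] := xy.1 (congr1 Some xx).
  by have [] := xy.2 (congr1 Some yy).
exists p, q; split=> // s; have [s' ss' Ls'] := pP s; exists s' => // a.
have := Ls' (Atom a); rewrite /= /unzip1 /unzip2 -!map_comp map_id.
exact.
Qed.

End elementary_equivalence.

(** * Codes for open sets, and the coset structure as a first-order structure *)

Definition coset_code : Type := (seq nat * seq (seq nat))%type.

(* A code [(s, bs)] stands for the union of the double cosets of the pointwise
   stabilizer of [s] given by the images [bs] of [s]; on an oligomorphic group
   these are all the sets invariant on both sides under some open subgroup. *)
Definition cset (G : closed_subgroup) (c : coset_code) : set (gt G) :=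
  [set g | exists2 b, b \in c.2 & orb G (c.1 ++ acts g c.1) (c.1 ++ b)].

Arguments cset G c : clear implicits.

Section codes.
Variables (G : closed_subgroup) (olG : oligomorphic G).

(** The double coset of [g] under [stab s] consists of the [h] with [s ++ acts h s] in the orbit of
    [s ++ acts g s]. One image of [s] is recorded for each such orbit met by [A]. *)
Lemma cset_ex (A : set (gt G)) s :
  (forall u g v, stab s u -> A g -> stab s v -> A (u * g * v)) ->
  exists c, A = cset G c.
Proof.
move=> As; have [ts tsP] := (oligomorphicP G).1 olG (size s + size s).
have /choice[b bP] (t : seq nat) : exists b,
    (exists2 g, A g & orb G t (s ++ acts g s)) ->
    exists2 g, A g & orb G t (s ++ acts g s) /\ b = acts g s.
  have [[g Ag tg]|no] := pselect (exists2 g, A g & orb G t (s ++ acts g s)).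
    by exists (acts g s) => _; exists g.
  by exists [::] => /no.
pose P t : bool := `[< exists2 g, A g & orb G t (s ++ acts g s) >].
exists (s, map b [seq t <- ts | P t]); apply/seteqP; split=> [g Ag|g].
  have [|t tts tg] := tsP (s ++ acts g s); first by rewrite size_cat size_acts.
  have Pt : exists2 g, A g & orb G t (s ++ acts g s) by exists g.
  exists (b t); first by apply: map_f; rewrite mem_filter tts andbT; apply/asboolP.
  have [g' _ [tg' ->]] := bP _ Pt.
  exact: orb_trans (orb_sym tg) tg'.
move=> [_ /mapP[t /[!mem_filter]/andP[/asboolP Pt _] ->]] /=.
have [g' Ag' [_ ->]] := bP _ Pt => -[h].
rewrite acts_cat => /eqP; rewrite eqseq_cat ?size_acts// => /andP[/eqP hs /eqP hg].
have -> : g = h^-1 * g' * (g'^-1 * h * g).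
  by rewrite -!mulgA mulVKg mulKg.
apply: As => //.
  by have [_ _ sV] := stab_subgroup G s; exact: sV.
by rewrite /stab /= !actsM hg actsK.
Qed.

Lemma cset_open c : open (cset G c).
Proof.
apply/open_acts => g [b bc gb]; exists c.1 => h hg; exists b => //.
by rewrite hg.
Qed.

(** [x U] is invariant under [U] on the right and under [x U x^-1] on the left; some stabiliser of a
    finite sequence is contained in both. *)
Lemma cset_open_coset (A : set (gt G)) : open_coset A -> exists c, A = cset G c.
Proof.
move=> [U oU [x ->]]; have /open_subgroup_stab[sU [s sUs]] := oU.
have /open_subgroup_stab[_ [r rU]] := conj_set_open_subgroup x^-1 oU.
apply: (@cset_ex _ (s ++ r)) => u g v; rewrite stab_cat => -[us /rU ur].
rewrite lcosetE /= => Ug [/sUs vs _].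
have [_ UM _] := sU; move: ur; rewrite conj_setE /= invgK => ux.
have -> : x^-1 * (u * g * v) = u ^ x * (x^-1 * g) * v.
  by rewrite conjgE !mulgA mulgK.
by apply: (UM) => //; exact: UM.
Qed.

Lemma cset_open_subgroup U : open_subgroup U -> exists c, U = cset G c.
Proof.
move=> oU; apply: cset_open_coset; exists U => //; exists 1.
by rewrite lcosetE; apply/seteqP; split=> y /=; rewrite invg1 mul1g.
Qed.

End codes.

(** A boolean mask selects from the environment the cosets asserted to have a common point, which
    provides this relation in every arity. The triples are for products and the pairs for equality,
    by positions in the environment. *)
Definition atom : Type := (seq bool + (nat * nat * nat + nat * nat))%type.

Definition rel_atom (G : closed_subgroup) (a : atom) (e : seq (set (gt G))) :=
  match a with
  | inl m => meet (mask m e)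
  | inr (inl (i, j, k)) =>
      match onth e i, onth e j, onth e k with
      | Some A, Some B, Some C => prodsub A B C
      | _, _, _ => False
      end
  | inr (inr (i, j)) => onth e i = onth e j
  end.

Definition eq_atom (i j : nat) : atom := inr (inr (i, j)).

Lemma onth_map (T1 T2 : Type) (f : T1 -> T2) s i :
  onth (map f s) i = omap f (onth s i).
Proof. by elim: s i => [|x s IHs] [|i] //=; rewrite !onthE /= in IHs *. Qed.

Lemma rel_atom_image (G H : closed_subgroup) (f : gt G -> gt H) g a e :
  {morph f : x y / x * y} -> cancel f g -> cancel g f ->
  rel_atom a e <-> rel_atom a [seq f @` A | A <- e].
Proof.
move=> fM fK gK.
have imK (A : set (gt G)) : g @` (f @` A) = A.
  by rewrite image_comp -[RHS]image_id; apply: eq_imagel => x _ /=.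
case: a => [m|[[[i j] k]|[i j]]] /=.
- rewrite -map_mask; split=> -[x xP].
    by exists (f x) => _ /mapP[A /xP Ax ->]; exists x.
  exists (g x) => A AP; have [y Ay <-] := xP _ (map_f (fun A => f @` A) AP).
  by rewrite fK.
- rewrite !onth_map.
  case: (onth e i) => //= A; case: (onth e j) => //= B; case: (onth e k) => //= C.
  split=> ABC.
    by move=> _ _ [x Ax <-] [y By <-]; exists (x * y); [exact: ABC|exact: fM].
  move=> x y Ax By; have [||z Cz] := ABC (f x) (f y); [by exists x|by exists y|].
  by rewrite -fM => /(can_inj fK) <-.
- rewrite !onth_map; split=> [->//|]; case: (onth e i) (onth e j) => [A|] [B|] //=.
  by move=> [/(congr1 (fun A => g @` A))]; rewrite !imK => ->.
Qed.

Lemma sat_iso (B X Y : Type) (R : B -> seq X -> Prop) (S : B -> seq Y -> Prop)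
    (p : X -> Y) f e : (forall y, exists x, p x = y) ->
  (forall a e, R a e <-> S a (map p e)) -> sat R f e <-> sat S f (map p e).
Proof.
move=> ps pR; elim: f e => [a|f IHf|f IHf g IHg|f IHf] e /=.
- exact: pR.
- by rewrite IHf.
- by rewrite IHf IHg.
- split=> [[x /IHf fx]|[y fy]]; first by exists (p x).
  by have [x xy] := ps y; exists x; apply/IHf; rewrite /= xy.
Qed.

Section structure.
Variables (G : closed_subgroup) (D : set (set (gt G))).
Hypotheses (olG : oligomorphic G) (admD : admissible D).

Definition structure : Type := set_type (Dcoset D).

HB.instance Definition _ := Choice.on structure.

Definition mkX A (XA : Dcoset D A) : structure := exist _ A (mem_set XA).

Lemma structureP (x : structure) : Dcoset D (val x).
Proof. exact: (set_mem (valP x)). Qed.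

Definition struct_rel (a : atom) (e : seq structure) : Prop :=
  rel_atom a (map val e).

Lemma rel_eq_atoms : eq_atoms eq_atom struct_rel.
Proof.
move=> i j e; rewrite /struct_rel /= !onth_map; split=> [|->//].
case: (onth e i) (onth e j) => [A|] [B|] //=.
by move=> -[/val_inj ->].
Qed.

Lemma Dcoset_open_coset A : Dcoset D A -> open_coset A.
Proof. by have [DO _ _ _] := admD; move=> [U /DO oU [x ->]]; exists U => //; exists x. Qed.

Lemma structure_countable : countable [set: structure].
Proof.
have /choice[c cP] (x : structure) : exists c, val x = cset G c.
  exact/cset_open_coset/Dcoset_open_coset/structureP.
apply/countable_injP; exists (pickle \o c) => x y _ _ /= /(pcan_inj pickleK) xy.
by apply: val_inj; rewrite !cP xy.
Qed.

(** Conjugation by [v] fixes [x U] if [v] lies in [U] and in [x U x^-1]: it then fixes [U], and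
    [x^-1 (x ^ v) = (v ^ x)^-1 v] lies in [U]. *)
Lemma open_coset_fixer (As : seq (set (gt G))) :
  (forall A, A \in As -> open_coset A) -> exists2 V, open_subgroup V &
    forall A v, A \in As -> V v -> conj_set A v = A.
Proof.
elim: As => [_|A As IHAs AsX].
  exists setT => //; split; first exact: openT.
  by split.
have [|V oV VP] := IHAs; first by move=> B BAs; apply: AsX; rewrite inE BAs orbT.
have [|U oU [x AE]] := AsX A; first by rewrite mem_head.
have [oU' sU] := oU.
exists (V `&` (U `&` conj_set U x^-1)).
  exact/open_subgroupI/open_subgroupI/conj_set_open_subgroup.
move=> B v; rewrite inE => /predU1P[->|BAs] [Vv [Uv]]; last by move=> _; exact: VP.
rewrite conj_setE /= invgK => Uxv; rewrite AE conj_lcoset conj_set_id//.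
apply/esym/lcoset_set_eq => //; rewrite lcosetE /=.
have [_ UM UV] := sU.
have -> : x^-1 * x ^ v = (v ^ x)^-1 * v by rewrite !conjgE !invgM !mulgA invgK.
by apply: UM => //; exact: UV.
Qed.

Definition structure_conj (g : gt G) (x : structure) : structure :=
  mkX (Dcoset_conj admD g (structureP x)).

Lemma structure_conjVK g : cancel (structure_conj g^-1) (structure_conj g).
Proof. by move=> x; apply: val_inj; rewrite /= conj_setKV. Qed.

Lemma conj_morph (g : gt G) : {morph (fun x => x ^ g) : x y / x * y}.
Proof. by move=> x y; rewrite conjMg. Qed.

Lemma structure_conj_rel g a e : struct_rel a e <-> struct_rel a (map (structure_conj g) e).
Proof.
rewrite /struct_rel (rel_atom_image _ _ (@conj_morph g) (@conjgK _ g) (@conjgKV _ g)).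
by rewrite -!map_comp.
Qed.

Lemma structure_fixer (e : seq structure) : exists2 V, open_subgroup V &
  forall x v, x \in e -> V v -> structure_conj v x = x.
Proof.
have [|V oV VP] := @open_coset_fixer (map val e).
  by move=> _ /mapP[x _ ->]; exact/Dcoset_open_coset/structureP.
by exists V => // x v xe Vv; apply: val_inj; apply: VP => //; exact: map_f.
Qed.

Lemma structure_conj_finite V : open_subgroup V ->
  exists xs : seq structure, forall x, exists2 x', x' \in xs &
    exists2 v, V v & x = structure_conj v x'.
Proof.
move=> oV; have [As AsX AsP] := Dcoset_conj_finite admD olG oV.
exists (pmap insub As) => x; have [B BAs [v Vv xE]] := AsP _ (structureP x).
exists (mkX (AsX _ BAs)); first by rewrite mem_pmap_sub.
by exists v => //; apply: val_inj.
Qed.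

(** Conjugation by the elements of an open subgroup fixing [e] preserves types over [e] and has
    finitely many orbits. *)
Lemma structure_finite_types : finite_types struct_rel.
Proof.
move=> e; have [V oV VP] := structure_fixer e.
have [xs xsP] := structure_conj_finite oV; exists xs => x.
have [x' x'xs [v Vv ->]] := xsP x; exists x' => // f.
have eE : map (structure_conj v) e = e.
  by rewrite -[RHS]map_id; apply/eq_in_map => y ye; exact: VP.
rewrite -{1}eE; symmetry; apply: (@sat_iso _ _ _ _ _ (structure_conj v) f (x' :: e)).
  by move=> y; exists (structure_conj v^-1 y); rewrite structure_conjVK.
exact: structure_conj_rel.
Qed.

Lemma structure_lift As : (forall A, A \in As -> Dcoset D A) ->
  exists e : seq structure, map val e = As.
Proof.
elim: As => [_|A As IHAs AsX]; first by exists [::].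
have [|e eE] := IHAs; first by move=> B BAs; apply: AsX; rewrite inE BAs orbT.
have XA : Dcoset D A by apply: AsX; rewrite mem_head.
by exists (mkX XA :: e); rewrite /= eE.
Qed.

End structure.

Lemma Dcoset_image (G H : closed_subgroup) (D : set (set (gt G)))
    (E : set (set (gt H))) (f : gt G -> gt H) A :
  {morph f : x y / x * y} -> (forall U, D U -> E (f @` U)) ->
  Dcoset D A -> Dcoset E (f @` A).
Proof.
move=> fM DE [U /DE EU [x ->]]; exists (f @` U) => //; exists (f x).
apply/seteqP; split=> _ [_ [u Uu <-] <-].
  by exists (f u); [exists u|rewrite fM].
by exists (x * u); [exists u|rewrite fM].
Qed.

Lemma meet_map (G : closed_subgroup) (X : eqType) (h : X -> set (gt G)) s t :
  s =i t -> meet (map h s) -> meet (map h t).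
Proof.
move=> st [x xP]; exists x => _ /mapP[y yt ->]; apply: xP; apply: map_f.
by rewrite st.
Qed.

Section classification.
Variables (G H : closed_subgroup) (D : set (set (gt G))) (E : set (set (gt H))).
Hypotheses (admD : admissible D) (admE : admissible E).

Lemma theory_of_iso (f : gt G -> gt H) g th : {morph f : x y / x * y} ->
  cancel f g -> cancel g f ->
  (forall U, D U -> E (f @` U)) -> (forall V, E V -> D (g @` V)) ->
  sat (struct_rel (D := D)) th [::] <-> sat (struct_rel (D := E)) th [::].
Proof.
move=> fM fK gK DE ED.
have gM : {morph g : x y / x * y}.
  by move=> x y; apply: (can_inj fK); rewrite fM !gK.
pose p (x : structure D) : structure E := mkX (Dcoset_image fM DE (structureP x)).
apply: (@sat_iso _ _ _ _ _ p _ [::]) => [y|a e].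
  exists (mkX (Dcoset_image gM ED (structureP y))); apply: val_inj => /=.
  by rewrite image_comp -[RHS]image_id; apply: eq_imagel => x _ /=.
by rewrite /struct_rel (rel_atom_image _ _ fM fK gK) -!map_comp.
Qed.

Lemma structure_iso (p : structure D -> structure E) (q : structure E -> structure D) :
  cancel p q -> cancel q p ->
  (forall s : seq (structure D), exists2 s' : seq (structure D), {subset s <= s'} &
    forall a, struct_rel a s' <-> struct_rel a (map p s')) ->
  exists2 f : gt G -> gt H, topological_isomorphism f &
    forall x, val (p x) = f @` val x.
Proof.
move=> pK qK pqP.
(* [reconstruct] expects maps defined on all sets; outside the structure the value is [set0]. *)
pose P A := if pselect (Dcoset D A) is left XA then val (p (mkX XA)) else set0.
pose Q B := if pselect (Dcoset E B) is left XB then val (q (mkX XB)) else set0.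
have PE x : P (val x) = val (p x).
  rewrite /P; case: pselect => [XA|]; last by case; exact: structureP.
  by congr (val (p _)); exact: val_inj.
have QE y : Q (val y) = val (q y).
  rewrite /Q; case: pselect => [XA|]; last by case; exact: structureP.
  by congr (val (q _)); exact: val_inj.
have mapPE e : map P (map val e) = map val (map p e).
  by rewrite -!map_comp; apply/eq_map => x /=; exact: PE.
have [|||||| f ftop fE] := @reconstruct G H D E admD admE P Q.
- by move=> A XA; rewrite -[A]/(val (mkX XA)) PE; exact: structureP.
- by move=> A XA; rewrite -[A]/(val (mkX XA)) QE; exact: structureP.
- by move=> A XA; rewrite -[A]/(val (mkX XA)) PE QE pK.
- by move=> A XA; rewrite -[A]/(val (mkX XA)) QE PE qK.
- move=> As /structure_lift[e <-]; rewrite mapPE.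
  have [s' es' s'P] := pqP e.
  (* Atoms transfer only along the larger list [s']; the mask recovers from it the members of
     [e]. *)
  have := s'P (inl (map (fun x => x \in e) s')).
  rewrite /struct_rel /= -!map_mask -filter_mask.
  have eE : [seq x <- s' | x \in e] =i e.
    by move=> x; rewrite mem_filter; case: (boolP (x \in e)) => //= /es'.
  rewrite -!map_comp => m; split=> me.
    by apply: (meet_map eE); apply/m; apply: meet_map me => x; rewrite eE.
  by apply: (meet_map eE); apply/m; apply: meet_map me => x; rewrite eE.
- move=> A B C XA XB XC.
  rewrite -[A]/(val (mkX XA)) -[B]/(val (mkX XB)) -[C]/(val (mkX XC)) !PE.
  move: (mkX XA) (mkX XB) (mkX XC) => x y z.
  have [s' es' s'P] := pqP [:: x; y; z].
  have xs : x \in s' by apply: es'; rewrite !inE eqxx.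
  have ys : y \in s' by apply: es'; rewrite !inE eqxx orbT.
  have zs : z \in s' by apply: es'; rewrite !inE eqxx !orbT.
  have := s'P (inr (inl (index x s', index y s', index z s'))).
  have on u : u \in s' -> onth s' (index u s') = Some u.
    by move=> us; rewrite onthE (nth_map u) ?nth_index ?index_mem.
  by rewrite /struct_rel /= !onth_map !on.
by exists f => // x; rewrite -PE fE//; exact: structureP.
Qed.

Lemma iso_of_theory : oligomorphic G -> oligomorphic H ->
  (forall th, sat (struct_rel (D := D)) th [::] <-> sat (struct_rel (D := E)) th [::]) ->
  topologically_isomorphic (gt G) (gt H).
Proof.
move=> olG olH GH.
have [p [q [pK qK pqP]]] := elementary_equivalence_iso
  (structure_countable olG admD) (structure_countable olH admE)
  (structure_finite_types olG admD) (structure_finite_types olH admE)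
  (@rel_eq_atoms _ D) (@rel_eq_atoms _ E) GH.
have [f fP _] := structure_iso pK qK pqP.
by exists f.
Qed.

End classification.

(** * Automorphisms *)

Lemma ultra_seq (T : Type) (I : eqType) (F : set (set T)) (s : seq I)
    (f : I -> set T) : UltraFilter F ->
  F [set x | exists2 i, i \in s & f i x] -> exists2 i, i \in s & F (f i).
Proof.
move=> FU FUn; apply: contrapT => no.
have : F [set x | forall i, i \in s -> (~` f i) x].
  apply: filter_seq => i si; have [Fi|//] := in_ultra_setVsetC (f i) FU.
  by case: no; exists i.
by move=> /(filterI FUn)/filter_ex[x [[i si fi] /(_ i si)]].
Qed.

Lemma conj_topological_isomorphism (G : closed_subgroup) (g : gt G) :
  topological_isomorphism (fun x : gt G => x ^ g).
Proof.
have cJ (h : gt G) : continuous (fun x : gt G => x ^ h).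
  move=> x W /nbhs_act[s sW]; apply/nbhs_act; exists (acts h s) => y yx.
  by apply: sW; apply/act_conj.
split; [exact: conj_morph|exact: cJ|exists (fun x => x ^ g^-1)].
by split; [exact: conjgK|exact: conjgKV|exact: cJ].
Qed.

Section automorphism_action.
Variables (G : closed_subgroup) (D : set (set (gt G))).
Hypotheses (olG : oligomorphic G) (admD : admissible D)
  (D_aut : forall f : gt G -> gt G, topological_isomorphism f ->
     forall U, D U -> D (f @` U)).

Notation aG := (aut (gt G)).

Definition autf (f : aG) : gt G -> gt G := bij_fun (val f).

Lemma autf_iso f : topological_isomorphism (autf f).
Proof. exact: aut_isoP. Qed.

Lemma autfM f x y : autf f (x * y) = autf f x * autf f y.
Proof. by have [-> //] := autf_iso f. Qed.

Lemma autf_mul f g x : autf (f * g) x = autf f (autf g x).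
Proof. by []. Qed.

Lemma autfK f : cancel (autf f) (autf f^-1).
Proof. by move=> x; rewrite -autf_mul mulVg. Qed.

Lemma autfKV f : cancel (autf f^-1) (autf f).
Proof. by move=> x; rewrite -autf_mul mulgV. Qed.

Lemma autf_inj f g : autf f =1 autf g -> f = g.
Proof. by move=> fg; apply/val_inj/bij_ext. Qed.

Lemma autf_lcoset f x U : autf f @` lcoset_set x U = lcoset_set (autf f x) (autf f @` U).
Proof.
apply/seteqP; split=> _ [_ [u Uu <-] <-].
  by exists (autf f u); [exists u|rewrite autfM].
by exists (x * u); [exists u|rewrite autfM].
Qed.

Lemma autf_image_mul f g A : autf (f * g) @` A = autf f @` (autf g @` A).
Proof. by rewrite image_comp. Qed.

Lemma autf_ex f : topological_isomorphism f -> exists g : aG, autf g = f.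
Proof.
move=> fP; have [_ _ [g [fK gK _]]] := fP.
by exists (exist _ (mk_bij (Bijective fK gK)) (mem_set fP)).
Qed.

Lemma inner_ex (g : gt G) : exists2 f : aG, forall x, autf f x = x ^ g & inn f.
Proof.
have [f fE] := autf_ex (conj_topological_isomorphism g).
by exists f => [x|]; [rewrite fE|exists g => x; exact: (congr1 (fun h => h x) fE)].
Qed.

Definition aut_act (f : aG) (x : structure D) : structure D :=
  mkX (Dcoset_image (autfM f) (D_aut (autf_iso f)) (structureP x)).

Lemma aut_actE f x : val (aut_act f x) = autf f @` val x. Proof. by []. Qed.

Lemma aut_act1 x : aut_act 1 x = x.
Proof. by apply: val_inj; rewrite aut_actE -[RHS]image_id. Qed.

Lemma aut_actM f g x : aut_act (f * g) x = aut_act f (aut_act g x).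
Proof. by apply: val_inj; rewrite !aut_actE autf_image_mul. Qed.

Lemma aut_actK f : cancel (aut_act f) (aut_act f^-1).
Proof. by move=> x; rewrite -aut_actM mulVg aut_act1. Qed.

Lemma aut_actKV f : cancel (aut_act f^-1) (aut_act f).
Proof. by move=> x; rewrite -aut_actM mulgV aut_act1. Qed.

Definition aut_acts f := map (aut_act f).

Lemma aut_actsM f g s : aut_acts (f * g) s = aut_acts f (aut_acts g s).
Proof. by rewrite /aut_acts -map_comp; apply: eq_map => x; exact: aut_actM. Qed.

Lemma aut_actsK f : cancel (aut_acts f) (aut_acts f^-1).
Proof. exact: mapK (aut_actK f). Qed.

Lemma aut_act_conj f g : (forall x, autf f x = x ^ g) -> aut_act f =1 structure_conj admD g.
Proof. by move=> fE x; apply: val_inj; apply: eq_imagel => y _; exact: fE. Qed.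

Lemma structure_conj_aut g : exists2 f, aut_act f =1 structure_conj admD g & inn f.
Proof. by have [f fE fi] := inner_ex g; exists f => //; exact: aut_act_conj. Qed.

(** For [U] in [D], the automorphism [f] sends the coset of the preimage of [U] at [x] to [(f x) U];
    since [g] acts in the same way, [g x] lies there too. *)
Lemma aut_act_faithful f g : aut_act f =1 aut_act g -> f = g.
Proof.
move=> fg; apply: autf_inj => x; apply: (Dcoset_singleton admD) => U DU.
have [DO _ _ _] := admD.
have DV : D (autf f^-1 @` U) by exact: D_aut (autf_iso _) _ DU.
have VU : autf f @` (autf f^-1 @` U) = U.
  by rewrite -autf_image_mul mulgV -[RHS]image_id.
pose A := mkX (Dcoset_lcoset x DV); have xA : val A x.
  by apply: lcoset_set_refl; have [] := DO _ DV.
have E : autf f @` val A = autf g @` val A by have := congr1 val (fg A).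
have AE : autf f @` val A = lcoset_set (autf f x) U by rewrite autf_lcoset VU.
by exists (autf f x); rewrite -AE; split; [|rewrite E]; exists x.
Qed.

(* A double coset decomposition [V = W y1 W u ... u W yn W], with [W] a finite
   intersection of members of [D], recovers [V] from finitely many of the
   left cosets of these members. *)
Lemma open_coset_support A : open_coset A -> exists s : seq (structure D),
  forall f, aut_acts f s = s -> autf f @` A = A.
Proof.
move=> [V oV [x ->]]; have [DO _ Dsm _] := admD.
have [Us UsD UsV] := Dsm _ oV.
pose W : set (gt G) := [set g | forall U, U \in Us -> U g].
have oW : open_subgroup W.
  split; last first.
    split=> [U|g h Wg Wh U UUs|g Wg U UUs].
    - by move=> /UsD/DO[_ []].
    - have [_ [_ UM _]] := DO _ (UsD _ UUs); apply: UM; [exact: Wg|exact: Wh].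
    - have [_ [_ _ UV]] := DO _ (UsD _ UUs); apply: UV; exact: Wg.
  rewrite openE => g Wg; apply: filter_seq => U UUs; apply: open_nbhs_nbhs.
  by split; [have [] := DO _ (UsD _ UUs)|exact: Wg].
have [ys ysP] := double_cosets_finite olG oW oW.
(* The cosets at 1 make [f] preserve [W], those at [x] handle the translation by [x], and those at
   [ys] the double cosets that make up [V]. *)
pose cosets := flatten [seq [seq lcoset_set z U | z <- 1 :: x :: ys] | U <- Us].
have [s sE] : exists s : seq (structure D), map val s = cosets.
  apply: structure_lift => B /flattenP[_ /mapP[U /UsD DU ->] /mapP[z _ ->]].
  exact: Dcoset_lcoset.
have [_ [_ VM VV]] := oV.
have [_ [_ WM WV]] := oW.
exists s; suff sub f : aut_acts f s = s -> autf f @` lcoset_set x V `<=` lcoset_set x V.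
  move=> f fs; apply/seteqP; split; first exact: sub.
  have /sub fV : aut_acts f^-1 s = s by rewrite -[in LHS]fs aut_actsK.
  move=> y Vy; exists (autf f^-1 y); last exact: autfKV.
  by apply: fV; exists y.
move=> fs; have fE z U : z \in 1 :: x :: ys -> U \in Us ->
    autf f @` lcoset_set z U = lcoset_set z U.
  move=> zs UUs; have : lcoset_set z U \in cosets.
    apply/flattenP; exists [seq lcoset_set z U | z <- 1 :: x :: ys];
      last exact: (map_f (fun z => lcoset_set z U)).
    exact: (map_f (fun U => [seq lcoset_set z U | z <- 1 :: x :: ys])).
  rewrite -sE => /mapP[a sa ->]; rewrite -aut_actE; congr val.
  by move: fs; rewrite -[s in RHS]map_id => /eq_in_map; exact.
have fW z : z \in 1 :: x :: ys -> W (z^-1 * autf f z).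
  move=> zs U UUs; have [_ sU] := DO _ (UsD _ UUs).
  suff : lcoset_set z U (autf f z) by rewrite lcosetE.
  by rewrite -(fE z U zs UUs); exists z => //; exact: lcoset_set_refl.
have fWW w : W w -> W (autf f w).
  move=> Ww U UUs; have [_ sU] := DO _ (UsD _ UUs).
  have := fE 1 U (mem_head _ _) UUs.
  have -> : lcoset_set 1 U = U.
    by rewrite lcosetE; apply/seteqP; split=> y /=; rewrite invg1 mul1g.
  by move=> <-; exists w => //; exact: Ww.
have WV' w : W w -> V w by move=> Ww; apply: UsV.
have fV v : V v -> V (autf f v).
  move=> Vv; have [w [y [w' [Ww yys Ww' vE]]]] := ysP v.
  have Vy : V y.
    have -> : y = w^-1 * v * w'^-1 by rewrite vE !mulgA mulVg mul1g mulgK.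
    by apply: (VM); [apply: (VM) => //; apply: VV|apply: VV]; exact: WV'.
  rewrite vE !autfM; apply: (VM); last exact: WV' (fWW _ Ww').
  apply: (VM); first exact: WV' (fWW _ Ww).
  rewrite -(mulVKg y (autf f y)); apply: VM => //.
  have yxs : y \in 1 :: x :: ys by apply/predU1P; right; apply/predU1P; right.
  exact: WV' (fW _ yxs).
rewrite autf_lcoset => _ [_ [v Vv <-] <-]; rewrite lcosetE /= mulgA.
apply: VM; last exact: fV.
have xs : x \in 1 :: x :: ys by apply/predU1P; right; exact: mem_head.
exact: WV' (fW _ xs).
Qed.

(** The topology is defined through all open cosets, but each of them is preserved as soon as
    finitely many cosets of members of [D] are; it is thus pointwise convergence on the
    structure. *)
Lemma nbhs_aut (f : aG) (W : set aG) : nbhs f W <->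
  exists s : seq (structure D), forall h, aut_acts h s = aut_acts f s -> W h.
Proof.
rewrite nbhsE; split.
  move=> [B [oB Bf] BW]; have [K [C [/finite_seqP[Cs CE] Co] <-] KB] := oB _ Bf.
  have [s sP] : exists s : seq (structure D), forall h, aut_acts h s = s ->
      forall A, A \in Cs -> autf h @` A = A.
    have : forall A, A \in Cs -> open_coset A by move=> A ACs; apply: Co; rewrite CE.
    elim: (Cs) => [_|A Cs' IH AsX]; first by exists [::].
    have [|s sP] := IH; first by move=> B' BAs; apply: AsX; rewrite inE BAs orbT.
    have [|r rP] := @open_coset_support A; first by apply: AsX; rewrite mem_head.
    exists (r ++ s) => h; rewrite /aut_acts map_cat => /eqP.
    rewrite eqseq_cat ?size_map// => /andP[/eqP hr /eqP hs] B'.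
    by rewrite inE => /predU1P[->|]; [exact: rP|exact: sP].
  exists s => h hs; apply: BW; apply: KB; rewrite lcosetE /= => A.
  rewrite CE => ACs; apply: (sP (f^-1 * h)) => //.
  by rewrite aut_actsM hs aut_actsK.
move=> [s sW]; pose K : set aG := val @^-1` setwise_stab [set` map val s].
have KB : aut_basis K.
  exists [set` map val s] => //; split; first exact: finite_seq.
  by move=> _ /mapP[x _ ->]; exact/(Dcoset_open_coset admD)/structureP.
exists (lcoset_set f K); first split.
- exact: (basis_open_lcoset (@aut_basisP (gt G))).
- exists 1; last exact: mulg1.
  by have [_ /(_ _ KB)[]] := @aut_basisP (gt G).
- move=> h [k kK <-]; apply: sW; rewrite aut_actsM; congr aut_acts.
  rewrite -[RHS]map_id; apply/eq_in_map => x xs; apply: val_inj.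
  by rewrite aut_actE; apply: kK; exact: map_f.
Qed.

(* [Aut G] is closed in the symmetric group of the coset structure. *)
Lemma aut_limit (p q : structure D -> structure D) : cancel p q -> cancel q p ->
  (forall s, exists f, map p s = aut_acts f s) -> exists f, p =1 aut_act f.
Proof.
move=> pK qK pP.
have [s|f ftop fE] := structure_iso admD admD pK qK.
  exists s => // a; have [f ->] := pP s.
  have := rel_atom_image a (map val s) (autfM f) (autfK f) (autfKV f).
  by rewrite /struct_rel /aut_acts -!map_comp.
have [g gE] := autf_ex ftop; exists g => x; apply: val_inj.
by rewrite aut_actE gE fE.
Qed.

End automorphism_action.

(** * The outer automorphism group is profinite *)

Section outer_automorphisms.
Variables (G : closed_subgroup) (D : set (set (gt G))).
Hypotheses (olG : oligomorphic G) (admD : admissible D)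
  (D_aut : forall f : gt G -> gt G, topological_isomorphism f ->
     forall U, D U -> D (f @` U)).

Notation aG := (aut (gt G)).
Notation act_on := (aut_act D_aut).
Notation acts_on := (aut_acts D_aut).

(** If [b] and [b'] are fixed points of the stabiliser of [a] and the pairs [(a, b)], [(a, b')] lie
    in one orbit, then [b = b']; hence there are at most as many of them as orbits on pairs. *)
Lemma fixed_points_finite a : exists bs : seq nat, forall b,
  (forall g : gt G, act g a = a -> act g b = b) -> b \in bs.
Proof.
have [ts tsP] := (oligomorphicP G).1 olG 2.
have /choice[f fP] (t : seq nat) : exists b,
    (exists c, orb G t [:: a; c]) -> orb G t [:: a; b].
  by have [[c cP]|no] := pselect (exists c, orb G t [:: a; c]); [exists c|exists 0 => /no].
exists (map f ts) => b fixb; have [//|t tts tb] := tsP [:: a; b].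
have := fP t (ex_intro _ b tb) => /orb_sym tf.
have [g [ga gb]] := orb_trans tf tb.
apply/mapP; exists t => //.
by apply: (@act_inj _ g); rewrite gb; exact: fixb.
Qed.

(* An automorphism that is inner on any finite set of open cosets is induced
   by an element of [G]: if [h], [h'] both conjugate [G_a] to its image, then
   [h'^-1 h a] is a fixed point of [G_a], so there are finitely many choices
   for [h a], and an ultrafilter of choices of [h] converges. *)
Lemma inn_closed (f : aG) :
  (forall s, exists g, acts_on f s = map (structure_conj admD g) s) -> inn f.
Proof.
(* [conj_set A h^-1] is [h A h^-1], so [h] approximates a permutation that implements [f]. *)
move=> fI; have fA (As : seq (set (gt G))) : (forall A, A \in As -> open_coset A) ->
    exists h : gt G, forall A, A \in As -> autf f @` A = conj_set A h^-1.
  move=> AsX; have [s sP] : exists s : seq (structure D), forall h : aG, acts_on h s = s ->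
      forall A, A \in As -> autf h @` A = A.
    elim: As AsX => [_|A As IH AsX]; first by exists [::].
    have [|s sP] := IH; first by move=> B' BAs; apply: AsX; rewrite inE BAs orbT.
    have [|r rP] := @open_coset_support _ _ olG admD D_aut A.
      by apply: AsX; rewrite mem_head.
    exists (r ++ s) => h; rewrite /aut_acts map_cat => /eqP.
    rewrite eqseq_cat ?size_map// => /andP[/eqP hr /eqP hs] B'.
    by rewrite inE => /predU1P[->|]; [exact: rP|exact: sP].
  have [g gs] := fI s; have [k kE _] := inner_ex g.
  exists g^-1 => A AAs; have kAE : autf k @` A = conj_set A g.
    by apply: eq_imagel => x _; exact: kE.
  rewrite invgK -kAE -(mulVKg k f) autf_image_mul (sP (k^-1 * f))//.
  rewrite aut_actsM gs; rewrite -[RHS](aut_actsK D_aut k); congr aut_acts.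
  by apply: eq_map => x; rewrite (aut_act_conj admD D_aut kE).
pose I : set (seq (set (gt G))) := [set As | forall A, A \in As -> open_coset A].
pose B (As : seq (set (gt G))) : set (gt G) :=
  [set h | forall A, A \in As -> autf f @` A = conj_set A h^-1].
have PF : ProperFilter (filter_from I B).
  apply: filter_from_proper; last by move=> As /fA.
  apply: filter_from_filter; first by exists [::].
  move=> As As' IAs IAs'; exists (As ++ As').
    by move=> A; rewrite mem_cat => /orP[/IAs|/IAs'].
  by move=> y By; split=> A AAs; apply: By; rewrite mem_cat AAs ?orbT.
have [F [FU FB]] := ultraFilterLemma PF.
have FA A : open_coset A -> F [set h | autf f @` A = conj_set A h^-1].
  move=> oA; apply: FB; exists [:: A]; first by move=> C; rewrite /= inE => /eqP->.
  by move=> h; apply; rewrite mem_head.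
have oS s : open_coset (stab s : set (gt G)).
  exists (stab s); first exact: stab_open_subgroup.
  by exists 1; rewrite lcosetE; apply/seteqP; split=> y /=; rewrite invg1 mul1g.
have FF : Filter F by exact: ultra_proper.
(* An element normalising a point stabiliser, and likewise its inverse, sends the point to a fixed
   point of that stabiliser. *)
have fixF a (n : gt G) : conj_set (stab [:: a]) n = stab [:: a] ->
    forall g : gt G, act g a = a -> act g (act n^-1 a) = act n^-1 a.
  move=> nE g ga; have : stab [:: a] g by rewrite /stab /= /acts /= ga.
  rewrite -nE conj_setE /= /stab /acts /= conjgE invgK !actM => -[gn].
  by apply: (@act_inj _ n); rewrite gn actKV.
have [b|b|h hP] := @closed_subgroup_limit G F.
- have [bs bsP] := fixed_points_finite b.
  have [h0 /= h0P] := filter_ex (FA _ (oS [:: b])).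
  have [c _ Fc] : exists2 c, c \in map (act h0) bs & F [set g | act g b = c].
    apply: ultra_seq; apply: filterS (FA _ (oS [:: b])) => h /= hE.
    exists (act h b) => //; rewrite -[h](mulVKg h0) actM; apply: map_f; apply: bsP.
    have -> : h0^-1 * h = (h^-1 * h0)^-1 by rewrite invgM invgK.
    by apply: fixF; rewrite conj_setM -hE h0P conj_setKV.
  by exists c.
- have [bs bsP] := fixed_points_finite b.
  (* For preimages of [b], take the [A] whose image under [f] is [stab [:: b]]: any two [h] with
     [h A h^-1] equal to this stabiliser differ by an element normalising it. *)
  pose A := autf f^-1 @` (stab [:: b] : set (gt G)).
  have oA : open_coset A by exact: aut_open_coset.
  have AE : autf f @` A = stab [:: b].
    by rewrite /A -autf_image_mul mulgV -[RHS]image_id.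
  have [h0 /= h0P] := filter_ex (FA _ oA).
  have [c _ Fc] : exists2 c, c \in map (act h0^-1) bs & F [set g | act g c = b].
    apply: ultra_seq; apply: filterS (FA _ oA) => h /= hE.
    exists (act h^-1 b); last by rewrite actKV.
    rewrite -[h^-1](mulKg h0) actM; apply: map_f; apply: bsP.
    have -> : h0 * h^-1 = (h * h0^-1)^-1 by rewrite invgM invgK.
    apply: fixF; rewrite conj_setM -AE hE conj_setKV -hE.
    by rewrite -h0P.
  by exists c.
exists h^-1 => x; apply: act_faithful => b.
pose b' := act h^-1 b.
(* If [k b' = b] and [f] acts on the coset of [stab [:: b']] at [x] as conjugation by [k], then
   [f x] sends [b] to [k (x b')]; for [k] near the limit this is the value of the limit at
   [x b']. *)
have oA : open_coset (lcoset_set x (stab [:: b'])).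
  by exists (stab [:: b']); [exact: stab_open_subgroup|exists x].
have [k /= [kE kx]] := filter_ex (filterI (FA _ oA) (hP [:: b'; act x b'])).
move: kx; rewrite /acts /= /b' actKV -/b' => -[kb kxb].
have : (autf f @` lcoset_set x (stab [:: b'])) (autf f x).
  by exists x => //; apply: lcoset_set_refl; exact: stab_subgroup.
rewrite kE conj_setE /= invgK lcosetE /= /stab /acts /= => -[].
rewrite actM => /(congr1 (act x)); rewrite actKV conjgE !actM kb => E.
by rewrite invgK -/b' -kxb -E actKV.
Qed.

Lemma out_pi_fM (f g h : aG) : out_pi f = out_pi g -> out_pi (f * h) = out_pi (g * h).
Proof. by move=> fg; rewrite -!out_piM fg. Qed.

(** By [inn_closed], distinct classes are told apart by some finite [s]: no inner automorphism
    agrees with [f1^-1 f2] on it. The sets [U f] are the left cosets in Out of the image of the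
    stabiliser of [s], an open subgroup, hence clopen. *)
Lemma out_zero_dimensional : zero_dimensional (out (gt G)).
Proof.
move=> q1 q2; rewrite -(out_reprK q1) -(out_reprK q2).
move: (repr q1) (repr q2) => f1 f2 q12.
have [s sP] : exists s, forall g, acts_on (f1^-1 * f2) s <> map (structure_conj admD g) s.
  apply: contrapT => no; move/eqP: q12; apply; apply/out_piP/inn_closed => s.
  by apply: contrapT => nos; apply: no; exists s => g gE; apply: nos; exists g.
pose U (f : aG) := [set q | exists2 k : aG, acts_on k s = s & q = out_pi (f * k)].
have oU f : open (U f).
  have -> : open (U f) = open (@out_pi (gt G) @^-1` (U f)) by [].
  rewrite openE => h [k ks hE]; apply/(@nbhs_aut _ _ olG admD D_aut); exists s => h' h's.
  exists (k * (h^-1 * h')).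
    by rewrite !aut_actsM h's aut_actsK.
  by rewrite mulgA -(out_pi_fM _ hE) mulVKg.
exists (U f1); split.
- split; first exact: oU.
  rewrite -openC (_ : ~` U f1 = \bigcup_(f in [set f | ~ U f1 (out_pi f)]) U f).
    by apply: bigcup_open => f _; exact: oU.
  apply/seteqP; split=> [q Uq|q [f Uf [k ks qE]] [k' k's qE']].
    exists (repr q); first by rewrite /= out_reprK.
    exists 1; last by rewrite mulg1 out_reprK.
    by rewrite -[RHS]map_id; apply: eq_map => x; exact: aut_act1.
  apply: Uf; exists (k' * k^-1).
    by rewrite aut_actsM -[in LHS]ks aut_actsK.
  by rewrite mulgA -(out_pi_fM k^-1 (etrans (esym qE) qE')) mulgK.
- exists 1; last by rewrite mulg1.
  by rewrite -[RHS]map_id; apply: eq_map => x; exact: aut_act1.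
- move=> [k ks /out_piP]; set j := f2^-1 * (f1 * k) => ij.
  have [_ _ iV] := @inn_subgroup (gt G).
  have [g gE] := inn_normal k^-1 (iV _ ij).
  apply: (sP g); have -> : f1^-1 * f2 = (j^-1 ^ k^-1) * k.
    by rewrite conjgE invgK /j !invgM invgK !mulgA mulgVK mulgV mul1g.
  rewrite aut_actsM ks; apply: eq_map => x.
  exact: (aut_act_conj admD D_aut gE).
Qed.

(* For an ultrafilter [F] on [Out G], the finite partial maps induced by some
   representative of F-almost every class are extended back and forth to a
   permutation of the coset structure. *)
Lemma out_compact : compact [set: out (gt G)].
Proof.
rewrite compact_ultra => F FU _.
have FF : ProperFilter F by exact: ultra_proper.
pose Q (l : seq (structure D * structure D)) : set (out (gt G)) :=
  [set out_pi f | f in [set f | forall z, z \in l -> act_on f z.1 = z.2]].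
have [||||||p [q [pK qK pP]]] := @back_and_forth (structure D) (structure D) (F \o Q).
- exact: (structure_countable olG admD).
- exact: (structure_countable olG admD).
- apply: filterS filterT => q _; exists (repr q) => //; exact: out_reprK.
- move=> l x /= FQ; have [V oV VP] := structure_fixer admD (map snd l).
  (* Composing with conjugation by an element of [V] changes neither the class in Out nor the
     earlier values, so finitely many candidates for the value at [x] suffice and the ultrafilter
     selects one. *)
  have [ys ysP] := structure_conj_finite olG admD oV.
  suff [y _ FQy] : exists2 y, y \in ys & F (Q ((x, y) :: l)) by exists y.
  apply: ultra_seq; apply: filterS FQ => _ [f fl <-].
  have [y yys [v Vv fxE]] := ysP (act_on f x).
  have [k kE ki] := structure_conj_aut admD D_aut v.
  exists y => //; exists (k^-1 * f) => [z|].
    rewrite inE => /predU1P[->|zl]; rewrite /= aut_actM.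
      by rewrite fxE -kE aut_actK.
    rewrite fl// -[in LHS](VP z.2 v)//; last exact: map_f.
    by rewrite -kE aut_actK.
  apply/out_piP; rewrite invgM invgK.
  by have := inn_normal f ki; rewrite conjgE mulgA.
- move=> l y /= FQ; have [V oV VP] := structure_fixer admD (map fst l).
  have [xs xsP] := structure_conj_finite olG admD oV.
  suff [x _ FQx] : exists2 x, x \in xs & F (Q ((x, y) :: l)) by exists x.
  apply: ultra_seq; apply: filterS FQ => _ [f fl <-].
  have [x xxs [v Vv fyE]] := xsP (act_on f^-1 y).
  have [k kE ki] := structure_conj_aut admD D_aut v.
  exists x => //; exists (f * k) => [z|].
    rewrite inE => /predU1P[->|zl]; rewrite /= aut_actM kE.
      by rewrite -fyE aut_actKV.
    by rewrite VP ?fl//; exact: map_f.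
  by apply/esym/out_piP; rewrite mulKg.
- move=> l x y x' y' /= /filter_ex[_ [f fl _]] xy xy'.
  have /= <- := fl _ xy; have /= <- := fl _ xy'; split=> [->//|].
  by move=> E; apply: (can_inj (aut_actK D_aut f)).
have [s|f fE] := @aut_limit _ _ admD D_aut _ _ pK qK.
  have [s' ss' /= /filter_ex[_ [f fP _]]] := pP s; exists f.
  apply/eq_in_map => x /ss' xs'; symmetry.
  exact: (fP (x, p x) (map_f (fun x => (x, p x)) xs')).
exists (out_pi f); split=> // W nW.
have /(@nbhs_aut _ _ olG admD D_aut)[s sW] : nbhs f (@out_pi (gt G) @^-1` W) by exact: pi_continuous nW.
have [s' ss'] := pP s; apply: filterS => _ [h hP <-]; apply: sW.
apply/eq_in_map => x /ss' xs'; rewrite -fE.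
exact: (hP (x, p x) (map_f (fun x => (x, p x)) xs')).
Qed.

Lemma out_profinite : profinite (out (gt G)).
Proof.
split; first exact: out_compact.
- rewrite open_hausdorff => x y /out_zero_dimensional[U [[oU cU] Ux Uy]].
  by exists (U, ~` U); rewrite ?inE//=; split=> //; [exact: closed_openC|exact: setICr].
- exact/zero_dimension_totally_disconnected/out_zero_dimensional.
Qed.

End outer_automorphisms.

(** * The automorphism group as an oligomorphic permutation group *)

Section automorphism_group_oligomorphic.
Variables (G : closed_subgroup) (D : set (set (gt G))).
Hypotheses (olG : oligomorphic G) (admD : admissible D)
  (D_aut : forall f : gt G -> gt G, topological_isomorphism f ->
     forall U, D U -> D (f @` U)).

Notation aG := (aut (gt G)).
Notation act_on := (aut_act D_aut).
Notation acts_on := (aut_acts D_aut).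

Lemma structure_conjM (g h : gt G) x :
  structure_conj admD (g * h) x = structure_conj admD h (structure_conj admD g x).
Proof. by apply: val_inj; exact: conj_setM. Qed.

Lemma structure_oligomorphic n : exists ss : seq (seq (structure D)),
  forall s, size s = n -> exists2 r, r \in ss &
    exists g, s = map (structure_conj admD g) r.
Proof.
elim: n => [|n [ss ssP]].
  exists [:: [::]] => s /size0nil ->; exists [::]; first by rewrite mem_head.
  by exists 1.
have /choice[X XP] (r : seq (structure D)) : exists xs : seq (structure D),
    forall x, exists2 y, y \in xs & exists2 v : gt G, x = structure_conj admD v y &
      map (structure_conj admD v) r = r.
  have [V oV VP] := structure_fixer admD r.
  have [xs xsP] := structure_conj_finite olG admD oV; exists xs => x.
  have [y yxs [v Vv xE]] := xsP x; exists y => //; exists v => //.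
  by rewrite -[RHS]map_id; apply/eq_in_map => z zr; exact: VP.
exists [seq x :: r | r <- ss, x <- X r] => -[//|x s] [sn].
have [r rss [g sE]] := ssP s sn.
have [y yX [v xE vr]] := XP r (structure_conj admD g^-1 x).
exists (y :: r); first by apply/allpairsPdep; exists r, y.
exists (v * g); rewrite /= structure_conjM -xE structure_conjVK sE; congr cons.
rewrite -[in LHS]vr -map_comp; apply: eq_map => z /=.
by rewrite structure_conjM.
Qed.

(** Were it finite, some finite sequence of points of omega would have trivial stabiliser, and its
    extensions by one more point would lie in infinitely many orbits. Infinity is needed to identify
    the structure with omega. *)
Lemma structure_infinite : infinite_set [set: structure D].
Proof.
move=> /finite_seqP[xs xsE].
have [DO _ _ _] := admD.
have xsP x : x \in xs by have : [set: structure D] x by []; rewrite xsE.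
have /choice[S_ SP] (x : structure D) : exists s, D (val x) -> stab s `<=` val x.
  have [/DO/open_subgroup_stab[_ [s sx]]|no] := pselect (D (val x)); first by exists s.
  by exists [::] => /no.
pose S := flatten (map S_ xs).
have S1 (g : gt G) : stab S g -> g = 1.
  move=> gS; apply: (Dcoset_singleton admD) => U DU; exists 1.
  have [_ sU] := DO _ DU; have [U1 _ _] := sU.
  rewrite !lcosetE /= invg1 !mul1g; split=> //.
  apply: (SP (mkX (Dcoset_sub DU)) DU); apply/stabP => a aS.
  apply/(stabP S g).1 => //; apply/flattenP; eexists; last exact: aS.
  exact/map_f/xsP.
have [ts tsP] := (oligomorphicP G).1 olG (size S).+1.
have /choice[f fP] n : exists t, t \in ts /\ orb G t (rcons S n).
  by have [|t tts tn] := tsP (rcons S n); [rewrite size_rcons|exists t].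
have fI : injective f.
  move=> m n fmn; have [_ /orb_sym fm] := fP m; have [_ fn] := fP n.
  rewrite fmn in fm; have [g] := orb_trans fm fn.
  rewrite /acts map_rcons => /rcons_inj[gS <-].
  by rewrite (S1 g gS).
have := @uniq_leq_size _ (map f (iota 0 (size ts).+1)) ts.
rewrite map_inj_uniq ?iota_uniq// size_map size_iota => /(_ isT).
suff sub : {subset [seq f i | i <- iota 0 (size ts).+1] <= ts} by move=> /(_ sub); rewrite ltnn.
by move=> _ /mapP[n _ ->]; have [] := fP n.
Qed.

Lemma structure_nat : exists (e : structure D -> nat) e', cancel e e' /\ cancel e' e.
Proof.
have := eq_card_nat (structure_countable olG admD) structure_infinite.
move=> /card_set_bijP[e [_ eI eS]].
have /choice[e' e'P] n : exists x, e x = n by have [x _ xn] := eS n I; exists x.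
exists e, e'; split=> // x; apply: eI; rewrite ?in_setT//; exact: e'P.
Qed.

Lemma aut_oligomorphic : exists2 H : closed_subgroup, oligomorphic H &
  topologically_isomorphic aG (gt H).
Proof.
have [e [e' [eK e'K]]] := structure_nat.
have actB (f : aG) : bijective (e \o act_on f \o e').
  exists (e \o act_on f^-1 \o e') => n /=; first by rewrite eK aut_actK e'K.
  by rewrite eK aut_actKV e'K.
pose t (f : aG) : sym_omega := mk_bij (actB f).
have tE f n : bij_fun (t f) n = e (act_on f (e' n)) by [].
have tM : {morph t : f g / f * g}.
  by move=> f g; apply: bij_ext => n; rewrite bij_mulE !tE eK aut_actM.
have t1 : t 1 = 1 by apply: bij_ext => n; rewrite bij_1E tE aut_act1 e'K.
have tV f : t f^-1 = (t f)^-1.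
  by apply: (mulgI (t f)); rewrite -tM !mulgV t1.
have tI : injective t.
  move=> f g fg; apply: (aut_act_faithful admD (D_aut := D_aut)) => x.
  have := congr1 (fun h : sym_omega => bij_fun h (e x)) fg.
  by rewrite !tE !eK => /(can_inj eK).
have sH : is_subgroup (range t).
  split; first by exists 1.
    by move=> _ _ [f _ <-] [g _ <-]; exists (f * g); rewrite ?tM.
  by move=> _ [f _ <-]; exists f^-1; rewrite ?tV.
have cH : closed (range t).
  move=> x clx; pose p := e' \o bij_fun x \o e; pose q := e' \o bij_fun x^-1 \o e.
  have pK : cancel p q by move=> y; rewrite /p /q /= e'K bij_VK eK.
  have qK : cancel q p by move=> y; rewrite /p /q /= e'K bij_KV eK.
  have [s|f fE] := @aut_limit _ _ admD D_aut _ _ pK qK.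
    have [|_ [[f _ <-]] fx] := clx (lcoset_set x (pointwise_stab [set` map e s])).
      rewrite nbhsE; exists (lcoset_set x (pointwise_stab [set` map e s])) => //.
      split; last by apply: lcoset_set_refl; exact: pointwise_stab_subgroup.
      apply: (basis_open_lcoset sym_basisP).
      by exists [set` map e s] => //=; exact: finite_seq.
    exists f; apply/eq_in_map => y ys; apply: (can_inj eK).
    case: fx => k ks /(congr1 (fun h : sym_omega => bij_fun h (e y))).
    rewrite bij_mulE ks; last exact: map_f.
    by rewrite tE eK /p /= => <-; rewrite e'K.
  exists f => //; apply: bij_ext => n.
  by rewrite tE -fE /p /= !e'K.
pose H := @ClosedSubgroup (Subgroup sH) cH.
have tH f : t f \in (H : set sym_omega) by apply/mem_set; exists f.
pose T (f : aG) : gt H := exist _ (t f) (tH f).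
have TM : {morph T : f g / f * g} by move=> f g; apply: val_inj; exact: tM.
have /choice[T' T'P] (h : gt H) : exists f, T f = h.
  by have [f _ fh] := set_mem (valP h); exists f; apply: val_inj.
have TK : cancel T T' by move=> f; apply/tI; have /(congr1 val) := T'P (T f).
have actsT f r : acts (T f) r = map e (acts_on f (map e' r)).
  by rewrite /acts /aut_acts -!map_comp.
have ee' s : map e' (map e s) = s by rewrite mapK.
exists H.
  (* Inner automorphisms alone already have finitely many orbits on tuples of cosets. *)
  apply/oligomorphicP => n; have [ss ssP] := structure_oligomorphic n.
  exists (map (map e) ss) => s sn.
  have [|r rss [g sE]] := ssP (map e' s); first by rewrite size_map.
  exists (map e r); first exact: map_f.
  have [f fE _] := structure_conj_aut admD D_aut g.
  exists (T f); rewrite actsT ee' -[RHS](mapK e'K) sE; congr map.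
  exact: eq_map.
exists T; split=> //.
  move=> f W /nbhs_act[s sW]; apply/(@nbhs_aut _ _ olG admD D_aut).
  by exists (map e' s) => h hf; apply: sW; rewrite !actsT hf.
exists T'; split=> // h W /(@nbhs_aut _ _ olG admD D_aut)[s sW].
apply/nbhs_act; exists (map e s) => k kh; apply: sW.
apply: (inj_map (can_inj eK)).
by move: kh; rewrite -(T'P k) -(T'P h) !actsT !ee' !TK.
Qed.

End automorphism_group_oligomorphic.

(** * Borel predicates of closed subgroups *)

Definition borel (P : closed_subgroup -> Prop) := measurable [set G | P G].

Lemma borel_ext (P Q : closed_subgroup -> Prop) :
  (forall G, P G <-> Q G) -> borel P -> borel Q.
Proof.
by move=> PQ; rewrite /borel (_ : [set G | P G] = [set G | Q G])//; apply/seteqP; split=> G /PQ.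
Qed.

Lemma borel_const (P : Prop) : borel (fun=> P).
Proof.
have [p|p] := pselect P; rewrite /borel.
  rewrite (_ : [set _ | _] = setT); [exact: measurableT|].
  by apply/seteqP; split.
rewrite (_ : [set _ | _] = set0); [exact: measurable0|].
by apply/seteqP; split.
Qed.

Lemma borel_not P : borel P -> borel (fun G => ~ P G).
Proof. exact: measurableC. Qed.

Lemma borel_and P Q : borel P -> borel Q -> borel (fun G => P G /\ Q G).
Proof. exact: measurableI. Qed.

Lemma borel_or P Q : borel P -> borel Q -> borel (fun G => P G \/ Q G).
Proof. exact: measurableU. Qed.

Lemma borel_imp P Q : borel P -> borel Q -> borel (fun G => P G -> Q G).
Proof.
move=> bP bQ; apply: borel_ext (borel_or (borel_not bP) bQ) => G.
split=> [[//|//]|PQ]; have [/PQ|] := pselect (P G); by [right|left].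
Qed.

Lemma borel_iff P Q : borel P -> borel Q -> borel (fun G => P G <-> Q G).
Proof. by move=> bP bQ; apply: borel_and; exact: borel_imp. Qed.

Lemma borel_ex (T : countType) (P : T -> closed_subgroup -> Prop) :
  (forall x, borel (P x)) -> borel (fun G => exists x, P x G).
Proof.
move=> bP; rewrite /borel (_ : [set _ | _] = \bigcup_x [set G | P x G]).
  by apply: countable_bigcupT_measurable => //; exact: countableP.
by apply/seteqP; split=> G [x]; exists x.
Qed.

Lemma borel_all (T : countType) (P : T -> closed_subgroup -> Prop) :
  (forall x, borel (P x)) -> borel (fun G => forall x, P x G).
Proof.
move=> bP; apply: borel_ext (borel_not (borel_ex (fun x => borel_not (bP x)))) => G.
by split=> [/forallNP PG x|PG [x]]; [exact: contrapT (PG x)|apply].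
Qed.

Lemma borel_ex2 (T : countType) (P Q : T -> closed_subgroup -> Prop) :
  (forall x, borel (P x)) -> (forall x, borel (Q x)) ->
  borel (fun G => exists2 x, P x G & Q x G).
Proof.
move=> bP bQ; apply: borel_ext (borel_ex (fun x => borel_and (bP x) (bQ x))) => G.
by split=> [[x []]|[x]]; exists x.
Qed.

(** The permutations sending [s] to [t] form an open set, and the groups meeting it form a generator
    of the Effros sigma-algebra. Later conditions are reduced to this one by countable
    operations. *)
Lemma borel_orb s t : borel (fun G => orb G s t).
Proof.
apply: sub_sigma_algebra; exists [set x : sym_omega | map (bij_fun x) s = t].
  move=> x xs; exists (pointwise_stab [set` s]).
    by exists [set` s] => //=; exact: finite_seq.
  move=> _ [k ks <-]; rewrite /= -xs; apply/eq_in_map => a sa.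
  by rewrite bij_mulE ks.
apply/seteqP; split=> [G [x [Gx xs]]|G [g gs]].
  by exists (exist _ x (mem_set Gx)).
by exists (val g); split=> //; exact/set_mem/(valP g).
Qed.

(** [P] depends on [g] only through [t = g s] and [t' = g^-1 s], and a pair [t], [t'] with [t] of
    the length of [s] arises in this way exactly when [s ++ t'] can be carried to [t ++ s]. This
    trades the group element for a pair of finite sequences; [x] and [y] stand for [g] and its
    inverse on [s]. *)
Lemma borel_gex (P : forall G, gt G -> Prop) (s : seq nat)
    (Q : (nat -> nat) -> (nat -> nat) -> closed_subgroup -> Prop) :
  (forall G (g : gt G) x y, {in s, act g =1 x} -> {in s, act g^-1 =1 y} ->
     P G g <-> Q x y G) ->
  (forall x y, borel (Q x y)) -> borel (fun G => exists g : gt G, P G g).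
Proof.
move=> PQ bQ; pose fin (t : seq nat) a := nth 0 t (index a s).
have finE G (g : gt G) : {in s, act g =1 fin (acts g s)}.
  by move=> a sa; rewrite /fin (nth_map 0) ?index_mem// nth_index.
apply: borel_ext (borel_ex (fun t => borel_ex (fun t' =>
  borel_and (borel_and (borel_const (size s = size t)) (borel_orb (s ++ t') (t ++ s)))
    (bQ (fin t) (fin t'))))) => G.
split=> [[t [t' [[st [g]]]]]|[g Pg]].
  rewrite acts_cat => /eqP + Qt.
  rewrite eqseq_cat ?size_acts// => /andP[/eqP gs /eqP gt'].
  exists g; apply/(PQ G g _ _ _ _).2: Qt.
    by rewrite -gs; exact: finE.
  by rewrite -[t'](actsK g) gt'; exact: finE.
exists (acts g s), (acts g^-1 s); split.
  by split; [rewrite size_acts|exists g; rewrite acts_cat actsKV].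
by apply: (PQ G g _ _ _ _).1 Pg; exact: finE.
Qed.

Lemma borel_gall (P : forall G, gt G -> Prop) (s : seq nat)
    (Q : (nat -> nat) -> (nat -> nat) -> closed_subgroup -> Prop) :
  (forall G (g : gt G) x y, {in s, act g =1 x} -> {in s, act g^-1 =1 y} ->
     P G g <-> Q x y G) ->
  (forall x y, borel (Q x y)) -> borel (fun G => forall g : gt G, P G g).
Proof.
move=> PQ bQ; apply: borel_ext (borel_not (@borel_gex (fun G g => ~ P G g) s
    (fun x y G => ~ Q x y G) _ (fun x y => borel_not (bQ x y)))) => [G|G g x y gx gy].
  by split=> [/forallNP PG x|PG [x]]; [exact: contrapT (PG x)|apply].
by rewrite (PQ G g x y).
Qed.

(* Membership of a product [g * h] in [cset G c], in terms of the finite data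
   [t = g^-1 c.1] and [u = h c.1]. *)
Definition in_code (c : coset_code) (t u : seq nat) (G : closed_subgroup) :=
  exists2 b, b \in c.2 & orb G (t ++ u) (c.1 ++ b).

Lemma borel_in_code c t u : borel (in_code c t u).
Proof. by apply: borel_ex2 => b; [exact: borel_const|exact: borel_orb]. Qed.

Lemma in_codeM G c (g h : gt G) :
  cset G c (g * h) <-> in_code c (acts g^-1 c.1) (acts h c.1) G.
Proof.
split=> -[b bc ob]; exists b => //.
  apply: orb_trans ob; apply: orb_sym; exists g^-1.
  by rewrite acts_cat -actsM mulKg.
apply: orb_trans ob; exists g^-1.
by rewrite acts_cat -actsM mulKg.
Qed.

Lemma in_code1 G c (g : gt G) : cset G c g <-> in_code c c.1 (acts g c.1) G.
Proof. by []. Qed.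

Lemma acts_look G (g : gt G) (s : seq nat) (x : nat -> nat) (u : seq nat) :
  {in s, act g =1 x} -> {subset u <= s} -> acts g u = map x u.
Proof. by move=> gx us; apply/eq_in_map => a /us; exact: gx. Qed.

Lemma in_catl (T : eqType) (s t : seq T) : {subset s <= s ++ t}.
Proof. by move=> x xs; rewrite mem_cat xs. Qed.

Lemma in_catr (T : eqType) (s t : seq T) : {subset t <= s ++ t}.
Proof. by move=> x xs; rewrite mem_cat xs orbT. Qed.

Lemma borel_sub c d : borel (fun G => cset G c `<=` cset G d).
Proof.
apply: (@borel_gall (fun G g => cset G c g -> cset G d g) (c.1 ++ d.1)
  (fun x y G => in_code c c.1 (map x c.1) G -> in_code d d.1 (map x d.1) G)).
  move=> G g x y gx gy; rewrite !in_code1.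
  by rewrite (acts_look gx (@in_catl _ _ _)) (acts_look gx (@in_catr _ _ _)).
by move=> x y; apply: borel_imp; exact: borel_in_code.
Qed.

Lemma borel_eq c d : borel (fun G => cset G c = cset G d).
Proof.
apply: borel_ext (borel_and (borel_sub c d) (borel_sub d c)) => G.
by split=> [?|->]; [exact/seteqP|split].
Qed.

Lemma borel_prodsub c d e : borel (fun G => prodsub (cset G c) (cset G d) (cset G e)).
Proof.
apply: (@borel_gall (fun G g => forall h, cset G c g -> cset G d h -> cset G e (g * h))
  (c.1 ++ e.1) (fun x y G => forall h : gt G, in_code c c.1 (map x c.1) G ->
     cset G d h -> in_code e (map y e.1) (acts h e.1) G)).
  move=> G g x y gx gy; split=> H h.
    rewrite -(acts_look gx (@in_catl _ _ _)) -(acts_look gy (@in_catr _ _ _)) -in_codeM.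
    exact: H.
  rewrite in_codeM in_code1.
  rewrite (acts_look gx (@in_catl _ _ _)) (acts_look gy (@in_catr _ _ _)).
  exact: H.
move=> x y; apply: (@borel_gall _ (d.1 ++ e.1) (fun z w G =>
   in_code c c.1 (map x c.1) G -> in_code d d.1 (map z d.1) G ->
   in_code e (map y e.1) (map z e.1) G)).
  move=> G g z w gz gw; rewrite (in_code1 d).
  by rewrite (acts_look gz (@in_catl _ _ _)) (acts_look gz (@in_catr _ _ _)).
move=> z w; do !apply: borel_imp; exact: borel_in_code.
Qed.

Lemma borel_subgroup c : borel (fun G => is_subgroup (cset G c)).
Proof.
apply: borel_ext (borel_and (borel_and (borel_in_code c c.1 c.1) (borel_prodsub c c c))
  (@borel_gall (fun G g => cset G c g -> cset G c g^-1) c.1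
   (fun x y G => in_code c c.1 (map x c.1) G -> in_code c c.1 (map y c.1) G) _ _)).
- move=> G; have -> : in_code c c.1 c.1 G <-> cset G c 1 by rewrite in_code1 acts1.
  by split=> [[[]]|[]].
- move=> G g x y gx gy; rewrite !in_code1.
  by rewrite (acts_look gx (fun _ => id)) (acts_look gy (fun _ => id)).
- by move=> x y; apply: borel_imp; exact: borel_in_code.
Qed.

Lemma borel_is_lcoset c d : borel (fun G => exists x, cset G c = lcoset_set x (cset G d)).
Proof.
apply: (@borel_gex _ d.1 (fun x y G =>
  forall h, cset G c h <-> in_code d (map x d.1) (acts h d.1) G)).
  move=> G g x y gx gy; rewrite lcosetE -(acts_look gx (fun _ => id)).
  split=> [-> h|H]; first by rewrite /= in_codeM invgK.
  by apply/seteqP; split=> h /=; rewrite in_codeM invgK => /H.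
move=> x y; apply: (@borel_gall _ (c.1 ++ d.1) (fun z w G =>
  in_code c c.1 (map z c.1) G <-> in_code d (map x d.1) (map z d.1) G)).
  move=> G g z w gz gw; rewrite (in_code1 c).
  by rewrite (acts_look gz (@in_catl _ _ _)) (acts_look gz (@in_catr _ _ _)).
by move=> z w; apply: borel_iff; exact: borel_in_code.
Qed.

Lemma borel_is_conj c d : borel (fun G => exists x, cset G c = conj_set (cset G d) x).
Proof.
apply: (@borel_gex _ d.1 (fun x y G =>
  forall h, cset G c h <-> in_code d (map y d.1) (acts h (map y d.1)) G)).
  move=> G g x y gx gy; rewrite conj_setE -(acts_look gy (fun _ => id)).
  have E h : cset G d (h ^ g^-1) <-> in_code d (acts g^-1 d.1) (acts h (acts g^-1 d.1)) G.
    by rewrite conjgE invgK in_codeM actsM.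
  split=> [-> h|H]; first exact: E.
  by apply/seteqP; split=> h /=; [move/H/E|move/E/H].
move=> x y; apply: (@borel_gall _ (c.1 ++ map y d.1) (fun z w G =>
  in_code c c.1 (map z c.1) G <-> in_code d (map y d.1) (map z (map y d.1)) G)).
  move=> G g z w gz gw; rewrite (in_code1 c).
  by rewrite (acts_look gz (@in_catl _ _ _)) (acts_look gz (@in_catr _ _ _)).
by move=> z w; apply: borel_iff; exact: borel_in_code.
Qed.

Lemma borel_meet (cs : seq coset_code) : borel (fun G => meet (map (cset G) cs)).
Proof.
apply: (@borel_gex _ (flatten (map fst cs)) (fun x y G =>
  forall c, c \in cs -> in_code c c.1 (map x c.1) G)).
  move=> G g x y gx gy; have sub c : c \in cs -> {subset c.1 <= flatten (map fst cs)}.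
    by move=> ccs a ac; apply/flattenP; exists c.1 => //; exact: map_f.
  split=> [H c ccs|H _ /mapP[c ccs ->]].
    by rewrite -(acts_look gx (sub c ccs)) -in_code1; exact: H (map_f _ ccs).
  by apply/in_code1; rewrite (acts_look gx (sub c ccs)); exact: H.
move=> x y; apply: borel_all => c; apply: borel_imp (borel_const _) _.
exact: borel_in_code.
Qed.

(** Finite index when [d] codes a subgroup: [es] contains codes of all its cosets at points of [c],
    so finiteness is an existential over a countable type. *)
Definition code_index (c d : coset_code) (G : closed_subgroup) :=
  exists es : seq coset_code, forall g : gt G, cset G c g ->
    exists2 e, e \in es & cset G e = lcoset_set g (cset G d).

Lemma borel_code_index c d : borel (code_index c d).
Proof.
apply: borel_ex => es; apply: (@borel_gall _ (c.1 ++ d.1) (fun x y G =>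
  in_code c c.1 (map x c.1) G -> exists2 e, e \in es &
  forall h, cset G e h <-> in_code d (map x d.1) (acts h d.1) G)).
  move=> G g x y gx gy; rewrite in_code1 (acts_look gx (@in_catl _ _ _)).
  rewrite -(acts_look gx (@in_catr _ _ _)).
  suff E e : cset G e = lcoset_set g (cset G d) <->
      (forall h, cset G e h <-> in_code d (acts g d.1) (acts h d.1) G).
    by split=> H /H[e ees /E eE]; exists e.
  rewrite lcosetE; split=> [-> h|H]; first by rewrite /= in_codeM invgK.
  by apply/seteqP; split=> h /=; rewrite in_codeM invgK => /H.
move=> x y; apply: borel_imp; first exact: borel_in_code.
apply: borel_ex2 => e; first exact: borel_const.
apply: (@borel_gall _ (e.1 ++ d.1) (fun z w G =>
  in_code e e.1 (map z e.1) G <-> in_code d (map x d.1) (map z d.1) G)).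
  move=> G g z w gz gw; rewrite (in_code1 e).
  by rewrite (acts_look gz (@in_catl _ _ _)) (acts_look gz (@in_catr _ _ _)).
by move=> z w; apply: borel_iff; exact: borel_in_code.
Qed.

(* Coded form of [\bigcap_(g in F) conj_set (cset G c) g `<=` cset G u]. *)
Definition code_conj_cap (c u : coset_code) (G : closed_subgroup) :=
  exists2 es : seq coset_code,
    forall e, e \in es -> exists x, cset G e = conj_set (cset G c) x &
    forall g : gt G, (forall e, e \in es -> cset G e g) -> cset G u g.

Lemma borel_code_conj_cap c u : borel (code_conj_cap c u).
Proof.
apply: borel_ex2 => es.
  by apply: borel_all => e; apply: borel_imp (borel_const _) (borel_is_conj _ _).
apply: (@borel_gall _ (u.1 ++ flatten (map fst es)) (fun x y G =>
  (forall e, e \in es -> in_code e e.1 (map x e.1) G) -> in_code u u.1 (map x u.1) G)).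
  move=> G g x y gx gy; have sub c' : c' \in es ->
      {subset c'.1 <= u.1 ++ flatten (map fst es)}.
    move=> ccs a ac; rewrite mem_cat orbC; apply/orP; left.
    by apply/flattenP; exists c'.1 => //; exact: map_f.
  rewrite in_code1 (acts_look gx (@in_catl _ _ _)).
  split=> H He; apply: H => e ees; have := He e ees; rewrite in_code1;
  by rewrite (acts_look gx (sub e ees)).
move=> x y; apply: borel_imp; last exact: borel_in_code.
by apply: borel_all => e; apply: borel_imp (borel_const _) (borel_in_code _ _ _).
Qed.

Lemma borel_oligomorphic : borel (fun G => oligomorphic G).
Proof.
apply: borel_ext => [G|]; first exact: iff_sym (oligomorphicP G).
apply: borel_all => n; apply: borel_ex => ts; apply: borel_all => s.
apply: borel_imp (borel_const _) _.
by apply: borel_ex2 => t; [exact: borel_const|exact: borel_orb].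
Qed.

(** Quantifiers run over codes instead of cosets. That one coset has several codes does no harm,
    since atoms see only the coded sets. *)
Fixpoint code_sat (dom : coset_code -> closed_subgroup -> Prop) (f : fo_form atom)
    (e : seq coset_code) (G : closed_subgroup) : Prop :=
  match f with
  | Atom a => rel_atom a (map (cset G) e)
  | Neg f => ~ code_sat dom f e G
  | And f g => code_sat dom f e G /\ code_sat dom g e G
  | Ex f => exists c, dom c G /\ code_sat dom f (c :: e) G
  end.

Lemma borel_rel_atom a e : borel (fun G => rel_atom a (map (cset G) e)).
Proof.
case: a => [m|[[[i j] k]|[i j]]] /=.
- by apply: borel_ext (borel_meet (mask m e)) => G; rewrite map_mask.
- apply: (@borel_ext (fun G => match onth e i, onth e j, onth e k with
      | Some a, Some b, Some c => prodsub (cset G a) (cset G b) (cset G c)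
      | _, _, _ => False end)).
    move=> G; rewrite !onth_map.
    by case: (onth e i) (onth e j) (onth e k) => [?|] [?|] [?|].
  case: (onth e i) (onth e j) (onth e k) => [a|] [b|] [c|]; try exact: borel_const.
  exact: borel_prodsub.
- apply: (@borel_ext (fun G => match onth e i, onth e j with
      | Some a, Some b => cset G a = cset G b
      | None, None => True
      | _, _ => False end)).
    move=> G; rewrite !onth_map.
    case: (onth e i) (onth e j) => [a|] [b|] //=.
    by split=> [->//|[]].
  case: (onth e i) (onth e j) => [a|] [b|]; try exact: borel_const.
  exact: borel_eq.
Qed.

Lemma borel_code_sat dom f e : (forall c, borel (dom c)) -> borel (code_sat dom f e).
Proof.
move=> bd; elim: f e => [a|f IHf|f IHf g IHg|f IHf] e /=.
- exact: borel_rel_atom.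
- exact: borel_not.
- exact: borel_and.
- by apply: borel_ex => c; exact: borel_and.
Qed.

Lemma code_satP (G : closed_subgroup) (D : set (set (gt G))) dom f e
    (e' : seq (structure D)) :
  oligomorphic G -> admissible D ->
  (forall c, dom c G <-> Dcoset D (cset G c)) -> map (cset G) e = map val e' ->
  code_sat dom f e G <-> sat (@struct_rel G D) f e'.
Proof.
move=> olG admD domP; elim: f e e' => [a|f IHf|f IHf g IHg|f IHf] e e' ee' /=.
- by rewrite /struct_rel ee'.
- by rewrite (IHf e e').
- by rewrite (IHf e e')// (IHg e e').
- split=> [[c [/domP Xc]]|[x]].
    by rewrite (IHf _ (mkX Xc :: e')) /= ?ee'//; exists (mkX Xc).
  have [c cE] := cset_open_coset olG (Dcoset_open_coset admD (structureP x)).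
  exists c; split; first by apply/domP; rewrite -cE; exact: structureP.
  by apply/(IHf _ (x :: e')) => //=; rewrite ee' cE.
Qed.

(** * Coding a sequence of bits by a real number *)

Section real_code.
Variable R : realType.
Import Order.TTheory GRing.Theory Num.Theory numFieldNormedType.Exports.
Local Open Scope ring_scope.

(** In base 3 with digits 0 and 1 the weight of a digit exceeds the whole tail after it, so distinct
    sequences have distinct sums, unlike in base 2. *)
Definition partial_code (b : nat -> bool) (n : nat) : R :=
  \sum_(k < n) (b k)%:R * (3%:R^-1) ^+ k.

Definition real_code (b : nat -> bool) : R := sup (range (partial_code b)).

Lemma partial_codeS b n :
  partial_code b n.+1 = partial_code b n + (b n)%:R * (3%:R^-1) ^+ n.
Proof. by rewrite /partial_code big_ord_recr. Qed.

Lemma partial_code_mono b : {homo partial_code b : m n / (m <= n)%N >-> m <= n}.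
Proof.
apply/nondecreasing_seqP => n; rewrite partial_codeS lerDl.
by rewrite mulr_ge0 ?ler0n// exprn_ge0// invr_ge0 ler0n.
Qed.

Let w (n : nat) : R := (3%:R^-1) ^+ n.

Let w_gt0 n : 0 < w n. Proof. by rewrite exprn_gt0// invr_gt0 ltr0n. Qed.

Let wE n : w n = w n.+1 *+ 3.
Proof.
have E : (3%:R^-1 : R) *+ 3 = 1.
  by rewrite -[LHS]mulr_natl mulfV// pnatr_eq0.
by rewrite /w exprSr -mulrnAr E mulr1.
Qed.

(* The partial sums increase, and become decreasing once [2 / 3 ^ n], which
   exceeds the tail of the geometric series, is added. *)
Lemma partial_code_anti b :
  {homo (fun n => partial_code b n + w n *+ 2) : m n / (m <= n)%N >-> n <= m}.
Proof.
apply/nonincreasing_seqP => n; rewrite partial_codeS -addrA lerD2l -/(w n).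
have bw : (b n)%:R * w n <= w n by case: (b n); rewrite ?mul1r// mul0r ltW.
apply: le_trans (lerD bw (lexx _)) _.
by rewrite wE -mulrnDr -mulrnA ler_pMn2l.
Qed.

Lemma partial_code_ub b m n : partial_code b n <= partial_code b m + w m *+ 2.
Proof.
apply: (le_trans (partial_code_mono b (leq_addl m n))).
apply: le_trans (partial_code_anti b (leq_addr n m)).
by rewrite lerDl mulrn_wge0// ltW.
Qed.

Lemma partial_code_has_sup b : has_sup (range (partial_code b)).
Proof.
split; first by exists (partial_code b 0), 0%N.
by exists (partial_code b 0 + w 0 *+ 2) => _ [n _ <-]; exact: partial_code_ub.
Qed.

(** At the first difference [b] gains [1 / 3^n], while all that [c] can still add is at most
    [2 / 3^(n+1)]. *)
Lemma real_code_lt (b c : nat -> bool) n : (forall k, (k < n)%N -> b k = c k) -> b n -> ~~ c n ->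
  real_code c < real_code b.
Proof.
move=> bc bn cn; have E : partial_code b n = partial_code c n.
  by apply: eq_bigr => k _; rewrite bc.
have b1 : partial_code b n.+1 <= real_code b.
  by apply: (ub_le_sup (partial_code_has_sup b).2); exists n.+1.
apply: lt_le_trans b1; rewrite partial_codeS bn mul1r -/(w n).
apply: (@le_lt_trans _ _ (partial_code c n.+1 + w n.+1 *+ 2)).
  apply: ge_sup; first by exists (partial_code c 0), 0%N.
  by move=> _ [m _ <-]; exact: partial_code_ub.
by rewrite partial_codeS (negPf cn) mul0r addr0 E ltrD2l (wE n) ltr_pMn2l.
Qed.

Lemma real_code_inj : injective real_code.
Proof.
move=> b c bcE; apply/funext => n; move: bcE; apply: contraPP => bcn.
have : exists k, b k != c k by exists n; apply/eqP.
case/ex_minnP => m bm mP bcE.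
have lt k : (k < m)%N -> b k = c k.
  by move=> km; apply/eqP; apply: contraTT km => /mP; rewrite -leqNgt.
move: bm; case bm: (b m); case cm: (c m) => // _.
  by have := real_code_lt lt bm (negbT cm); rewrite bcE ltxx.
have lt' k : (k < m)%N -> c k = b k by move/lt.
by have := real_code_lt lt' cm (negbT bm); rewrite bcE ltxx.
Qed.

Lemma real_code_cvg b : partial_code b n @[n --> \oo] --> real_code b.
Proof.
apply: nondecreasing_cvgn; first exact: partial_code_mono.
by have [] := partial_code_has_sup b.
Qed.

(** The value is a pointwise limit of finite linear combinations of indicators of Borel sets. *)
Lemma measurable_real_code (P : nat -> closed_subgroup -> Prop) :
  (forall n, borel (P n)) ->
  measurable_fun setT (fun G => real_code (fun n => `[< P n G >])).
Proof.
move=> bP; apply: (@measurable_realfun.measurable_fun_cvg _ _ _ _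
    (fun n G => partial_code (fun n => `[< P n G >]) n)); last first.
  by move=> G _; exact: real_code_cvg.
move=> n; apply: measurable_sum => k; apply: measurable_realfun.measurable_funM => //.
rewrite (_ : (fun _ => _) = \1_[set G | P k G]).
  by apply: measurable_realfun.measurable_indic; exact: (bP k).
apply/funext => G; rewrite indicE; congr (nat_of_bool _)%:R.
Qed.

End real_code.

(** * Both conclusions from an isomorphism-invariant admissible family *)

Section invariant_family.
Variables (R : realType) (C : set closed_subgroup)
  (D : forall G : closed_subgroup, set (set (gt G))).
Hypotheses (bC : borel C) (olC : forall G, C G -> oligomorphic G)
  (admC : forall G, C G -> admissible (@D G))
  (D_inv : forall (G H : closed_subgroup) (f : gt G -> gt H), C G -> C H ->
     topological_isomorphism f -> forall U, D U -> D (f @` U))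
  (bD : forall c, borel (fun G => C G /\ D (cset G c))).

Lemma topological_isomorphism_inv (T T' : topGroupType) (f : T -> T') g :
  topological_isomorphism f -> cancel f g -> cancel g f ->
  topological_isomorphism g.
Proof.
move=> [fM fc [g' [fK g'K g'c]]] fgK gfK.
have -> : g = g' by apply/funext => y; apply: (can_inj fK); rewrite gfK g'K.
split; [|exact: g'c|by exists f].
by move=> x y; apply: (can_inj fK); rewrite fM !g'K.
Qed.

(** [C G] is included because membership in [D] is assumed Borel only jointly with [C]. *)
Definition code_dom (c : coset_code) (G : closed_subgroup) :=
  exists d, (C G /\ D (cset G d)) /\
    exists x, cset G c = lcoset_set x (cset G d).

Lemma borel_code_dom c : borel (code_dom c).
Proof. by apply: borel_ex => d; apply: borel_and => //; exact: borel_is_lcoset. Qed.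

Lemma code_domP c G : C G -> code_dom c G <-> Dcoset (@D G) (cset G c).
Proof.
move=> CG; have [DO _ _ _] := admC CG; split=> [[d [[_ DU] cE]]|[U DU cE]].
  by exists (cset G d).
have [d dE] := cset_open_subgroup (olC CG) (DO _ DU).
by exists d; rewrite -dE.
Qed.

Definition theory_bit n (G : closed_subgroup) :=
  exists f, form_index f = n /\ code_sat code_dom f [::] G.

Lemma borel_theory_bit n : borel (theory_bit n).
Proof.
have [[f fn]|no] := pselect (exists f : fo_form atom, form_index f = n).
  apply: borel_ext (borel_code_sat f [::] borel_code_dom) => G.
  split=> [Gf|[f' [f'n]]]; first by exists f.
  by have -> // : f' = f by apply: form_index_inj; rewrite f'n.
by apply: borel_ext (borel_const False) => G; split=> // -[f [fn _]]; case: no; exists f.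
Qed.

Lemma smooth_of_family : smooth_on R C closed_subgroup_iso.
Proof.
split; first exact: bC.
exists (fun G => real_code R (fun n => `[< theory_bit n G >])).
  by apply: measurable_funTS; apply: measurable_real_code; exact: borel_theory_bit.
move=> G H CG CH; split=> [[f ftop]|/real_code_inj GH].
  have [fM fc [g [fK gK gc]]] := ftop.
  have gtop := topological_isomorphism_inv ftop fK gK.
  congr real_code; apply/funext => n; apply/asbool_equiv_eq.
  have E th := theory_of_iso th fM fK gK (D_inv CG CH ftop) (D_inv CH CG gtop).
  have satE th (K : closed_subgroup) (CK : C K) :=
    @code_satP K _ code_dom th [::] [::] (olC CK) (admC CK) (fun c => code_domP c CK) erefl.
  by split=> -[th [thn]]; rewrite satE// => GH; exists th; split=> //;
    rewrite satE//; exact/E.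
apply: (iso_of_theory (admC CG) (admC CH) (olC CG) (olC CH)) => th.
rewrite -(@code_satP G _ code_dom th [::])//; [|exact: olC|exact: admC|];
  last by move=> c; exact: code_domP.
rewrite -(@code_satP H _ code_dom th [::])//; [|exact: olC|exact: admC|];
  last by move=> c; exact: code_domP.
have bitE (K : closed_subgroup) : theory_bit (form_index th) K <-> code_sat code_dom th [::] K.
  by split=> [[f [/form_index_inj -> //]]|?]; exists th.
rewrite -!bitE; have := congr1 (fun b => b (form_index th)) GH.
by move=> /= E; split=> /asboolP; [rewrite E|rewrite -E] => /asboolP.
Qed.

Lemma aut_of_family G : C G -> profinite (out (gt G)) /\
  exists2 H : closed_subgroup, oligomorphic H &
    topologically_isomorphic (aut (gt G)) (gt H).
Proof.
move=> CG; have D_aut f := @D_inv G G f CG CG.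
split; first exact: (out_profinite (olC CG) (admC CG) D_aut).
exact: (aut_oligomorphic (olC CG) (admC CG) D_aut).
Qed.

End invariant_family.

(** * Groups without algebraicity *)

Lemma no_algebraicityP (G : closed_subgroup) : no_algebraicity G <->
  forall s a, a \notin s -> forall bs : seq nat,
    exists2 g : gt G, stab s g & act g a \notin bs.
Proof.
split=> [noG s a as_ bs|noG S /finite_seqP[s ->] a as_ /finite_seqP[bs bsE]].
  apply: contrapT => no; apply: (noG [set` s] (finite_seq s) a).
    by apply/negP.
  apply: (@sub_finite_set _ _ [set` bs]) (finite_seq bs) => _ [x [Gx xs] <-] /=.
  apply: contrapT => /negP xa; apply: no.
  by exists (exist _ x (mem_set Gx)) => //; apply/stabP => b /xs.
have [|g /stabP gs /negP] := noG s a _ bs; first exact/negP.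
apply; have : [set bij_fun x a | x in G `&` pointwise_stab [set` s]] (act g a).
  by exists (val g) => //; split; [exact/set_mem/(valP g)|exact: gs].
by rewrite bsE.
Qed.

Lemma conj_stab (G : closed_subgroup) s (g : gt G) :
  conj_set (stab s) g = stab (acts g^-1 s).
Proof.
rewrite conj_setE; apply/seteqP; split=> h; rewrite /stab /= conjgE invgK !actsM.
  by move=> hs; apply: (@acts_inj _ g); rewrite hs actsKV.
by move=> ->; rewrite actsKV.
Qed.

Definition point_stabilizers (G : closed_subgroup) : set (set (gt G)) :=
  [set stab [:: a] | a in [set: nat]].

Lemma point_stabilizers_admissible (G : closed_subgroup) :
  oligomorphic G -> admissible (@point_stabilizers G).
Proof.
move=> olG; split.
- by move=> _ [a _ <-]; exact: stab_open_subgroup.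
- by move=> _ g [a _ <-]; rewrite conj_stab; exists (act g^-1 a).
- move=> V /open_subgroup_stab[_ [s sV]].
  exists [seq stab [:: a] | a <- s] => [_ /mapP[a _ ->]|g gs]; first by exists a.
  apply: sV; apply/stabP => a sa; apply: (stabP [:: a] g).1; last exact: mem_head.
  by apply: gs; exact: (map_f (fun a => stab [:: a])).
- have [ts tsP] := (oligomorphicP G).1 olG 1%N.
  exists [seq stab [:: head 0 t] | t <- ts] => [_ /mapP[t _ ->]|_ [a _ <-]].
    by exists (head 0 t).
  have [//|t tts [g gt]] := tsP [:: a].
  exists (stab [:: head 0 t]); first exact: (map_f (fun t => stab [:: head 0 t])).
  by exists g^-1; rewrite conj_stab invgK; case: t gt {tts} => [|b [|]] //= [<-].
Qed.

Section interalgebraicity.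
Variables (G H : closed_subgroup) (f : gt G -> gt H) (h : gt H -> gt G).
Hypotheses (ft : topological_isomorphism f) (fK : cancel f h) (hK : cancel h f)
  (noG : no_algebraicity G).

Let fM x y : f (x * y) = f x * f y. Proof. by have [-> _ _] := ft. Qed.

Let hM x y : h (x * y) = h x * h y.
Proof. by apply: (can_inj fK); rewrite fM !hK. Qed.

Let f1 : f 1 = 1.
Proof. by apply: (mulgI (f 1)); rewrite -fM !mulg1. Qed.

Let fV x : f x^-1 = (f x)^-1.
Proof. by apply: (mulgI (f x)); rewrite -fM !mulgV f1. Qed.

(* In model-theoretic terms, [a] is in acl(b) when [G] acts on [b] through [f]. *)
Definition algebraic_over (G H : closed_subgroup) (f : gt G -> gt H) (a b : nat) :=
  exists s : seq nat, forall g, act (f g) b = b -> act g a \in s.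

(* Otherwise the stabilizer of any [b] contains the stabilizer of a finite set
   avoiding [a], and thus so does the stabilizer of [a]. *)
Lemma algebraic_over_ex a : exists b, algebraic_over f a b.
Proof.
apply: contrapT => no.
have cf : continuous f by have [] := ft.
have ch : continuous h.
  have [_ _ [h' [fK' hK' ch']]] := ft; have -> // : h = h'.
  by apply/funext => y; apply: (can_inj fK); rewrite hK hK'.
have /choice[T TP] b : exists T : seq nat, a \notin T /\
    forall g : gt G, stab T g -> act (f g) b = b.
  have /(nbhs_act 1)[t tP] : nbhs (1 : gt G) (f @^-1` stab [:: b]).
    apply: cf; rewrite f1; apply: open_nbhs_nbhs; split; first exact: open_stab.
    exact: acts1.
  (* The stabiliser of [t] fixes [b], but [t] may contain [a]. As [a] is not algebraic over [b],
     some [g] fixing [b] moves [a] off [t]; then [g^-1 t] avoids [a], and its stabiliser, a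
     conjugate by [g], still fixes [b]. *)
  have [g [gb ga]] : exists g, act (f g) b = b /\ act g a \notin t.
    apply: contrapT => nog; apply: no; exists b, t => g gb.
    by apply: contrapT => /negP ga; apply: nog; exists g.
  exists (acts g^-1 t); split.
    by apply: contra ga => /mapP[c ct ->]; rewrite actKV.
  move=> k; rewrite -conj_stab conj_setE /= => kt.
  have := tP (k ^ g^-1); rewrite acts1 => /(_ kt).
  have gVb : act (f g)^-1 b = b by rewrite -[in LHS]gb actK.
  rewrite /stab /= /acts /= conjgE invgK !fM fV !actM gVb => -[E].
  by apply: (@act_inj _ (f g)); rewrite E gb.
have [S SP] : exists S, forall k : gt H, stab S k -> act (h k) a = a.
  have /(nbhs_act 1)[S SP] : nbhs (1 : gt H) (h @^-1` stab [:: a]).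
    apply: ch; have -> : h 1 = 1 by apply: (can_inj fK); rewrite hK f1.
    by apply: open_nbhs_nbhs; split; [exact: open_stab|exact: acts1].
  by exists S => k; rewrite /stab /= => kS; have := SP k; rewrite acts1 => /(_ kS)[].
have [|g /stabP gS] := (no_algebraicityP G).1 noG (flatten (map T S)) a _ [:: a].
  apply/negP => /flattenP[_ /mapP[b _ ->] aT].
  by have [/negP] := TP b.
rewrite inE => /eqP; apply; rewrite -[g]fK; apply: SP; apply/stabP => b bS.
have [_] := TP b; apply; apply/stabP => c cT; apply: gS.
by apply/flattenP; exists (T b) => //; exact: map_f.
Qed.

(** Algebraicity is transitive: the stabiliser of [c] moves [b] to finitely many points, and over
    each of them [a] has finitely many images. So [a] has a finite orbit under the stabiliser of
    [c], which without algebraicity forces [a = c]. *)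
Lemma algebraic_over_antisym a b c :
  algebraic_over f a b -> algebraic_over h b c -> a = c.
Proof.
move=> [s sP] [t tP]; apply/eqP; apply: contrapT => /negP ac.
have /choice[k kP] b' : exists k : gt G,
    (exists g : gt G, act (f g) b = b') -> act (f k) b = b'.
  by have [[g gb]|no] := pselect (exists g, act (f g) b = b');
    [exists g|exists 1 => /no].
have [|g /stabP gc] := (no_algebraicityP G).1 noG [:: c] a _
    (flatten [seq acts (k b') s | b' <- t]); first by rewrite inE.
move/negP; apply; apply/flattenP; exists (acts (k (act (f g) b)) s).
  apply: (map_f (fun b' => acts (k b') s)); apply: tP; rewrite fK.
  by apply: gc; rewrite mem_head.
have kg := kP (act (f g) b) (ex_intro _ g erefl).
set l := k _ in kg *.
have -> : act g a = act l (act (l^-1 * g) a) by rewrite -actM mulVKg.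
by apply: (map_f (act l)); apply: sP; rewrite fM fV actM -kg actK.
Qed.

End interalgebraicity.

Section point_stabilizers_iso.
Variables (G H : closed_subgroup) (f : gt G -> gt H) (h : gt H -> gt G).
Hypotheses (ft : topological_isomorphism f) (ht : topological_isomorphism h)
  (fK : cancel f h) (hK : cancel h f) (noG : no_algebraicity G)
  (noH : no_algebraicity H).

(** Translating by [g], the point [a = g a] is algebraic over the image of [b] under [f g]. Since
    [b] is algebraic over [a], antisymmetry on the side of [H] identifies [b] with its image. *)
Lemma interalgebraic_fixed a b g : algebraic_over f a b -> algebraic_over h b a ->
  act g a = a -> act (f g) b = b.
Proof.
move=> [s sP] ba ga; symmetry; apply: (algebraic_over_antisym ht hK noH ba).
have [fM _ _] := ft.
exists (acts g s) => k kb; have := sP (k ^ g).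
have -> : act (f (k ^ g)) b = b.
  apply: (@act_inj _ (f g)); rewrite -[RHS]kb -!actM -!fM; congr (act (f _) _).
  by rewrite conjgE mulVKg.
move=> /(_ erefl) ks; apply/mapP; exists (act (k ^ g) a) => //.
by rewrite -actM conjgE mulVKg actM ga.
Qed.

End point_stabilizers_iso.

(** Choose [b] with [a] algebraic over [b], then [c] with [b] algebraic over [c]. Antisymmetry gives
    [a = c], so [a] and [b] are interalgebraic and their stabilisers correspond under [f]. *)
Lemma point_stabilizers_iso (G H : closed_subgroup) (f : gt G -> gt H) U :
  no_algebraicity G -> no_algebraicity H -> topological_isomorphism f ->
  point_stabilizers U -> point_stabilizers (f @` U).
Proof.
move=> noG noH ft [a _ <-]; have [_ _ [h [fK hK _]]] := ft.
have ht := topological_isomorphism_inv ft fK hK.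
have [b ab] := algebraic_over_ex ft fK hK noG a.
have [c bc] := algebraic_over_ex ht hK fK noH b.
have ac := algebraic_over_antisym ft fK noG ab bc; subst c.
exists b => //; apply/seteqP; split=> [k|_ [g ga <-]]; rewrite /stab /= /acts /=.
  move=> -[kb]; exists (h k); last exact: hK.
  by rewrite /stab /acts /= (interalgebraic_fixed ht ft fK noG bc ab kb).
have [ga'] := ga.
by rewrite (interalgebraic_fixed ft ht hK noH ab bc ga').
Qed.

Lemma borel_no_algebraicity_class : borel no_algebraicity_class.
Proof.
apply: borel_and; first exact: borel_oligomorphic.
apply: (@borel_ext (fun G => forall s a, a \notin s -> forall bs : seq nat,
    exists b, b \notin bs /\ orb G (rcons s a) (rcons s b))).
  move=> G; rewrite no_algebraicityP; split=> noG s a as_ bs; have := noG s a as_ bs.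
    move=> [b [bbs [g]]]; rewrite /acts map_rcons => /rcons_inj[gs gb].
    by exists g => //; rewrite gb.
  move=> [g gs gb]; exists (act g a); split=> //; exists g.
  by rewrite /acts map_rcons; congr rcons; exact: gs.
apply: borel_all => s; apply: borel_all => a; apply: borel_imp (borel_const _) _.
apply: borel_all => bs; apply: borel_ex => b.
exact: borel_and (borel_const _) (borel_orb _ _).
Qed.

Lemma cset_stab (G : closed_subgroup) a : cset G ([:: a], [:: [:: a]]) = stab [:: a].
Proof.
apply/seteqP; split=> [g [_ /[!inE]/eqP-> [k]]|g gs].
  rewrite /stab /acts /= => -[ka kga]; congr [:: _].
  by apply: (@act_inj _ k); rewrite kga.
exists [:: a]; first exact: mem_head.
have -> : acts g ([:: a], [:: [:: a]]).1 = [:: a] by exact: gs.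
exact: orb_refl.
Qed.

Lemma borel_point_stabilizers c :
  borel (fun G => no_algebraicity_class G /\ point_stabilizers (cset G c)).
Proof.
apply: borel_and borel_no_algebraicity_class _.
apply: borel_ext (borel_ex (fun a => borel_eq c ([:: a], [:: [:: a]]))) => G.
by split=> [[a]|[a _ aE]]; [rewrite cset_stab => ->|]; exists a => //; rewrite cset_stab.
Qed.

(** * Essential subgroups *)

(** Symmetric in [f] and [g], so that each transport lemma also applies to the inverse. *)
Definition iso_pair (T T' : topGroupType) (f : T -> T') (g : T' -> T) :=
  [/\ {morph f : x y / x * y}, {morph g : x y / x * y}, continuous f,
      continuous g & cancel f g /\ cancel g f].

Lemma iso_pair_sym (T T' : topGroupType) (f : T -> T') g : iso_pair f g -> iso_pair g f.
Proof. by move=> [? ? ? ? []]. Qed.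

Lemma iso_pairP (T T' : topGroupType) (f : T -> T') :
  topological_isomorphism f -> exists g, iso_pair f g.
Proof.
move=> ft; have [fM fc [g [fK gK gc]]] := ft.
by exists g; split=> //; have [] := topological_isomorphism_inv ft fK gK.
Qed.

(** Maximality is tested against single subgroups comparable with all members, instead of against
    larger chains; single subgroups can be transported and coded. *)
Lemma maximal_subgroup_chainP (T : topGroupType) (U : set T) (C : set (set T)) :
  maximal_subgroup_chain U C <-> subgroup_chain U C /\
  forall V, is_subgroup V -> U `<=` V ->
    (forall W, C W -> V `<=` W \/ W `<=` V) -> C V.
Proof.
split=> -[chC CP]; (split; first exact: chC); [move=> V sV UV VC|move=> C' chC' CC'].
  have <- : [set W | C W \/ W = V] = C; last by right.
  apply: CP => [|W CW]; last by left.
  have [CU CT Csub Ctot] := chC; split; [by left|by left| |].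
    by move=> W [/Csub//|->].
  move=> W W' [CW|->] [CW'|->]; [exact: Ctot| | |by left].
    by have [VW|WV] := VC _ CW; [right|left].
  by have [VW|WV] := VC _ CW'; [left|right].
apply/seteqP; split=> // V C'V; have [_ _ C'sub C'tot] := chC'.
have [sV UV] := C'sub _ C'V; apply: CP => // W CW.
exact: C'tot C'V (CC' _ CW).
Qed.

Section transport.
Variables (T T' : topGroupType) (f : T -> T') (g : T' -> T).
Hypothesis fg : iso_pair f g.

Lemma image_isoK A : g @` (f @` A) = A.
Proof.
have [_ _ _ _ [fK _]] := fg; rewrite image_comp -[RHS]image_id.
by apply: eq_imagel => x _ /=.
Qed.

Lemma image_subgroup U : is_subgroup U -> is_subgroup (f @` U).
Proof.
have [fM _ _ _ _] := fg.
have f1 : f 1 = 1 by apply: (mulgI (f 1)); rewrite -fM !mulg1.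
move=> [U1 UM UV]; split; first by exists 1.
  by move=> _ _ [x Ux <-] [y Uy <-]; exists (x * y); [exact: UM|exact: fM].
move=> _ [x Ux <-]; exists x^-1; first exact: UV.
by apply: (mulgI (f x)); rewrite -fM !mulgV.
Qed.

Lemma image_open_subgroup U : open_subgroup U -> open_subgroup (f @` U).
Proof.
have [_ _ _ gc [fK gK]] := fg.
move=> [oU sU]; split; last exact: image_subgroup.
rewrite (_ : f @` U = g @^-1` U); first by apply: open_comp.
apply/seteqP; split=> [_ [x Ux <-]|y Uy]; first by rewrite /= fK.
by exists (g y).
Qed.

Lemma image_lcoset x U : f @` lcoset_set x U = lcoset_set (f x) (f @` U).
Proof.
have [fM _ _ _ _] := fg.
apply/seteqP; split=> _ [_ [u Uu <-] <-].
  by exists (f u); [exists u|rewrite fM].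
by exists (x * u); [exists u|rewrite fM].
Qed.

Lemma image_conj_set U x : f @` conj_set U x = conj_set (f @` U) (f x).
Proof.
have [fM _ _ _ _] := fg.
have fJ y : f (y ^ x) = f y ^ f x.
  by rewrite !conjgE; apply: (mulgI (f x)); rewrite -fM !mulVKg fM.
apply/seteqP; split=> _ [_ [u Uu <-] <-].
  by exists (f u); [exists u|rewrite fJ].
by exists (u ^ x); [exists u|rewrite fJ].
Qed.

Lemma image_finite_index K H : finite_index K H -> finite_index (f @` K) (f @` H).
Proof.
move=> fin; apply: sub_finite_set (finite_image (fun A => f @` A) fin).
move=> _ [_ [h Hh <-] <-]; exists (lcoset_set h K); first by exists h.
exact: image_lcoset.
Qed.

End transport.

Section transport_essential.
Variables (T T' : topGroupType) (f : T -> T') (g : T' -> T).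
Hypothesis fg : iso_pair f g.
Let gf := iso_pair_sym fg.

Lemma image_irreducible H : irreducible H -> irreducible (f @` H).
Proof.
move=> [oH Hirr]; split; first exact: (image_open_subgroup fg oH).
move=> K oK KH finK; rewrite -(image_isoK gf K); congr image.
apply: Hirr; first exact: (image_open_subgroup gf oK).
  by rewrite -(image_isoK fg H); exact: image_subset.
by rewrite -(image_isoK fg H); exact: (image_finite_index gf finK).
Qed.

Lemma image_almost_essential H : almost_essential H -> almost_essential (f @` H).
Proof.
move=> [Hirr HP]; split; first exact: image_irreducible.
move=> U /(image_open_subgroup gf)/HP[F finF FU].
exists (f @` F); first exact: finite_image.
move=> y yF; have [_ _ _ _ [fK gK]] := fg; rewrite -(image_isoK gf U); exists (g y) => //.
apply: FU => x Fx; have := yF (f x); rewrite -(image_conj_set fg).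
by move=> /(_ (ex_intro2 _ _ x Fx erefl))[z Hz <-]; rewrite fK.
Qed.

Lemma image_chain U C : subgroup_chain U C ->
  subgroup_chain (f @` U) [set f @` V | V in C].
Proof.
move=> [CU CT Csub Ctot]; have [_ _ _ _ [fK gK]] := fg; split.
- by exists U.
- exists setT => //; apply/seteqP; split=> // y _; by exists (g y).
- move=> _ [V /Csub[sV UV] <-]; split; first exact: (image_subgroup fg sV).
  exact: image_subset.
- move=> _ _ [V CV <-] [W CW <-].
  by have [VW|WV] := Ctot _ _ CV CW; [left|right]; exact: image_subset.
Qed.

Lemma image_maximal_chain U C : maximal_subgroup_chain U C ->
  maximal_subgroup_chain (f @` U) [set f @` V | V in C].
Proof.
move=> /maximal_subgroup_chainP[chC CP]; apply/maximal_subgroup_chainP.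
split; first exact: image_chain.
move=> V sV UV VC; exists (g @` V); last exact: (image_isoK gf).
apply: CP; first exact: (image_subgroup gf sV).
  by rewrite -(image_isoK fg U); exact: image_subset.
move=> W CW; rewrite -(image_isoK fg W).
by have [|VW|WV] := VC (f @` W); [exists W|left; exact: image_subset|right; exact: image_subset].
Qed.

Lemma image_chain_card (C : set (set T)) n :
  C #= `I_n -> [set f @` V | V in C] #= `I_n.
Proof.
apply: card_eq_trans; apply: inj_card_eq => V W _ _ VW.
by rewrite -(image_isoK fg V) VW image_isoK.
Qed.

End transport_essential.

Lemma image_has_depth (T T' : topGroupType) (f : T -> T') g U d :
  iso_pair f g -> has_depth U d -> has_depth (f @` U) d.
Proof.
move=> fg [[C Cmax Cd] dmin]; split.
  exists [set f @` V | V in C]; first exact: (image_maximal_chain fg Cmax).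
  exact: (image_chain_card fg Cd).
move=> C' e C'max C'e; have gf := iso_pair_sym fg.
apply: (dmin [set g @` V | V in C']); last exact: (image_chain_card gf C'e).
by rewrite -(image_isoK fg U); exact: (image_maximal_chain gf C'max).
Qed.

Lemma image_essential (T T' : topGroupType) (f : T -> T') U :
  topological_isomorphism f -> essential U -> essential (f @` U).
Proof.
move=> /iso_pairP[g fg] [Ualm [d Ud dmin]]; have gf := iso_pair_sym fg.
split; first exact: (image_almost_essential fg Ualm).
exists d; first exact: (image_has_depth fg Ud).
move=> K e Kalm Ke; apply: (dmin (g @` K)).
  exact: (image_almost_essential gf Kalm).
exact: (image_has_depth gf Ke).
Qed.

Lemma essential_admissible (G : closed_subgroup) : oligomorphic G ->
  finitely_many_essential (gt G) -> admissible [set U : set (gt G) | essential U].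
Proof.
move=> olG [[H Hess] [F /finite_seqP[Ks ->] KsP]].
have essJ (U : set (gt G)) g : essential U -> essential (conj_set U g).
  exact: image_essential (conj_topological_isomorphism g).
split=> /=.
- by move=> U [[[]]].
- by move=> U g; exact: essJ.
(* The conjugates of a single essential subgroup already yield a basis at 1; here the existence of
   one is used. *)
- move=> V oV; have [[_ /(_ V oV)[E /finite_seqP[gs ->] EV]] _] := Hess.
  exists [seq conj_set H g | g <- gs] => [_ /mapP[g _ ->]|x xU]; first exact: essJ.
  by apply: EV => g gsg; apply: xU; exact: map_f.
(* The given representatives need not be essential, so the others are discarded; one that is
   conjugate to an essential subgroup is itself essential. *)
- exists [seq K <- Ks | `[< essential K >]] => [K|U Uess].
    by rewrite mem_filter => /andP[/asboolP].
  have [K KKs [g UE]] := KsP _ Uess; exists K; last by exists g.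
  rewrite mem_filter; apply/andP; split=> //; apply/asboolP.
  by rewrite -(conj_setK g K) -UE; exact: essJ.
Qed.

(** * Essential subgroups in terms of codes *)

Section essential_codes.
Implicit Types (c d e u v : coset_code) (G : closed_subgroup).

(** Quantifiers over open subgroups become quantifiers over codes [d] with [is_subgroup (cset G d)];
    openness of coded sets is automatic. *)
Definition code_irreducible c G := is_subgroup (cset G c) /\
  forall d, is_subgroup (cset G d) -> cset G d `<=` cset G c ->
    code_index c d G -> cset G c `<=` cset G d.

Definition code_almost_essential c G := code_irreducible c G /\
  forall u, is_subgroup (cset G u) -> code_conj_cap c u G.

Definition code_setT : coset_code := ([::], [:: [::]]).

(** Members are compared through [cset], because one subgroup has many codes; the injectivity clause
    makes [n + 1] the number of members of the chain. *)
Definition code_maximal_chain c n G := exists es : seq coset_code,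
  [/\ size es = n.+1 /\
      forall i j, cset G (nth code_setT es i) = cset G (nth code_setT es j) ->
        (i < n.+1)%N -> (j < n.+1)%N -> i = j,
      (exists2 e, e \in es & cset G e = cset G c) /\
      (exists2 e, e \in es & cset G e = cset G code_setT),
      forall e, e \in es -> is_subgroup (cset G e) /\ cset G c `<=` cset G e,
      forall e, e \in es -> forall e', e' \in es ->
        cset G e `<=` cset G e' \/ cset G e' `<=` cset G e &
      forall v, is_subgroup (cset G v) -> cset G c `<=` cset G v ->
        (forall e, e \in es -> cset G v `<=` cset G e \/ cset G e `<=` cset G v) ->
        exists2 e, e \in es & cset G e = cset G v].

Definition code_has_depth c n G := code_maximal_chain c n G /\
  forall m, code_maximal_chain c m G -> (n <= m)%N.

Definition code_essential c G := code_almost_essential c G /\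
  exists n, code_has_depth c n G /\
    forall d m, code_almost_essential d G -> code_has_depth d m G -> (n <= m)%N.

Lemma borel_code_almost_essential c : borel (code_almost_essential c).
Proof.
apply: borel_and; last first.
  by apply: borel_all => u; apply: borel_imp (borel_subgroup _) (borel_code_conj_cap _ _).
apply: borel_and; first exact: borel_subgroup.
apply: borel_all => d; apply: borel_imp (borel_subgroup _) _.
by apply: borel_imp (borel_sub _ _) (borel_imp (borel_code_index _ _) (borel_sub _ _)).
Qed.

Lemma borel_and5 P1 P2 P3 P4 P5 : borel P1 -> borel P2 -> borel P3 -> borel P4 ->
  borel P5 -> borel (fun G => [/\ P1 G, P2 G, P3 G, P4 G & P5 G]).
Proof.
move=> b1 b2 b3 b4 b5.
apply: borel_ext (borel_and b1 (borel_and b2 (borel_and b3 (borel_and b4 b5)))) => G.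
by split=> [[? [? [? []]]]|[]].
Qed.

Lemma borel_in_ex (T : countType) (s : seq T) (P : T -> closed_subgroup -> Prop) :
  (forall x, borel (P x)) -> borel (fun G => exists2 x, x \in s & P x G).
Proof. by move=> bP; apply: borel_ex2 => // x; exact: borel_const. Qed.

Lemma borel_in_all (T : countType) (s : seq T) (P : T -> closed_subgroup -> Prop) :
  (forall x, borel (P x)) -> borel (fun G => forall x, x \in s -> P x G).
Proof. by move=> bP; apply: borel_all => x; apply: borel_imp (borel_const _) _. Qed.

Lemma borel_code_maximal_chain c n : borel (code_maximal_chain c n).
Proof.
apply: borel_ex => es; apply: borel_and5.
- apply: borel_and (borel_const _) _; apply: borel_all => i; apply: borel_all => j.
  exact: borel_imp (borel_eq _ _) (borel_const _).
- by apply: borel_and; apply: borel_in_ex => e; exact: borel_eq.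
- by apply: borel_in_all => e; exact: borel_and (borel_subgroup _) (borel_sub _ _).
- apply: borel_in_all => e; apply: borel_in_all => e'.
  exact: borel_or (borel_sub _ _) (borel_sub _ _).
- apply: borel_all => v; apply: borel_imp (borel_subgroup _) _.
  apply: borel_imp (borel_sub _ _) _; apply: borel_imp.
    by apply: borel_in_all => e; exact: borel_or (borel_sub _ _) (borel_sub _ _).
  by apply: borel_in_ex => e; exact: borel_eq.
Qed.

Lemma borel_code_has_depth c n : borel (code_has_depth c n).
Proof.
apply: borel_and (borel_code_maximal_chain _ _) _; apply: borel_all => m.
exact: borel_imp (borel_code_maximal_chain _ _) (borel_const _).
Qed.

Lemma borel_code_essential c : borel (code_essential c).
Proof.
apply: borel_and (borel_code_almost_essential _) _; apply: borel_ex => n.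
apply: borel_and (borel_code_has_depth _ _) _.
apply: borel_all => d; apply: borel_all => m.
apply: borel_imp (borel_code_almost_essential _) _.
exact: borel_imp (borel_code_has_depth _ _) (borel_const _).
Qed.

Variables (G : closed_subgroup) (olG : oligomorphic G).

Lemma cset_setT : cset G code_setT = setT.
Proof.
apply/seteqP; split=> // g _; exists [::]; first exact: mem_head.
exact: orb_refl.
Qed.

Lemma cset_open_subgroupE c : open_subgroup (cset G c) <-> is_subgroup (cset G c).
Proof. by split=> [[]//|]; split=> //; exact: cset_open. Qed.

Lemma code_indexP c d : is_subgroup (cset G d) ->
  code_index c d G <-> finite_index (cset G d) (cset G c).
Proof.
move=> sd; split=> [[es esP]|/finite_seqP[As AsE]].
  apply: sub_finite_set (finite_image (cset G) (finite_seq es)) => _ [g cg <-].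
  by have [e ees eE] := esP g cg; exists e.
have /choice[k kP] A : exists e, open_coset A -> A = cset G e.
  have [/(cset_open_coset olG)[e eE]|no] := pselect (open_coset A); first by exists e.
  by exists code_setT => /no.
exists (map k As) => g cg; exists (k (lcoset_set g (cset G d))).
  apply: map_f; have : [set lcoset_set h (cset G d) | h in cset G c] (lcoset_set g (cset G d)).
    by exists g.
  by rewrite AsE.
symmetry; apply: kP; exists (cset G d); last by exists g.
exact/cset_open_subgroupE.
Qed.

Lemma code_irreducibleP c : code_irreducible c G <-> irreducible (cset G c).
Proof.
split=> -[sc cP]; split.
- exact/cset_open_subgroupE.
- move=> K oK Kc Kfin; have [d dE] := cset_open_subgroup olG oK.
  apply/seteqP; split=> //; rewrite dE in oK Kc Kfin *; apply: cP => //.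
    by have [] := oK.
  by apply/code_indexP => //; have [] := oK.
- by have [] := sc.
- by move=> d sd dc /(code_indexP _ sd) fin; rewrite (cP (cset G d))//; exact/cset_open_subgroupE.
Qed.

Lemma code_conj_capP c u : is_subgroup (cset G c) -> code_conj_cap c u G <->
  exists2 F : set (gt G), finite_set F & \bigcap_(g in F) conj_set (cset G c) g `<=` cset G u.
Proof.
move=> sc; split=> [[es esP esu]|[F /finite_seqP[gs ->] Fu]].
  have /choice[k kP] e : exists x, e \in es -> cset G e = conj_set (cset G c) x.
    by have [/esP[x xE]|no] := boolP (e \in es); [exists x|exists 1].
  exists (k @` [set` es]); first exact/finite_image/finite_seq.
  move=> g gF; apply: esu => e ees; rewrite (kP _ ees); apply: gF; by exists e.
have /choice[k kP] x : exists e, conj_set (cset G c) x = cset G e.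
  by apply: (cset_open_subgroup olG); apply: conj_set_open_subgroup; exact/cset_open_subgroupE.
exists (map k gs) => [_ /mapP[x _ ->]|g gk]; first by exists x; rewrite kP.
by apply: Fu => x xgs; rewrite kP; apply: gk; exact: map_f.
Qed.

Lemma code_almost_essentialP c : code_almost_essential c G <-> almost_essential (cset G c).
Proof.
split=> -[/code_irreducibleP irrc cP]; split=> //.
- move=> U oU; have [u uE] := cset_open_subgroup olG oU; rewrite uE in oU *.
  apply/code_conj_capP; first by have [[]] := irrc.
  by apply: cP; have [] := oU.
- move=> u su; apply/code_conj_capP; first by have [[]] := (code_irreducibleP c).1 irrc.
  exact/cP/cset_open_subgroupE.
Qed.

Lemma code_maximal_chainP c n : is_subgroup (cset G c) -> code_maximal_chain c n G <->
  exists2 C, maximal_subgroup_chain (cset G c) C & C #= `I_n.+1.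
Proof.
(* Subgroups above an open subgroup are open, so every member of the chain has a code. *)
move=> sc; have coded V : is_subgroup V -> cset G c `<=` V -> exists v, V = cset G v.
  move=> sV cV; apply: (cset_open_subgroup olG); apply/open_subgroup_stab; split=> //.
  have /open_subgroup_stab[_ [s sc']] := (cset_open_subgroupE c).2 sc.
  by exists s; exact: subset_trans cV.
split.
  move=> [es [[sz inj] [[e0 e0s e0c] [e1 e1s e1T]] essub estot esmax]].
  exists (cset G @` [set` es]).
    apply/maximal_subgroup_chainP; split; first split.
    - by exists e0.
    - by exists e1 => //; rewrite e1T cset_setT.
    - by move=> _ [e /essub ? <-].
    - by move=> _ _ [e ees <-] [e' ees' <-]; exact: estot.
    move=> V sV cV VC; have [v vE] := coded V sV cV; rewrite vE in sV cV VC *.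
    have [|e ees eE] := esmax v sV cV; last by exists e.
    by move=> e ees; apply: VC; exists e.
  rewrite card_eq_sym; apply/card_set_bijP; exists (fun i => cset G (nth code_setT es i)).
  split.
  - by move=> i /= ni; exists (nth code_setT es i) => //=; rewrite mem_nth ?sz.
  - by move=> i j /[!inE] ni nj /= ij; exact: inj.
  - move=> _ [e /= ees <-]; exists (index e es); last by rewrite nth_index.
    by rewrite /= -sz index_mem.
move=> [C /maximal_subgroup_chainP[[Cc CT Csub Ctot] Cmax]].
rewrite card_eq_sym => /card_set_bijP[f [fC fI fS]].
have /choice[k kP] i : exists e, `I_n.+1 i -> f i = cset G e.
  have [ni|no] := pselect (`I_n.+1 i); last by exists code_setT.
  by have [sf cf] := Csub _ (fC _ ni); have [e eE] := coded _ sf cf; exists e.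
pose es := map k (iota 0 n.+1).
have esE i : (i < n.+1)%N -> cset G (nth code_setT es i) = f i.
  by move=> ni; rewrite (nth_map 0) ?size_iota// nth_iota// kP.
have esC e : e \in es -> C (cset G e).
  move=> /mapP[i /[!mem_iota] /andP[_ ni] ->]; rewrite -kP//; exact: fC.
have Ces V : C V -> exists2 e, e \in es & cset G e = V.
  move=> /fS[i ni <-]; exists (k i); last by rewrite -kP.
  by apply: map_f; rewrite mem_iota.
exists es; split.
- split; first by rewrite size_map size_iota.
  move=> i j + ni nj; rewrite !esE// => fij.
  by apply: fI => //; rewrite inE.
- by split; apply: Ces; rewrite ?cset_setT.
- by move=> e /esC/Csub.
- by move=> e /esC Ce e' /esC Ce'; exact: Ctot.
- move=> v sv cv vC; apply: (Ces); apply: Cmax => // W /Ces[e ees <-].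
  exact: vC.
Qed.

Lemma code_has_depthP c n : is_subgroup (cset G c) ->
  code_has_depth c n G <-> has_depth (cset G c) n.
Proof.
move=> sc; rewrite /code_has_depth /has_depth code_maximal_chainP//.
split=> -[? cP]; (split; first by []); [move=> C e Cmax Ce|
  move=> m /(code_maximal_chainP _ sc)[C Cmax Cm]].
  by apply: cP; apply/code_maximal_chainP => //; exists C.
exact: cP Cmax Cm.
Qed.

Lemma code_essentialP c : code_essential c G <-> essential (cset G c).
Proof.
have subg d : almost_essential (cset G d) -> is_subgroup (cset G d) by move=> [[[]]].
split=> [[/code_almost_essentialP calm [n [cn nP]]]|[calm [n cn nP]]].
  split=> //; exists n; first by apply/code_has_depthP => //; exact: subg.
  move=> K e Kalm Ke; have oK : open_subgroup K by have [[]] := Kalm.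
  have [d dE] := cset_open_subgroup olG oK; rewrite dE in Kalm Ke.
  apply: (nP d); first exact/code_almost_essentialP.
  by apply/code_has_depthP => //; exact: subg.
split; first exact/code_almost_essentialP.
exists n; split; first by apply/code_has_depthP => //; exact: subg.
move=> d m /code_almost_essentialP dalm dm; apply: (nP (cset G d)) => //.
by apply/code_has_depthP => //; exact: subg.
Qed.

Lemma finitely_many_essentialP : finitely_many_essential (gt G) <->
  (exists c, code_essential c G) /\
  exists cs : seq coset_code, forall d, code_essential d G ->
    exists2 c, c \in cs & exists x, cset G d = conj_set (cset G c) x.
Proof.
have oess (U : set (gt G)) : essential U -> open_subgroup U by move=> [[[]]].
split=> [[[U Uess] [F /finite_seqP[Ks ->] KsP]]|[[c /code_essentialP cess] [cs csP]]].
  split.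
    have [c cE] := cset_open_subgroup olG (oess _ Uess).
    by exists c; apply/code_essentialP; rewrite -cE.
  have /choice[k kP] K : exists e, open_subgroup K -> K = cset G e.
    have [/(cset_open_subgroup olG)[e eE]|no] := pselect (open_subgroup K); first by exists e.
    by exists code_setT => /no.
  exists (map k Ks) => d /code_essentialP dess; have [K KKs [g dE]] := KsP _ dess.
  exists (k K); first exact: map_f.
  exists g; rewrite -kP// -(conj_setK g K) -dE.
  by apply: conj_set_open_subgroup; exact: oess.
split; first by exists (cset G c).
exists (cset G @` [set` cs]); first exact/finite_image/finite_seq.
move=> U Uess; have [d dE] := cset_open_subgroup olG (oess _ Uess).
rewrite dE in Uess *; have [e ecs eE] := csP d ((code_essentialP d).2 Uess).
by exists (cset G e) => //; exists e.
Qed.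

End essential_codes.

Lemma borel_finitely_many_essential_class : borel finitely_many_essential_class.
Proof.
apply: (@borel_ext (fun G => oligomorphic G /\ ((exists c, code_essential c G) /\
    exists cs : seq coset_code, forall d, code_essential d G ->
    exists2 c, c \in cs & exists x, cset G d = conj_set (cset G c) x))).
  by move=> G; split=> -[olG] /(finitely_many_essentialP olG).
apply: borel_and borel_oligomorphic _; apply: borel_and.
  by apply: borel_ex => c; exact: borel_code_essential.
apply: borel_ex => cs; apply: borel_all => d.
apply: borel_imp (borel_code_essential _) _.
by apply: borel_in_ex => c; exact: borel_is_conj.
Qed.

Lemma borel_essential c :
  borel (fun G => finitely_many_essential_class G /\ essential (cset G c)).
Proof.
apply: borel_ext (borel_and borel_finitely_many_essential_class (borel_code_essential c)).
by move=> G; split=> -[CG]; have [olG _] := CG; move/(code_essentialP olG).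
Qed.

Theorem theorem1p2 (R : realType) (C : set closed_subgroup)
    (HC : C = no_algebraicity_class \/ C = finitely_many_essential_class) :
  smooth_on R C closed_subgroup_iso /\
  (forall G : closed_subgroup, C G ->
     profinite (out (set_type G)) /\
     exists2 H : closed_subgroup, oligomorphic H &
       topologically_isomorphic (aut (set_type G)) (set_type H)).
Proof.
suff [D [bC olC admC D_inv bD]] : exists D : forall G : closed_subgroup, set (set (gt G)),
    [/\ borel C, forall G, C G -> oligomorphic G, forall G, C G -> admissible (D G),
      forall (G H : closed_subgroup) (f : gt G -> gt H), C G -> C H ->
        topological_isomorphism f -> forall U, D G U -> D H (f @` U) &
      forall c, borel (fun G => C G /\ D G (cset G c))].
  split; first exact: smooth_of_family bC olC admC D_inv bD.
  by move=> G; exact: aut_of_family olC admC D_inv _.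
have [->|->] := HC.
  exists point_stabilizers; split.
  - exact: borel_no_algebraicity_class.
  - by move=> G [].
  - by move=> G [olG _]; exact: point_stabilizers_admissible.
  - move=> G H f [_ noG] [_ noH] ft U; exact: point_stabilizers_iso.
  - exact: borel_point_stabilizers.
exists (fun G => [set U | essential U]); split.
- exact: borel_finitely_many_essential_class.
- by move=> G [].
- by move=> G [olG GE]; exact: essential_admissible.
- by move=> G H f _ _ ft U; exact: image_essential.
- exact: borel_essential.
Qed.
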